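(* For any orbit data $\tau$ with $\lambda(w_\tau)>1$, there is an orbit data $\check\tau=(\check n,\check\sigma,\check\kappa)$ such that $\lambda(w_{\check\tau})=\lambda(w_\tau)>1$ and $\check\tau$ satisfies the realizability condition $$w_{\check\tau}^k(\alpha)\ne\alpha\qquad(\alpha\in\Gamma(\check\tau),\ k\ge1).$$ In particular, $\check\tau$ is realized by an $\check n$-tuple $\overline f_{\check\tau}\in\mathcal{Q}(C)^{\check n}$ with $\delta(\overline f_{\check\tau})=\lambda(w_{\check\tau})$.
   Context: **Lattice.** For $N\ge3$, $\mathbb{Z}^{1,N}=\bigoplus_{i=0}^N\mathbb{Z}e_i$ with $(e_0,e_0)=1$, $(e_i,e_i)=-1$ $(i\ge1)$, $(e_i,e_j)=0$ $(i\ne j)$. $W_N\subset O(\mathbb{Z}^{1,N})$ is generated by $\rho_i(x)=x+(x,\alpha_i)\alpha_i$ $(0\le i\le N-1)$, $\alpha_0=e_0-e_1-e_2-e_3$, $\alpha_i=e_i-e_{i+1}$ $(i\ge 1)$. The root system is $\Phi_N=\bigcup_{i=0}^{N-1}W_N\alpha_i$. $\lambda(w)$ is the spectral radius of $w$. **Orbit data.** $\mathcal{K}(n)=\{(i,j):1\le i\le n,\ 1\le j\le3\}$. An orbit data is $\tau=(n,\sigma,\kappa)$ with $n\ge1$ an integer, $\sigma$ a permutation of $\mathcal{K}(n)$, and $\kappa:\mathcal{K}(n)\to\mathbb{Z}_{\ge0}$ such that $\mu(\iota):=\kappa(\iota)n+i_1-i-1\ge0$ for all $\iota=(i,j)$,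 where $\sigma^m(\iota)=(i_m,j_m)$. Put $N=\sum_\iota\kappa(\iota)$ and $\bar\sigma(\iota)=\sigma^k(\iota)$ with $k\ge0$ least such that $\kappa(\sigma^k(\iota))\ge1$. Let $\mathbb{Z}^\tau=\mathbb{Z}e_0\oplus\bigoplus_{\iota}\bigoplus_{k=1}^{\kappa(\iota)}\mathbb{Z}e_\iota^k\cong\mathbb{Z}^{1,N}$, an orthogonal basis with $(e_0,e_0)=1$, $(e_\iota^k,e_\iota^k)=-1$. Define $r_\tau$ by $e_0\mapsto e_0$, $e^1_{\bar\sigma(\sigma(\iota))}\mapsto e_\iota^{\kappa(\iota)}$ if $\kappa(\iota)\ge1$, $e_\iota^k\mapsto e_\iota^{k-1}$ for $2\le k\le\kappa(\iota)$. For $1\le m\le n$ define $q_m$ by $e_0\mapsto2e_0-\sum_{l=1}^3e^1_{\bar\sigma(m,l)}$, $e^1_{\bar\sigma(m,a)}\mapsto e_0-e^1_{\bar\sigma(m,b)}-e^1_{\bar\sigma(m,c)}$ for $\{a,b,c\}=\{1,2,3\}$, and all other basis vectors fixed. Then $w_\tau:=r_\tau\circ q_1\circ\cdots\circ q_n\in W_N$. **The finite set $\Gamma(\tau)\subset\Phi_N$.** Put $\theta_{i,i'}(k)=kn+i'-i$. For $1\le\ell\le n$ let $\alpha_\ell^c=q_n\circ\cdots\circ q_{\ell+1}(e_0-e^1_{\bar\sigma(\ell,1)}-e^1_{\bar\sigma(\ell,2)}-e^1_{\bar\sigma(\ell,3)})$, and $\Gamma_1(\tau)=\{\alpha^c_\ell\}_{\ell=1}^n$.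 For $\iota=(i,j),\iota'=(i',j')\in\mathcal{K}(n)$ and $k$ with $0\le\theta_{i,i'}(k)\le\mu(\iota)$ let $\alpha^k_{\iota,\iota'}=q_n\circ\cdots\circ q_{i'+1}(e_{\bar\sigma(\iota)}^{k+1}-e^1_{\bar\sigma(\iota')})$, where, if $\kappa(\iota)\ge1$ and $k=\kappa(\iota)$, the symbol $e_{\bar\sigma(\iota)}^{\kappa(\iota)+1}$ is read as $e^1_{\bar\sigma(\sigma(\iota))}$. $\Gamma_2^1(\tau)$ is the set of all $\alpha_{\iota,\iota'}^k$ with $0<\theta_{i,i'}(k)\le\mu(\iota)$ for which there is $h\ge0$ with $\mu(\sigma^\ell(\iota))=\mu(\sigma^\ell(\iota'))+\delta_{\ell,0}\,\theta_{i,i'}(k)$ for $0\le\ell\le h-1$ and $\mu(\sigma^h(\iota))<\mu(\sigma^h(\iota'))+\delta_{h,0}\,\theta_{i,i'}(k)$ (Kronecker deltas). $\Gamma_2^2(\tau)$ is the set of all $\alpha^0_{\iota,\iota'}$ with $i=i'$, $j\ne j'$, $\mu(\sigma^\ell(\iota))=\mu(\sigma^\ell(\iota'))$ for all $\ell\ge0$, and $\iota'=\sigma^h(\iota)$ for some $h\ge1$. $\Gamma_2(\tau)=\Gamma_2^1(\tau)\cup\Gamma_2^2(\tau)$ and $\Gamma(\tau)=\Gamma_1(\tau)\cup\Gamma_2(\tau)$. **Points.** Points of $\mathbb{P}^2$ may be proper or infinitely near: a point is a class $[x,\pi]$, $\pi:\hat X\to\mathbb{P}^2$ a composition of point blowups,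 $x\in\hat X$, where $(x_1,\pi_1)\sim(x_2,\pi_2)$ if $\pi_1^{-1}\circ\pi_2$ is locally biholomorphic at $x_2$ and sends $x_2$ to $x_1$. For a birational map $f$, $I(f)$ is the finite set of all (proper and infinitely near) base points; $f$ induces a bijection from points not in $I(f)$ to points not in $I(f^{-1})$: $[x,\pi]\mapsto[y,\nu]$ where $\nu^{-1}\circ f\circ\pi$ is locally biholomorphic at $x$ and sends $x$ to $y$. For a quadratic birational map, $I(f^{\pm1})=\{p_1^\pm,p_2^\pm,p_3^\pm\}$, with labels matched so that the lift $\tilde f:X^+\to X^-$ of $f$ between the blowups of $I(f)$ and $I(f^{-1})$ satisfies $\tilde f^*[E_a^-]=[H^+]-[E_b^+]-[E_c^+]$ for $\{a,b,c\}=\{1,2,3\}$ ($E_a^\pm$ the exceptional divisor, i.e. total transform, over $p_a^\pm$; $H^\pm$ the total transform of a line). **Realization.** Consider $\overline f=(f_1,\dots,f_n)$, $f_\ell:\mathbb{P}^2_{\ell-1}\to\mathbb{P}^2_\ell$ quadratic birational, $\mathbb{P}^2_\ell$ copies of $\mathbb{P}^2$, $\mathbb{P}^2_0=\mathbb{P}^2_n$ (points on different copies are regarded as different), $I(f_\ell)=\{p^+_{\ell,j}\}_{j=1}^3\subset\mathbb{P}^2_{\ell-1}$, $I(f_\ell^{-1})=\{p^-_{\ell,j}\}_{j=1}^3\subset\mathbb{P}^2_\ell$ with matched labels. For $\iota=(i,j)$ put $p_\iota^0=p_\iota^-$ and $p_\iota^m=f_\ell(p_\iota^{m-1})\in\mathbb{P}^2_\ell$,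 $\ell\equiv i+m$ mod $n$. $\overline f$ is a realization of $\tau$ (and $\tau$ is realized by $\overline f$) if for every $\iota\in\mathcal{K}(n)$: $p_\iota^m\ne p_{\iota'}^+$ for $0\le m<\mu(\iota)$ and all $\iota'\in\mathcal{K}(n)$, and $p_\iota^{\mu(\iota)}=p_{\sigma(\iota)}^+$. **Cubic.** $C=\{yz^2=x^3\}\subset\mathbb{P}^2$, $C^*=C\setminus\{[0:1:0]\}$, parametrized by $t\mapsto[t:t^3:1]$. An infinitely near point lies on $C^*$ if it is obtained by blowing up a proper point of $C^*$ and successively the intersection points of the strict transform of $C^*$ with the last exceptional curve. $\mathcal{Q}(C)$ is the set of quadratic birational maps $f$ of $\mathbb{P}^2$ with $f(C):=\overline{f(C\setminus I(f))}=C$ and all points of $I(f)$ on $C^*$; such $f$ restricts to $C^*\cong\mathbb{C}$ as $t\mapsto\delta(f)t+c(f)$, $\delta(f)\in\mathbb{C}^\times$. $\delta(\overline f)=\prod_\ell\delta(f_\ell)$. *)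

(* Defs.v *)
From HB Require Import structures.
From mathcomp Require Import all_boot all_order all_fingroup all_algebra.
From mathcomp Require Import complex.
From mathcomp Require Import all_classical all_reals all_analysis.
From mathcomp Require Import -(notations) mpoly.
Set Implicit Arguments.
Unset Strict Implicit.
Unset Printing Implicit Defensive.
Import Order.TTheory GRing.Theory Num.Theory.
Import numFieldNormedType.Exports.
Local Open Scope classical_set_scope.
Local Open Scope ring_scope.

(** * Orbit data *)

(* K(n): the indices i and j are counted from 0. *)
Definition Kset (n : nat) : finType := ('I_n * 'I_3)%type.

(* [od_admissible] is mu >= 0, i.e. kappa(i,j) * n + i_1 - i - 1 >= 0, written
   without subtraction. *)
Record orbit_data := OrbitData {
  od_n : nat;
  od_sigma : {perm Kset od_n};
  od_kappa : Kset od_n -> nat;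
  od_n_gt0 : (0 < od_n)%N;
  od_admissible : forall iota : Kset od_n,
    (iota.1 < od_kappa iota * od_n + (od_sigma iota).1)%N
}.

Arguments od_sigma : clear implicits.
Arguments od_kappa : clear implicits.

Section OrbitData.
Variable tau : orbit_data.
Local Notation n := (od_n tau).
Local Notation sigma := (od_sigma tau).
Local Notation kappa := (od_kappa tau).
Local Notation K := (Kset n).
Implicit Types (iota : K) (k h l : nat).

(* The truncated subtraction is exact by [od_admissible]. *)
Definition mu iota : nat := (kappa iota * n + (sigma iota).1 - iota.1.+1)%N.

(* First point of the cycle iota, sigma iota, sigma^2 iota, ... with kappa >= 1.
   It exists: the sum of mu over a cycle of length c is n (sum of kappa) - c. *)
Definition sigma_bar iota : K :=
  head iota [seq x <- fingraph.orbit sigma iota | (0 < kappa x)%N].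

(* Basis of Z^tau: None is e_0, and the index (iota, k) with 0 <= k < kappa iota
   is e_iota^(k+1). *)
Definition basis : finType := option {iota : K & 'I_(kappa iota)}.

Definition lattice := {ffun basis -> int}.

Definition e0 : lattice := [ffun b : basis => (b == None)%:R].

(* The superscript k is counted from 1, as in e_iota^k; the vector is 0 when k is
   not in the range 1..kappa iota, a case which is never used. *)
Definition e (iota : K) (k : nat) : lattice :=
  [ffun b : basis => (if b is Some ik then
     ((tag ik == iota) && ((tagged ik : nat).+1 == k))%:R else 0) : int].

Definition linear_ext (g : basis -> lattice) (v : lattice) : lattice :=
  \sum_b g b *~ v b.

Definition r_basis (b : basis) : lattice :=
  match b with
  | None => e0
  | Some ik =>
    if (tagged ik : nat) is k'.+1 then e (tag ik) k'.+1
    else if [pick iota | (0 < kappa iota)%N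
                         && (sigma_bar (sigma iota) == tag ik)] is Some iota
    then e iota (kappa iota) else 0
  end.

Definition r_tau : lattice -> lattice := linear_ext r_basis.

Definition e1_bar (m : 'I_n) (a : 'I_3) : lattice := e (sigma_bar (m, a)) 1.

Definition q_basis (m : 'I_n) (b : basis) : lattice :=
  match b with
  | None => e0 *+ 2 - \sum_l e1_bar m l
  | Some ik =>
    if [pick a | (tag ik == sigma_bar (m, a)) && ((tagged ik : nat) == 0)%N]
      is Some a
    then e0 - \sum_(l | l != a) e1_bar m l
    else e (tag ik) (tagged ik).+1
  end.

Definition q (m : 'I_n) : lattice -> lattice := linear_ext (q_basis m).

(* r o q_1 o ... o q_n *)
Definition w (v : lattice) : lattice := r_tau (foldr q v (enum 'I_n)).

(* q_n o ... o q_(l+1) *)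
Definition q_above (l : 'I_n) (v : lattice) : lattice :=
  foldl (fun u m => q m u) v [seq m : 'I_n <- enum 'I_n | (l < m)%N].

Definition alpha_c (l : 'I_n) : lattice := q_above l (e0 - \sum_a e1_bar l a).

Definition Gamma1 : set lattice := range alpha_c.

(* theta is only used where it is nonnegative: it is required to be positive in
   [Gamma21], and it is 0 in [Gamma22]. *)
Definition theta (i i' : 'I_n) (k : nat) : nat := (k * n + i' - i)%N.

Definition e_next iota k : lattice :=
  if (0 < kappa iota)%N && (k == kappa iota) then e (sigma_bar (sigma iota)) 1
  else e (sigma_bar iota) k.+1.

Definition alpha iota iota' k : lattice :=
  q_above iota'.1 (e_next iota k - e (sigma_bar iota') 1).

Definition Gamma21 : set lattice := [set v | exists iota iota' k,
  let t := theta iota.1 iota'.1 k in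
  [/\ (0 < t <= mu iota)%N,
      exists h,
        (forall l, (l < h)%N -> mu (iter l sigma iota) =
           (mu (iter l sigma iota') + (l == 0) * t)%N) /\
        (mu (iter h sigma iota) <
           mu (iter h sigma iota') + (h == 0) * t)%N
    & v = alpha iota iota' k]].

Definition Gamma22 : set lattice := [set v | exists iota iota',
  [/\ iota.1 = iota'.1, iota.2 <> iota'.2,
      forall l, mu (iter l sigma iota) = mu (iter l sigma iota'),
      exists h, (0 < h)%N /\ iota' = iter h sigma iota
    & v = alpha iota iota' 0]].

Definition Gamma : set lattice := Gamma1 `|` (Gamma21 `|` Gamma22).

Definition realizability : Prop :=
  forall v, Gamma v -> forall k, (0 < k)%N -> iter k w v <> v.

Definition unit_vector (b : basis) : lattice := [ffun b' => (b' == b)%:R].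

(* Row i holds the coordinates of the image of the i-th basis vector. *)
Definition w_matrix : 'M[int]_#|basis| :=
  \matrix_(i, j) w (unit_vector (enum_val i)) (enum_val j).

Definition spectral_radius (R : realType) (m : nat) (M : 'M[R[i]]_m) : R :=
  sup [set Normc.normc a | a in [set a | eigenvalue M a]].

Definition lambda (R : realType) : R :=
  spectral_radius (map_mx intr w_matrix : 'M[R[i]]_#|basis|).

End OrbitData.

(** * Points of the projective plane, proper or infinitely near *)

Section Plane.
Variable C : numFieldType.

Definition vec3 (x y z : C) : 'rV[C]_3 :=
  \row_(k < 3) nth 0 [:: x; y; z] k.

Definition collinear (x y : 'rV[C]_3) : Prop := exists k : C, x = k *: y.

(* Affine a b = [a:b:1], AtInfinity a = [a:1:0], LastPoint = [1:0:0]. *)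
Inductive proper_point := Affine of C & C | AtInfinity of C | LastPoint.

HB.instance Definition _ := gen_eqMixin proper_point.

(* Affine coordinates (u,v) of the plane centred at p. *)
Definition proper_chart (p : proper_point) (z : C * C) : 'rV[C]_3 :=
  match p with
  | Affine a b => vec3 (a + z.1) (b + z.2) 1
  | AtInfinity a => vec3 (a + z.1) 1 z.2
  | LastPoint => vec3 1 z.1 z.2
  end.

(* The blowup of the origin of C^2, in coordinates centred at the point of the
   exceptional curve with direction [1:c] (Some c) or [0:1] (None), together with
   the equation of the exceptional curve in these coordinates. *)
Definition blowup_chart (d : option C) (z : C * C) : C * C :=
  if d is Some c then (z.1, z.1 * (z.2 + c)) else (z.1 * z.2, z.2).

Definition exceptional_coord (d : option C) (z : C * C) : C :=
  if d is Some _ then z.1 else z.2.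

(* A class [x, pi] only depends on the blowups whose centres lie under x, so it is
   given by a proper point and the successive directions of the points blown up
   above it, the last of them being x: two such pairs are equivalent if and only
   if they are equal. [chart p] is pi in coordinates centred at x. *)
Definition point := (proper_point * seq (option C))%type.

Definition chart (p : point) (z : C * C) : 'rV[C]_3 :=
  proper_chart p.1 (foldr blowup_chart z p.2).

(* Local equation, in the coordinates of [chart q], of the total transform of the
   exceptional curve E_p over p. It is 1 unless q is infinitely near to p; when
   q = p there is no E_p yet. *)
Definition exceptional_eq (p q : point) (z : C * C) : C :=
  if (q.1 == p.1) && prefix p.2 q.2 then
    if drop (size p.2) q.2 is d :: ds
    then exceptional_coord d (foldr blowup_chart z ds) else 1
  else 1.

Definition holomorphic_at0 (V : normedModType C) (h : C * C -> V) : Prop :=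
  \forall z \near (0 : C * C), differentiable h z.

Definition local_biholomorphism (phi : C * C -> C * C) : Prop :=
  [/\ phi 0 = 0, holomorphic_at0 phi &
   exists psi : C * C -> C * C,
     [/\ psi 0 = 0, holomorphic_at0 psi,
         \forall z \near (0 : C * C), psi (phi z) = z
       & \forall z \near (0 : C * C), phi (psi z) = z]].

(** * Birational maps *)

Local Notation form := (mpoly 3 C).

Definition homog (d : nat) (P : form) : Prop := P \is ishomog1 d mdeg.

Definition form_eval (P : form) (x : 'rV[C]_3) : C :=
  meval (fun i => x 0 i) P.

(* [rat_coprime] says that the forms have no common factor of positive degree
   (factors of forms are forms); in particular they are not all 0. *)
Record rational_map := RationalMap {
  rat_deg : nat;
  rat_form : 'I_3 -> form;
  rat_homog : forall k, homog rat_deg (rat_form k);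
  rat_coprime : forall (d : nat) (g : form) (h : 'I_3 -> form),
    homog d g -> (forall k, rat_form k = g * h k) -> d = 0%N
}.

Definition rat_eval (f : rational_map) (x : 'rV[C]_3) : 'rV[C]_3 :=
  \row_k form_eval (rat_form f k) x.

Definition left_inverse (g f : rational_map) : Prop :=
  (forall x, collinear (rat_eval g (rat_eval f x)) x) /\
  (exists x, rat_eval g (rat_eval f x) != 0).

Record quadratic_map := QuadraticMap {
  quad_map :> rational_map;
  quad_inv : rational_map;
  quad_deg : rat_deg quad_map = 2;
  quad_mapK : left_inverse quad_inv quad_map;
  quad_invK : left_inverse quad_map quad_inv
}.

(* f o pi does not extend holomorphically to the point p. *)
Definition base_point (f : rational_map) (p : point) : Prop :=
  ~ exists h : C * C -> 'rV[C]_3,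
      [/\ holomorphic_at0 h, h 0 != 0
        & \forall z \near (0 : C * C), collinear (rat_eval f (chart p z)) (h z)].

(* phi is nu^-1 o f o pi in the coordinates at p = [x, pi] and p' = [y, nu]. *)
Definition lifts_to (f : rational_map) (p p' : point) (phi : C * C -> C * C) :
    Prop :=
  local_biholomorphism phi /\
  \forall z \near (0 : C * C),
    collinear (rat_eval f (chart p z)) (chart p' (phi z)).

Definition maps_to (f : rational_map) (p p' : point) : Prop :=
  exists phi, lifts_to f p p' phi.

(* [f~^* E^-_a] = [H^+] - sum_(b <> a) [E^+_b] in the Picard group of X^+, as a
   linear equivalence: the divisor f~^* E^-_a + sum_(b <> a) E^+_b - (total
   transform of the line L = 0) is the divisor of the rational function A / B.
   The identity of divisors is tested at every point p not in I(f); these are the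
   points of X^+ and the points infinitely near to them, and f~ sends p to p'. *)
Definition matched_label (f : quadratic_map) (pplus pminus : 'I_3 -> point)
    (a : 'I_3) : Prop :=
  exists (L : form) (d : nat) (A B : form),
    [/\ homog 1 L /\ L != 0, homog d A /\ A != 0, homog d B /\ B != 0
      & forall p p' phi, lifts_to f p p' phi ->
        exists g : C * C -> C,
          [/\ holomorphic_at0 (g : C * C -> C^o), g 0 != 0
            & \forall z \near (0 : C * C),
              form_eval A (chart p z) * form_eval L (chart p z) =
              g z * form_eval B (chart p z) *
              (exceptional_eq (pminus a) p' (phi z) *
               \prod_(b | b != a) exceptional_eq (pplus b) p z)]].

Definition labelling (f : quadratic_map) (pplus pminus : 'I_3 -> point) : Prop :=
  [/\ injective pplus /\ (forall p, base_point f p <-> exists j, p = pplus j),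
      injective pminus /\
        (forall p, base_point (quad_inv f) p <-> exists j, p = pminus j)
    & forall a, matched_label f pplus pminus a].

(** * Realization of an orbit data *)

(* A point of the copy P^2_k is a pair (k, point). With indices counted from 0,
   f_i goes from the copy i to the copy i + 1 mod n, which is [ordS i]. *)
Definition realizes (tau : orbit_data) (f : 'I_(od_n tau) -> quadratic_map) :
    Prop :=
  exists pplus pminus : Kset (od_n tau) -> point,
  (forall l, labelling (f l) (fun j => pplus (l, j)) (fun j => pminus (l, j))) /\
  exists p : Kset (od_n tau) -> nat -> 'I_(od_n tau) * point,
  forall iota,
  [/\ p iota 0%N = (ordS iota.1, pminus iota),
      forall m, (m < mu iota)%N -> (p iota m.+1).1 = ordS (p iota m).1 /\
        maps_to (f (p iota m).1) (p iota m).2 (p iota m.+1).2,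
      forall m, (m < mu iota)%N -> forall iota',
        p iota m <> (iota'.1, pplus iota')
    & p iota (mu iota) =
        ((od_sigma tau iota).1, pplus (od_sigma tau iota))].

(** * The cuspidal cubic *)

(* The cone of nonzero representatives of the points of y z^2 = x^3. *)
Definition cubic : set 'rV[C]_3 :=
  [set x | x != 0 /\ x 0 1 * x 0 2%:R ^+ 2 = x 0 0 ^+ 3].

Definition cubic_param (t : C) : 'rV[C]_3 := vec3 t (t ^+ 3) 1.

(* p is over a proper point of C^* and lies on the strict transform of C, the
   closure of the inverse image of C minus that proper point. *)
Definition on_Cstar (p : point) : Prop :=
  (exists t, p.1 = Affine t (t ^+ 3)) /\
  closure [set z | cubic (chart p z) /\
                   ~ collinear (chart p z) (proper_chart p.1 0)] (0 : C * C).

(* The closure in the plane is computed on cones: the proper points of I(f) are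
   the common zeros of the forms of f, and the projection from C^3 minus 0 to the
   plane is an open quotient map. *)
Definition in_QC (f : quadratic_map) : Prop :=
  closure (rat_eval f @` [set x | cubic x /\ rat_eval f x != 0])
    `&` [set x | x != 0] = cubic /\
  (forall p, base_point f p -> on_Cstar p).

(* d is delta(f). *)
Definition is_delta (f : quadratic_map) (d : C) : Prop :=
  d != 0 /\ exists c : C, forall t, rat_eval f (cubic_param t) != 0 ->
    collinear (rat_eval f (cubic_param t)) (cubic_param (d * t + c)).

End Plane.

(* Main.v *)
Require Import Defs.
From mathcomp Require Import all_boot all_order all_fingroup all_algebra.
From mathcomp Require Import complex.
From mathcomp Require Import all_classical all_reals all_analysis.
From mathcomp Require Import -(notations) mpoly.
From mathcomp Require Import zify ring lra.
Set Implicit Arguments.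
Unset Strict Implicit.
Unset Printing Implicit Defensive.
Import Order.TTheory GRing.Theory Num.Theory.
Import numFieldNormedType.Exports.
Local Open Scope classical_set_scope.
Local Open Scope ring_scope.

(** The eigenvalue lambda of w gives a real function rho on the basis of Z^tau, with rho(e_0) = 1
    and rho o w = lambda^-1 rho. Recording only its values on e_0 and on the exceptional classes, w is
    a sequence of quadratic steps from these values to the same values divided by lambda. A step is
    induced by a quadratic map with three distinct proper base points on C^* when the three values it
    uses are distinct and their sum is not the value of e_0. A step which violates this is the
    identity or the composite of steps of the good kind using a further exceptional value: otherwise
    the identities rho(e_0)^2 = sum rho(e)^2 and 3 rho(e_0) = sum rho(e) would make all values
    commensurable, hence lambda = 1.

    Along the new sequence the values, shifted so that three points of C^* are collinear when their
    parameters sum to 0, are the parameters of the base points of quadratic maps preserving C. The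
    new orbit data records when the base points of the inverses, followed on C^* through infinitely
    near points, next hit a base point. The values form an eigenfunction for the new w as well, so
    that lambda is unchanged. A periodic root is annihilated by this function; for a root of
    Gamma_2 two of the followed points then have the same parameter, and their heights over it,
    whose order is preserved by the maps, contradict the definition of Gamma_2. *)

(** * Functions on the basis of the lattice *)

Section Functionals.
Variables (tau : orbit_data) (F : fieldType).
Local Notation n := (od_n tau).
Local Notation sigma := (od_sigma tau).
Local Notation kappa := (od_kappa tau).
Local Notation K := (Kset n).
Local Notation basis := Defs.basis.
Local Notation lattice := Defs.lattice.
Implicit Types (iota : K) (rho : basis tau -> F).

(** At a step of w_tau the values of the eigenfunction may coincide or be those of collinear points;
    the base points prescribed there are then infinitely near or collinear, and tau itself need not
    satisfy the condition. So tau is discarded, and only the path of multisets of values is kept.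
    Further values needed for perturbing a step are supplied by two zeros: these can be adjoined
    freely, since the path has to close up only after multiplication by lambda, which fixes 0. A
    multiset forgets to which orbit a value belongs, so the orbits are rebuilt. Equal values are
    separated by heights: a value of multiplicity m stands for the points of heights 0, ..., m - 1
    over one point of C^*. Once p_a^+ is sent to p_a^-, each map is a bijection between such finite
    sets of points. Every orbit is therefore periodic, and cutting it at the base points gives the
    new orbit data. As all base points are proper and distinct, every map is the standard involution
    X_a |-> X_b X_c in the coordinates given by the sides of two triangles, and all local questions
    become computations with these sides. *)

Definition ext rho (v : lattice tau) : F := \sum_b rho b *~ v b.

Lemma extD rho u v : ext rho (u + v) = ext rho u + ext rho v.
Proof. by rewrite /ext -big_split; apply: eq_bigr => b _; rewrite ffunE mulrzDr. Qed.

Lemma extN rho u : ext rho (- u) = - ext rho u.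
Proof. by rewrite /ext -sumrN; apply: eq_bigr => b _; rewrite ffunE mulrNz. Qed.

Lemma extB rho u v : ext rho (u - v) = ext rho u - ext rho v.
Proof. by rewrite extD extN. Qed.

Lemma ext0 rho : ext rho 0 = 0.
Proof. by rewrite /ext big1 // => b _; rewrite ffunE mulr0z. Qed.

Lemma extMz rho u (k : int) : ext rho (u *~ k) = ext rho u *~ k.
Proof.
case: k => k; rewrite ?NegzE ?mulrNz ?extN.
  by elim: k => [|k IH]; rewrite ?mulr0n ?mulr0z ?ext0 // !intS !mulrzDr extD !mulr1z IH.
congr (- _); elim: (k.+1) => [|m IH]; first by rewrite !mulr0z ext0.
by rewrite !intS !mulrzDr extD !mulr1z IH.
Qed.

Lemma ext_sum (I : Type) (r : seq I) (P : pred I) rho (g : I -> lattice tau) :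
  ext rho (\sum_(i <- r | P i) g i) = \sum_(i <- r | P i) ext rho (g i).
Proof. exact: (big_morph _ (extD rho) (ext0 rho)). Qed.

Lemma ext_unit rho b : ext rho (unit_vector b) = rho b.
Proof.
rewrite /ext (bigD1 b) //= big1 ?addr0; first by rewrite ffunE eqxx mulr1z.
by move=> c ncb; rewrite ffunE (negbTE ncb) mulr0z.
Qed.

Lemma eq_ext rho rho' : rho =1 rho' -> ext rho =1 ext rho'.
Proof. by move=> E v; apply: eq_bigr => b _; rewrite E. Qed.

Lemma extZ c rho v : ext (fun b => c * rho b) v = c * ext rho v.
Proof. by rewrite /ext mulr_sumr; apply: eq_bigr => b _; rewrite mulrzAr. Qed.

Definition pull (g : lattice tau -> lattice tau) rho : basis tau -> F :=
  fun b => ext rho (g (unit_vector b)).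

Lemma linear_ext_unit (g : basis tau -> lattice tau) b :
  linear_ext g (unit_vector b) = g b.
Proof.
rewrite /linear_ext (bigD1 b) //= big1 ?addr0; first by rewrite ffunE eqxx mulr1z.
by move=> c ncb; rewrite ffunE (negbTE ncb) mulr0z.
Qed.

Lemma ext_linear rho (g : basis tau -> lattice tau) v :
  ext rho (linear_ext g v) = ext (pull (linear_ext g) rho) v.
Proof.
rewrite /linear_ext ext_sum; apply: eq_bigr => b _.
by rewrite extMz -[in LHS]linear_ext_unit.
Qed.

Lemma sigma0_lt iota : kappa iota = 0%N -> (iota.1 < (sigma iota).1)%N.
Proof. by move=> k0; have := od_admissible iota; rewrite k0 mul0n. Qed.

(* A cycle of [sigma] cannot avoid [kappa > 0], since [sigma] increases the index of the plane where
   [kappa] vanishes. *)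
Lemma sigma_bar_has iota : exists2 k, (0 < kappa (iter k sigma iota))%N &
  sigma_bar iota = iter k sigma iota /\
  forall l, (l < k)%N -> kappa (iter l sigma iota) = 0%N.
Proof.
have [k Pk min_k] : exists2 k, (0 < kappa (iter k sigma iota))%N &
    forall l, (l < k)%N -> kappa (iter l sigma iota) = 0%N.
  have ex : exists k, (0 < kappa (iter k sigma iota))%N.
    apply/not_existsP => no.
    have lt m : (iota.1 + m <= (iter m sigma iota).1)%N.
      elim: m => [|m IH]; first by rewrite addn0.
      have k0 : kappa (iter m sigma iota) = 0%N.
        by apply/eqP; rewrite -leqn0 leqNgt; apply/negP/no.
      by rewrite addnS (leq_ltn_trans IH) //= sigma0_lt.
    have := lt n; rewrite leqNgt => /negP; apply.
    by apply: (leq_trans (ltn_ord _)); rewrite leq_addl.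
  exists (ex_minn ex); first by case: ex_minnP.
  move=> l; case: ex_minnP => m _ mm lm; apply/eqP; rewrite -leqn0 leqNgt.
  by apply: contraL lm => /mm; rewrite -leqNgt.
exists k => //; split=> //.
have kord : (k < fingraph.order sigma iota)%N.
  rewrite ltnNge; apply/negP => le.
  have := Pk; rewrite -(subnK le) iterD fingraph.iter_order; last exact: perm_inj.
  rewrite min_k ?ltnn //.
  by rewrite -{2}(subnK le) -addn1 leq_add2l; exact: fingraph.order_gt0.
rewrite /sigma_bar -nth0 /fingraph.orbit.
have -> : fingraph.order sigma iota = (k + (fingraph.order sigma iota - k).-1.+1)%N.
  by rewrite prednK ?subn_gt0 // subnKC // ltnW.
rewrite trajectD filter_cat.
have -> : [seq x <- traject sigma iota k | (0 < kappa x)%N] = [::].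
  apply/eqP; rewrite -[_ == _]negbK -has_filter; apply/hasPn => x.
  by move=> /trajectP [l lk ->]; rewrite min_k.
by rewrite /= Pk.
Qed.

Lemma sigma_bar_gt0 iota : (0 < kappa (sigma_bar iota))%N.
Proof. by have [k Pk [-> _]] := sigma_bar_has iota. Qed.

Lemma sigma_bar_id iota : (0 < kappa iota)%N -> sigma_bar iota = iota.
Proof.
by have [[|k] _ [-> // H]] := sigma_bar_has iota; rewrite (H 0%N).
Qed.

(** The plane index strictly increases along the indices that [sigma_bar] skips, so the path from
    (m, a') cannot pass through (m, a) unless a = a'. The three classes used by [q m] are therefore
    distinct. *)
Lemma sigma_bar_inj (m : 'I_n) : injective (fun a => sigma_bar (m, a)).
Proof.
move=> a a' /=.
have [k Pk [-> H]] := sigma_bar_has (m, a).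
have [k' Pk' [-> H']] := sigma_bar_has (m, a').
have incr j iota : (forall l, (l < j)%N -> kappa (iter l sigma iota) = 0%N) ->
    (iota.1 + j <= (iter j sigma iota).1)%N.
  elim: j => [|j IH] Hj; first by rewrite addn0.
  rewrite addnS (leq_ltn_trans (IH _)) //=; first by move=> l lj; rewrite Hj // ltnW.
  by rewrite sigma0_lt // Hj.
have injit j : injective (iter j sigma).
  by elim: j => [|j IH] x y //= /perm_inj /IH.
wlog le : k k' a a' Pk H Pk' H' / (k <= k')%N.
  move=> W E; case: (leqP k k') => [le|/ltnW le]; first exact: (W k k').
  by apply/esym; apply: (W k' k).
rewrite -(subnKC le) iterD => /injit E.
have := incr (k' - k)%N (m, a'); rewrite -E /= => /(_ _) le0.
have : (m + (k' - k) <= m)%N.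
  by apply: le0 => l lt; apply: H'; apply: leq_trans lt (leq_subr _ _).
rewrite -[X in (_ <= X)%N]addn0 leq_add2l leqn0 => /eqP z.
by move: E; rewrite z => -[].
Qed.

Local Notation T := {iota : K & 'I_(kappa iota)}.

Definition basis_index iota (k : 'I_(kappa iota)) : T := existT (fun i => 'I_(kappa i)) iota k.

Lemma basis_index_inj iota k iota' k' : @basis_index iota k = @basis_index iota' k' -> iota = iota' /\ (k : nat) = k'.
Proof. by move=> E; have := congr1 tag E => /= E1; subst iota'; case/eqP: E; rewrite eq_Tagged /= => /eqP ->. Qed.

Lemma e_unit iota (k : 'I_(kappa iota)) :
  e iota k.+1 = unit_vector (Some (basis_index k)).
Proof.
apply/ffunP => -[[iota' k']|]; rewrite !ffunE //=.
congr (nat_of_bool _)%:R; rewrite eqSS; apply/andP/eqP => [[/eqP E /eqP Ek]|/Some_inj E].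
  by subst iota'; congr Some; congr existT; apply: val_inj.
by have [E1 E2] := @basis_index_inj _ _ iota k E; split; apply/eqP.
Qed.

Definition first_index iota : T := basis_index (Ordinal (sigma_bar_gt0 iota)).

Lemma e1_bar_unit m a : e1_bar m a = unit_vector (Some (first_index (m, a))).
Proof. by rewrite /e1_bar -e_unit. Qed.

Lemma first_index_inj (m : 'I_n) : injective (fun a => first_index (m, a)).
Proof. by move=> a a' /basis_index_inj [/sigma_bar_inj]. Qed.

Lemma e0_unit : e0 tau = unit_vector None.
Proof. by apply/ffunP => b; rewrite !ffunE. Qed.

(** Minus the value of rho on the root e_0 - e_a - e_b - e_c of the m-th step. As [q m] is the
    reflection in this root, precomposition with it subtracts the defect on e_0 and on the three
    classes. *)
Definition defect rho (m : 'I_n) : F := \sum_a rho (Some (first_index (m, a))) - rho None.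

Definition is_base (m : 'I_n) (b : basis tau) : bool :=
  if b is Some x then [exists a, x == first_index (m, a)] else true.

Lemma pull_q (m : 'I_n) rho b : pull (q m) rho b = rho b - (is_base m b)%:R * defect rho m.
Proof.
rewrite /pull /q linear_ext_unit; case: b => [x|]; last first.
  rewrite /= extB e0_unit mulr2n extD ext_sum ext_unit mul1r opprB addrA.
  by congr (_ - _); apply: eq_bigr => a _; rewrite e1_bar_unit ext_unit.
rewrite /= ; case: pickP => [a /andP [/eqP Ea /eqP Ek]|no].
  have Ex : x = first_index (m, a).
    by case: x Ea Ek => i k /= E; subst i => Ek; congr existT; apply: val_inj; rewrite /= Ek.
  have -> : [exists a, x == first_index (m, a)] by apply/existsP; exists a; rewrite Ex.
  rewrite extB e0_unit ext_unit ext_sum Ex /defect [\sum_a0 rho _](bigD1 a) //=.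
  rewrite (eq_bigr (fun b => rho (Some (first_index (m, b))))); first by ring.
  by move=> b _; rewrite e1_bar_unit ext_unit.
have -> : [exists a, x == first_index (m, a)] = false.
  apply/negbTE/existsPn => a; apply/negP => /eqP Ex.
  by have := no a; rewrite Ex /= !eqxx.
by rewrite mul0r subr0 e_unit ext_unit; case: x {no}.
Qed.

Definition lorentz rho rho' : F := rho None * rho' None - \sum_x rho (Some x) * rho' (Some x).

Lemma sum_base (m : 'I_n) (f : T -> F) :
  \sum_x (is_base m (Some x))%:R * f x = \sum_a f (first_index (m, a)).
Proof.
rewrite (eq_bigr (fun x => \sum_a (x == first_index (m, a))%:R * f x)).
  rewrite exchange_big; apply: eq_bigr => a _.
  rewrite (bigD1 (first_index (m, a))) //= eqxx mul1r big1 ?addr0 // => x /negbTE ->.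
  by rewrite mul0r.
move=> x _; rewrite -mulr_suml; congr (_ * _) => /=.
case: existsP => [[a /eqP ->]|no]; last first.
  by rewrite big1 // => a _; case: eqP => // E; case: no; exists a; apply/eqP.
rewrite (bigD1 a) //= eqxx big1 ?addr0 // => b nb.
by case: eqP => // /first_index_inj E; rewrite E eqxx in nb.
Qed.

Lemma lorentz_q (m : 'I_n) rho rho' : lorentz (pull (q m) rho) (pull (q m) rho') = lorentz rho rho'.
Proof.
rewrite /lorentz !pull_q !mul1r.
set S := defect rho m; set S' := defect rho' m.
rewrite (eq_bigr (fun x => rho (Some x) * rho' (Some x) +
   ((is_base m (Some x))%:R * (S * S' - S * rho' (Some x) - S' * rho (Some x))))); last first.
  move=> x _; rewrite !pull_q -/S -/S'; case: (is_base _ _); rewrite ?mul1r ?mul0r; ring.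
rewrite big_split /= (sum_base m (fun x => S * S' - S * rho' (Some x) - S' * rho (Some x))).
rewrite !big_split /= !sumrN -!mulr_sumr sumr_const card_ord.
have -> : \sum_a rho (Some (first_index (m, a))) = S + rho None by rewrite /S /defect subrK.
have -> : \sum_a rho' (Some (first_index (m, a))) = S' + rho' None by rewrite /S' /defect subrK.
rewrite -mulr_natr; ring.
Qed.

Definition r_index_spec (x y : T) : Prop :=
  (tag y = tag x /\ (tagged y).+1 = tagged x :> nat) \/
  [/\ tagged x = 0%N :> nat, (tagged y).+1 = kappa (tag y)
    & sigma_bar (sigma (tag y)) = tag x].

(** Go backwards along [sigma] to the first index with kappa > 0; one exists because the cycle comes
    back to iota. Minimality of j prevents [sigma_bar] from stopping before iota. *)
Lemma sigma_bar_surj iota : (0 < kappa iota)%N ->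
  exists iota', (0 < kappa iota')%N && (sigma_bar (sigma iota') == iota).
Proof.
move=> k0; pose P j := (0 < j)%N && (0 < kappa (iter j (sigma^-1)%g iota))%N.
have ex : exists j, P j.
  exists (fingraph.order (sigma^-1)%g iota); rewrite /P fingraph.order_gt0 fingraph.iter_order //.
  exact: perm_inj.
case: (ex_minnP ex) => j /andP [j0 kj] mj.
exists (iter j (sigma^-1)%g iota); rewrite kj /=; apply/eqP.
have back l : (l <= j)%N -> iter l sigma (iter j (sigma^-1)%g iota) = iter (j - l) (sigma^-1)%g iota.
  elim: l => [|l IH] lj; first by rewrite subn0.
  by rewrite iterS IH 1?ltnW // -(subnSK lj) iterS permKV.
have [k Pk [-> H]] := sigma_bar_has (sigma (iter j (sigma^-1)%g iota)).
rewrite -iterSr in Pk *.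
have kj' : (k.+1 <= j)%N.
  rewrite ltnNge; apply/negP => jk.
  have := H j.-1; rewrite -iterSr prednK // back // subnn /= => H0.
  by move: k0; rewrite H0 // -(leq_add2r 1) !addn1 prednK.
rewrite back // in Pk *; case: (posnP (j - k.+1)) => [->//|p0].
have := mj (j - k.+1)%N; rewrite /P p0 Pk => /(_ isT).
by rewrite leqNgt ltn_subrL j0.
Qed.

Lemma r_basis_unit (x : T) : exists2 y, r_index_spec x y & r_basis (Some x) = unit_vector (Some y).
Proof.
case: x => iota [[|k] lt] /=; rewrite /r_basis /=; last first.
  by exists (basis_index (Ordinal (ltnW lt))); [left | rewrite -e_unit].
case: pickP => [iota' /andP [k0 /eqP E]|no]; last first.
  by have [iota' H] := sigma_bar_surj lt; rewrite no in H.
have lt' : ((kappa iota').-1 < kappa iota')%N by rewrite prednK.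
exists (basis_index (Ordinal lt')); first by right; rewrite /= prednK.
by rewrite -e_unit /= prednK.
Qed.

Lemma r_index_spec_inj x x' y : r_index_spec x y -> r_index_spec x' y -> x = x'.
Proof.
have ext2 (u v : T) : tag u = tag v -> (tagged u : nat) = tagged v -> u = v.
  by case: u v => [i k] [i' k'] /= E; subst i' => E; congr existT; apply: val_inj.
case=> [[E1 E2]|[E1 E2 E3]] [[F1 F2]|[F1 F2 F3]].
- by apply: ext2; rewrite -?E1 -?E2.
- by have := ltn_ord (tagged x); rewrite -E2 -E1 F2 ltnn.
- by have := ltn_ord (tagged x'); rewrite -F2 -F1 E2 ltnn.
- by apply: ext2; rewrite -?E3 ?E1.
Qed.

Definition r_index (x : T) : T := sval (cid2 (r_basis_unit x)).
Lemma r_indexP x : r_index_spec x (r_index x). Proof. by rewrite /r_index; case: cid2. Qed.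
Lemma r_index_inj : injective r_index.
Proof. by move=> x x' E; apply: (r_index_spec_inj (r_indexP x)); rewrite E; apply: r_indexP. Qed.

Lemma pull_r rho b : pull (@r_tau tau) rho b = if b is Some x then rho (Some (r_index x)) else rho None.
Proof.
rewrite /pull /r_tau linear_ext_unit; case: b => [x|]; last by rewrite /= e0_unit ext_unit.
by rewrite /r_index; case: cid2 => y /= _ ->; rewrite ext_unit.
Qed.

Lemma lorentz_r rho rho' : lorentz (pull (@r_tau tau) rho) (pull (@r_tau tau) rho') = lorentz rho rho'.
Proof.
rewrite /lorentz !pull_r [in RHS](reindex_inj r_index_inj); congr (_ - _).
by apply: eq_bigr => x _; rewrite !pull_r.
Qed.

(** Since w = r o q_1 o ... o q_n, precomposition takes up the q_m in the order of the list: rho o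
    r, rho o r o q_1, rho o r o q_1 o q_2, and so on. These are the values on the successive
    planes. *)
Definition stage rho (ms : seq 'I_n) : basis tau -> F :=
  foldl (fun r m => pull (q m) r) rho ms.

Lemma ext_foldr_q rho v ms : ext rho (foldr (@q tau) v ms) = ext (stage rho ms) v.
Proof.
elim: ms rho => //= m ms IH rho; by rewrite /q ext_linear IH.
Qed.

Lemma ext_w rho v : ext rho (w v) = ext (stage (pull (@r_tau tau) rho) (enum 'I_n)) v.
Proof. by rewrite /w /r_tau ext_linear ext_foldr_q. Qed.

Lemma lorentz_stage rho rho' ms : lorentz (stage rho ms) (stage rho' ms) = lorentz rho rho'.
Proof. by elim: ms rho rho' => //= m ms IH rho rho'; rewrite IH lorentz_q. Qed.

Lemma pull_w rho b : pull (@w tau) rho b = stage (pull (@r_tau tau) rho) (enum 'I_n) b.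
Proof. by rewrite /pull ext_w ext_unit. Qed.

Lemma lorentz_w rho rho' : lorentz (pull (@w tau) rho) (pull (@w tau) rho') = lorentz rho rho'.
Proof.
have E rho1 : pull (@w tau) rho1 = stage (pull (@r_tau tau) rho1) (enum 'I_n).
  by apply/funext => b; apply: pull_w.
by rewrite !E lorentz_stage lorentz_r.
Qed.

End Functionals.

(** * Eigenfunctions and eigenvectors of the matrix of w *)

Section FunctionalsMore.
Variables (tau : orbit_data) (F : fieldType).
Local Notation n := (od_n tau).
Local Notation basis := Defs.basis.
Implicit Types (rho : basis tau -> F).

Definition eigenfun rho (c : F) := forall b, pull (@w tau) rho b = c * rho b.

Lemma eigenfun_ext rho c v : eigenfun rho c -> ext rho (w v) = c * ext rho v.
Proof.
move=> H; rewrite ext_w -extZ; apply: eq_ext => b.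
by rewrite -pull_w H.
Qed.

Lemma eigenfunZ rho c k : eigenfun rho c -> eigenfun (fun b => k * rho b) c.
Proof. by move=> H b; rewrite /pull extZ mulrCA -H. Qed.

(** Precomposition with w is an isometry; hence two eigenfunctions are orthogonal unless c * c' =
    1. *)
Lemma lorentz_eigen rho c rho' c' : eigenfun rho c -> eigenfun rho' c' ->
  lorentz rho rho' = (c * c') * lorentz rho rho'.
Proof.
move=> H H'; rewrite -[LHS]lorentz_w /lorentz !H !H' mulrBr mulr_sumr.
congr (_ - _); first by ring.
by apply: eq_bigr => x _; rewrite H H'; ring.
Qed.

Lemma big_option (T : finType) (f : option T -> F) :
  \sum_b f b = f None + \sum_x f (Some x).
Proof.
rewrite (bigD1 None) //=; congr (_ + _).
rewrite (reindex_omap Some id); last by case.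
by apply: eq_bigl => x; rewrite /= eqxx.
Qed.

Definition w_mx : 'M[F]_#|basis tau| := map_mx intr (w_matrix tau).
Definition fun_col rho : 'cV[F]_#|basis tau| := \col_i rho (enum_val i).
Definition lorentz_mx : 'M[F]_#|basis tau| :=
  diag_mx (\row_i if enum_val i is None then 1 else -1).

Lemma lorentz_mxK : lorentz_mx *m lorentz_mx = 1%:M.
Proof.
rewrite /lorentz_mx mulmx_diag; apply/matrixP => i j; rewrite !mxE.
by case: (enum_val i) => [x|]; rewrite ?mulrNN mulr1.
Qed.

Lemma w_mx_col rho : w_mx *m fun_col rho = fun_col (pull (@w tau) rho).
Proof.
apply/colP => i; rewrite !mxE /pull /ext [RHS](reindex _ (onW_bij _ (enum_val_bij _))).
by apply: eq_bigr => j _; rewrite !mxE -[RHS]mulrzr mulrC.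
Qed.

Lemma fun_col_lorentz rho rho' : (fun_col rho)^T *m lorentz_mx *m fun_col rho' = (lorentz rho rho')%:M.
Proof.
rewrite /lorentz_mx mul_mx_diag; apply/matrixP => i j; rewrite !ord1 !mxE /= mulr1n.
pose G b := (if b is None then 1 else -1) * rho b * rho' b.
transitivity (\sum_(k < #|basis tau|) G (enum_val k)).
  by apply: eq_bigr => k _; rewrite !mxE /G; case: (enum_val k) => *; ring.
transitivity (\sum_b G b); first by rewrite [RHS](reindex _ (onW_bij _ (enum_val_bij _))).
rewrite big_option /G /lorentz mul1r -sumrN; congr (_ + _); apply: eq_bigr => x _; ring.
Qed.

Lemma fun_colE (v : 'cV[F]_#|basis tau|) : v = fun_col (fun b => v (enum_rank b) 0).
Proof. by apply/colP => i; rewrite !mxE enum_valK. Qed.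

Lemma w_mx_isometry : w_mx^T *m lorentz_mx *m w_mx = lorentz_mx.
Proof.
have H (u v : 'cV[F]_#|basis tau|) : u^T *m (w_mx^T *m lorentz_mx *m w_mx) *m v = u^T *m lorentz_mx *m v.
  rewrite (fun_colE u) (fun_colE v) !mulmxA -trmx_mul -mulmxA !w_mx_col.
  by rewrite !fun_col_lorentz lorentz_w.
apply/matrixP => i j.
have /matrixP /(_ 0 0) := H (delta_mx i 0) (delta_mx j 0).
by rewrite !trmx_delta -!rowE -!colE !mxE.
Qed.

Lemma w_mx_isometryT : w_mx *m lorentz_mx *m w_mx^T = lorentz_mx.
Proof.
have H : (lorentz_mx *m w_mx^T *m lorentz_mx) *m w_mx = 1%:M by rewrite -!mulmxA [_ *m (lorentz_mx *m _)]mulmxA w_mx_isometry lorentz_mxK.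
have := mulmx1C H; rewrite !mulmxA => /(congr1 (mulmx^~ lorentz_mx)).
by rewrite mul1mx -[_ *m lorentz_mx *m lorentz_mx]mulmxA lorentz_mxK mulmx1.
Qed.

(** [eigenvalue] is about row vectors, whereas eigenfunctions are columns. With J = [lorentz_mx],
    the relation w J w^T = J turns a row x of eigenvalue a into the column J x^T of eigenvalue
    a^-1. *)
Lemma eigenvalue_eigenfun (a : F) : eigenvalue w_mx a ->
  a != 0 /\ exists2 rho, exists b, rho b != 0 & eigenfun rho a^-1.
Proof.
move=> /eigenvalueP [x xM x0].
have E : lorentz_mx *m x^T = a *: (w_mx *m (lorentz_mx *m x^T)).
  by rewrite -{1}w_mx_isometryT -!mulmxA -trmx_mul xM linearZ /= -!scalemxAr.
have a0 : a != 0.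
  apply/negP => /eqP a0; move: E; rewrite a0 scale0r => /(congr1 (mulmx lorentz_mx)).
  by rewrite mulmxA lorentz_mxK mul1mx mulmx0 => /(congr1 trmx); rewrite trmxK trmx0 => /eqP; rewrite (negbTE x0).
split=> //; exists (fun b => (lorentz_mx *m x^T) (enum_rank b) 0).
  apply/existsP; apply: contraNT x0 => /existsPn H.
  have : lorentz_mx *m x^T = 0.
    by apply/colP => i; have := H (enum_val i); rewrite enum_valK negbK => /eqP ->; rewrite mxE.
  move/(congr1 (mulmx lorentz_mx)); rewrite mulmxA lorentz_mxK mul1mx mulmx0 => /(congr1 trmx).
  by rewrite trmxK trmx0 => ->.
move=> b; have := w_mx_col (fun b => (lorentz_mx *m x^T) (enum_rank b) 0); rewrite -fun_colE.
move=> /colP /(_ (enum_rank b)); rewrite [in RHS]mxE enum_rankK => <-.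
by rewrite [in RHS]E [in RHS]mxE mulKf.
Qed.

Lemma eigenfun_eigenvalue rho (a : F) : a != 0 -> (exists b, rho b != 0) ->
  eigenfun rho a^-1 -> eigenvalue w_mx a.
Proof.
move=> a0 [b b0] H; apply/eigenvalueP; exists ((fun_col rho)^T *m lorentz_mx).
  have E : fun_col rho = a *: (w_mx *m fun_col rho).
    by rewrite w_mx_col; apply/colP => i; rewrite !mxE H mulVKf.
  by rewrite {1}E linearZ /= trmx_mul -!scalemxAl -!mulmxA [_ *m (lorentz_mx *m _)]mulmxA w_mx_isometry.
apply/negP => /eqP /(congr1 (mulmx^~ lorentz_mx)); rewrite -mulmxA lorentz_mxK mulmx1 mul0mx.
move/(congr1 trmx); rewrite trmxK trmx0 => /colP /(_ (enum_rank b)).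
by rewrite !mxE enum_rankK => /eqP; rewrite (negbTE b0).
Qed.
End FunctionalsMore.

(** * Real isotropic eigenfunctions *)

Section Spectral.
Variables (tau : orbit_data) (C : numClosedFieldType).
Local Notation basis := Defs.basis.
Implicit Types (rho : basis tau -> C).

Lemma ext_conj rho v : ext (fun b => (rho b)^*) v = (ext rho v)^*.
Proof. by rewrite /ext rmorph_sum; apply: eq_bigr => b _; rewrite rmorphMz. Qed.

Lemma sum_real_sqr_eq0 (T : finType) (f : T -> C) :
  (forall x, (f x)^* = - f x) \/ (forall x, (f x)^* = f x) ->
  \sum_x f x ^+ 2 = 0 -> forall x, f x = 0.
Proof.
move=> H E x.
have {}E : \sum_x `|f x| ^+ 2 = 0.
  case: H => H.
    move/eqP: E; rewrite -oppr_eq0 -sumrN => /eqP E; rewrite -[RHS]E; apply: eq_bigr => y _.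
    by rewrite normCK H mulrN expr2.
  by rewrite -[RHS]E; apply: eq_bigr => y _; rewrite normCK H expr2.
have /psumr_eq0P := E => /(_ _) H0.
have := H0 (fun y _ => exprn_ge0 2 (normr_ge0 (f y))) x isT.
by move/eqP; rewrite sqrf_eq0 normr_eq0 => /eqP.
Qed.

(** As |c| <> 1, rho is isotropic and orthogonal to its conjugate. If rho(e_0) were 0, definiteness
    on the other classes would give rho = 0. Scaled to r(e_0) = 1, the sums of r^2, r conj(r) and
    conj(r)^2 over the exceptional classes are all 1, so the squares of the purely imaginary numbers
    r - conj(r) add up to 0. *)
Lemma eigenfun_normal rho c : (exists b, rho b != 0) -> eigenfun rho c -> `|c| != 1 ->
  exists r : basis tau -> C, [/\ r None = 1, eigenfun r c, forall b, (r b)^* = r b & lorentz r r = 0].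
Proof.
move=> [b0 nz] H c1.
have c2 : c * c != 1.
  apply: contraNneq c1 => E; have : `|c| ^+ 2 == 1 by rewrite -normrX expr2 E normr1.
  by rewrite sqrp_eq1.
have c3 : c * c^* != 1 by rewrite -normCK sqrp_eq1.
have Hc (r : basis tau -> C) : eigenfun r c -> eigenfun (fun b => (r b)^*) c^*.
  by move=> Hr b; rewrite -rmorphM -Hr; apply: ext_conj.
have Q0 (r : basis tau -> C) : eigenfun r c -> lorentz r r = 0.
  move=> Hr; have /eqP := lorentz_eigen Hr Hr.
  by rewrite -subr_eq0 -{1}[lorentz r r]mul1r -mulrBl mulf_eq0 subr_eq0 eq_sym (negbTE c2) => /eqP.
have H0 (r : basis tau -> C) : eigenfun r c -> lorentz r (fun b => (r b)^*) = 0.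
  move=> Hr; have /eqP := lorentz_eigen Hr (Hc _ Hr).
  by rewrite -subr_eq0 -{1}[lorentz r _]mul1r -mulrBl mulf_eq0 subr_eq0 eq_sym (negbTE c3) => /eqP.
have r0 : rho None != 0.
  apply: contra_neq nz => N0.
  have := H0 _ H; rewrite /lorentz N0 mul0r sub0r => /eqP; rewrite oppr_eq0 => /eqP E.
  have /psumr_eq0P E0 := E.
  case: b0 => [x|//]; apply/eqP; rewrite -normr_eq0 -sqrf_eq0 normCK.
  by apply/eqP/E0 => // y _; rewrite -normCK exprn_ge0.
pose r b := (rho None)^-1 * rho b.
have Hr : eigenfun r c by apply: eigenfunZ.
have r1 : r None = 1 by rewrite /r mulVf.
have Qr := Q0 _ Hr; exists r; split=> //.
suff Hx : forall x, r (Some x) - (r (Some x))^* = 0.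
  by case=> [x|]; [have /eqP := Hx x; rewrite subr_eq0 => /eqP/esym | rewrite r1 rmorph1].
apply: sum_real_sqr_eq0; first by left=> x; rewrite rmorphB /= conjCK opprB.
have S1 : \sum_x r (Some x) * r (Some x) = 1.
  by move/eqP: Qr; rewrite /lorentz r1 mulr1 subr_eq0 => /eqP/esym.
have S2 : \sum_x r (Some x) * (r (Some x))^* = 1.
  by have /eqP := H0 _ Hr; rewrite /lorentz r1 rmorph1 mulr1 subr_eq0 => /eqP/esym.
have S3 : \sum_x (r (Some x))^* * (r (Some x))^* = 1.
  have := congr1 Num.conj S1; rewrite rmorph1 rmorph_sum => <-.
  by apply: eq_bigr => x _; apply: esym; apply: rmorphM.
rewrite (eq_bigr (fun x => r (Some x) * r (Some x) - (r (Some x) * (r (Some x))^*) *+ 2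
   + (r (Some x))^* * (r (Some x))^*)); last by move=> x _; rewrite sqrrB !expr2.
rewrite big_split sumrB /= sumrMnl S1 S2 S3; ring.
Qed.

(** Orthogonal rays of the light cone coincide: if c * c' <> 1, the sum of (r - r')^2 is 1 - 2 + 1 =
    0. *)
Lemma eigenfun_uniq (r r' : basis tau -> C) c c' : r None = 1 -> (forall b, (r b)^* = r b) -> lorentz r r = 0 ->
  eigenfun r c -> r' None = 1 -> (forall b, (r' b)^* = r' b) -> lorentz r' r' = 0 ->
  eigenfun r' c' -> c * c' != 1 -> c = c'.
Proof.
move=> r1 rr Qr Hr r1' rr' Qr' Hr' cc.
have Q0 : lorentz r r' = 0.
  have /eqP := lorentz_eigen Hr Hr'.
  by rewrite -subr_eq0 -{1}[lorentz r _]mul1r -mulrBl mulf_eq0 subr_eq0 eq_sym (negbTE cc) => /eqP.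
have E x : r (Some x) - r' (Some x) = 0.
  move: x; apply: sum_real_sqr_eq0; first by right=> x; rewrite rmorphB /= rr rr'.
  rewrite (eq_bigr (fun x => r (Some x) * r (Some x) - (r (Some x) * r' (Some x)) *+ 2
   + r' (Some x) * r' (Some x))); last by move=> x _; rewrite sqrrB !expr2.
  rewrite big_split sumrB /= sumrMnl.
  move/eqP: Qr; rewrite /lorentz r1 mulr1 subr_eq0 => /eqP <-.
  move/eqP: Qr'; rewrite /lorentz r1' mulr1 subr_eq0 => /eqP <-.
  by move/eqP: Q0; rewrite /lorentz r1 r1' mulr1 subr_eq0 => /eqP <-; ring.
have {}E : r = r'.
  by apply/funext => -[x|]; [apply/eqP; rewrite -subr_eq0 E | rewrite r1 r1'].
by have := Hr None; rewrite E Hr' r1' !mulr1.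
Qed.
End Spectral.

(** * The spectral radius as an eigenvalue *)

Section Lambda.
Variables (R : realType) (tau : orbit_data).
Local Notation C := R[i].
Local Notation basis := Defs.basis.
Implicit Types (rho : basis tau -> C).

Lemma norm_normc (z : C) : `|z| = (Normc.normc z)%:C%C.
Proof. by rewrite normc_def; case: z. Qed.

Lemma normc_neq1 (z : C) : Normc.normc z != 1 -> `|z| != 1.
Proof. by apply: contra_neq => E; apply: complexI; rewrite -norm_normc E. Qed.

Lemma normc_inv_neq1 (a : C) : 1 < Normc.normc a -> `|a^-1| != 1.
Proof. by move=> a1; rewrite normc_neq1 // Normc.normcV invr_eq1 gt_eqF. Qed.

Lemma normcV_lt1 (a : C) : 1 < Normc.normc a -> Normc.normc a^-1 < 1.
Proof. by move=> a1; rewrite Normc.normcV invf_lt1 // (lt_trans ltr01). Qed.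

Lemma normc_gt1_neq0 (a : C) : 1 < Normc.normc a -> a != 0.
Proof. by apply: contraTneq => ->; rewrite Normc.normc0 ltr10. Qed.

(** An eigenvalue a' of larger modulus would also have a normalized isotropic eigenfunction. The
    product of a^-1 and a'^-1 has modulus less than 1, so [eigenfun_uniq] would give a = a'. *)
Lemma lambda_eigenfun rho a : (exists b, rho b != 0) -> eigenfun rho a^-1 ->
  1 < Normc.normc a -> lambda tau R = Normc.normc a.
Proof.
move=> rho0 Hrho a1; rewrite /lambda /spectral_radius.
have a0 := normc_gt1_neq0 a1.
set E : set R := image _ _.
have Ea : E (Normc.normc a) by exists a => //; apply: (eigenfun_eigenvalue a0 rho0 Hrho).
have ub : ubound E (Normc.normc a).
  move=> _ [a' /eigenvalue_eigenfun [a'0 [rho' rho'0 Hrho']] <-].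
  rewrite leNgt; apply/negP => lt.
  have a'1 : 1 < Normc.normc a' by apply: lt_trans lt.
  have [r [r1 Hr rr Qr]] := eigenfun_normal rho0 Hrho (normc_inv_neq1 a1).
  have [r' [r1' Hr' rr' Qr']] := eigenfun_normal rho'0 Hrho' (normc_inv_neq1 a'1).
  have : a^-1 = a'^-1.
    apply: (eigenfun_uniq r1 rr Qr Hr r1' rr' Qr' Hr').
    apply/negP => /eqP /(congr1 (@Normc.normc R)).
    rewrite Normc.normcM Normc.normc1; apply/eqP; rewrite lt_eqF //.
    by rewrite mulr_ilt1 ?normcV_lt1 // Normc.normcV invr_ge0 ltW // (lt_trans ltr01).
  by move/invr_inj => E'; rewrite E' ltxx in lt.
apply/eqP; rewrite eq_le; apply/andP; split.
  by apply: ge_sup => //; exists (Normc.normc a).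
by apply: ub_le_sup => //; exists (Normc.normc a).
Qed.

Lemma lambda_gt1_eigenfun : 1 < lambda tau R -> exists a, exists2 rho : basis tau -> C,
  exists b, rho b != 0 & eigenfun rho a^-1 /\ 1 < Normc.normc a.
Proof.
rewrite /lambda /spectral_radius => l1.
(* The default value of [sup] is 0, so lambda > 1 guarantees that the supremum exists. *)
have [hs|ns] := pselect (has_sup [set Normc.normc a | a in [set a | eigenvalue (w_mx tau C) a]]);
  last by move: l1; rewrite sup_out // ltr10.
have [x [a ea <-] xl] := sup_gt hs.1 l1.
have [a0 [rho rho0 Hrho]] := eigenvalue_eigenfun ea.
by exists a; exists rho.
Qed.

Lemma ext_real (r : basis tau -> R) v :
  ext (fun b => (r b)%:C%C) v = (ext r v)%:C%C.
Proof. by rewrite /ext rmorph_sum; apply: eq_bigr => b _; rewrite rmorphMz. Qed.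

Lemma sum3_bound (d : R) (f : 'I_3 -> R) : 0 < d -> \sum_a f a * f a <= d * d -> \sum_a f a < 2 * d.
Proof.
rewrite !big_ord_recl !big_ord0 !addr0.
set x := f _; set y := f _; set z := f _ => d0 H.
suff : (x + (y + z)) ^+ 2 < (2 * d) ^+ 2.
  by move=> lt; apply: contraTT lt; rewrite -!leNgt => le; rewrite lerXn2r ?nnegrE //; nra.
have := sqr_ge0 (x - y); have := sqr_ge0 (x - z); have := sqr_ge0 (y - z); nra.
Qed.

(** The steps preserve the forward light cone: the new value of e_0 is 2 d - (a + b + c), and (a + b
    + c)^2 <= 3 (a^2 + b^2 + c^2) <= 3 d^2 < 4 d^2. *)
Lemma stage_gt0 (r : basis tau -> R) ms : lorentz r r = 0 -> 0 < r None -> 0 < stage r ms None.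
Proof.
elim: ms r => //= m ms IH r Q0 r0; apply: IH; first by rewrite lorentz_q.
rewrite pull_q mul1r /defect opprB addrA subr_gt0.
have -> : r None + r None = 2 * r None by ring.
apply: sum3_bound => //; move/eqP: Q0; rewrite subr_eq0 => /eqP ->.
rewrite -(sum_base (F := R) m (fun x => r (Some x) * r (Some x))); apply: ler_sum => x _.
by case: (is_base _ _); rewrite ?mul1r ?mul0r // -expr2 sqr_ge0.
Qed.

Lemma lambda_gt1_real : 1 < lambda tau R ->
  exists2 r : basis tau -> R, r None = 1 & eigenfun r (lambda tau R)^-1.
Proof.
move=> l1; have [a [rho rho0 [Hrho a1]]] := lambda_gt1_eigenfun l1.
have la := lambda_eigenfun rho0 Hrho a1.
have [r [r1 Hr rr Qr]] := eigenfun_normal rho0 Hrho (normc_inv_neq1 a1).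
pose s b := complex.Re (r b).
have rs b : r b = (s b)%:C%C.
  have := rr b; rewrite /s; case: (r b) => x y /= E.
  have {E} : (x -i* y)%C = (x +i* y)%C by rewrite -[RHS]E.
  case=> /eqP; rewrite eq_sym -subr_eq0 opprK -mulr2n mulrn_eq0 /= => /eqP ->.
  by [].
have pr b : pull (@w tau) r b = (pull (@w tau) s b)%:C%C.
  by rewrite /pull -ext_real; apply: eq_ext => b'; rewrite rs.
have first_index : s None = 1 by apply: complexI; rewrite -rs r1.
have ca : a^-1 = (pull (@w tau) s None)%:C%C by rewrite -pr Hr r1 mulr1.
set c := pull (@w tau) s None in ca.
have Hs : eigenfun s c.
  by move=> b; apply: complexI; rewrite -pr Hr ca rmorphM rs.
have Qs : lorentz s s = 0.
  apply: complexI; rewrite -[RHS]Qr /lorentz rmorphB rmorphM rmorph_sum !rs; congr (_ - _).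
  by apply: eq_bigr => x _; rewrite rmorphM !rs.
(* Positivity excludes c = - 1 / lambda; only the modulus of c is known so far. *)
have c0 : 0 < c.
  rewrite /c pull_w stage_gt0 ?lorentz_r // pull_r first_index //.
suff -> : (lambda tau R)^-1 = c by exists s.
rewrite la -Normc.normcV ca; apply: complexI; rewrite -norm_normc.
by rewrite ger0_norm // lecR ltW.
Qed.
End Lambda.

(** * Sequences of quadratic steps *)

Lemma eq_perm (T : eqType) (s t : seq T) : s = t -> perm_eq s t.
Proof. by move->. Qed.

Lemma perm_swap (T : eqType) (x y : T) (u : seq T) : perm_eq [:: x, y & u] [:: y, x & u].
Proof. by rewrite (perm_catCA [:: x] [:: y] u). Qed.

Lemma perm_rot3 (T : eqType) (x y z : T) (u : seq T) : perm_eq [:: x, y, z & u] [:: y, z, x & u].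
Proof. by rewrite (perm_catCA [:: x] [:: y; z] u). Qed.

Section Paths.
Variable R : realFieldType.
Implicit Types (d a b c r p S : R) (s u : seq R).

(* The values of the class of a line and of the exceptional classes; a quadratic map based at the
   points of values a, b, c subtracts S = a + b + c - d from d, a, b and c. *)
Definition cstep (x : R * seq R) a b c (y : R * seq R) := exists u, [/\ perm_eq x.2 [:: a, b, c & u],
   y.1 = x.1 - (a + b + c - x.1) &
   perm_eq y.2 [:: a - (a + b + c - x.1), b - (a + b + c - x.1), c - (a + b + c - x.1) & u]].

Definition legal d a b c := [/\ a != b, a != c, b != c & a + b + c != d].

Inductive reach : R * seq R -> R * seq R -> Prop :=
| reach0 x y : x.1 = y.1 -> perm_eq x.2 y.2 -> reach x y
| reachS x a b c y z : legal x.1 a b c -> cstep x a b c y -> reach y z -> reach x z.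

Lemma reach_trans x y z : reach x y -> reach y z -> reach x z.
Proof.
move=> H; elim: H z => {x y} [x y E P z|x a b c y z L S _ IH t H]; last first.
  exact: reachS L S (IH _ H).
move=> H; elim: H x E P => {y z} [y z E' P' x E P|y a b c z t L [u [P1 P2 P3]] H _ x E P].
  by apply: reach0; [rewrite E | apply: perm_trans P P'].
apply: (@reachS x a b c z) => //; first by rewrite E.
exists u; split => //; rewrite ?E //; exact: perm_trans P P1.
Qed.

Definition commens_at (g : R) (x : R * seq R) := (exists k : int, x.1 = g *~ k) /\
  forall t : R, t \in x.2 -> exists k : int, t = g *~ k.

Definition commens x := exists g, commens_at g x.

(** The identities express that rho vanishes on the canonical class 3 e_0 - sum e and that rho is
    isotropic. *)
Definition good (x : R * seq R) := [/\ \sum_(t <- x.2) t = 3 * x.1, \sum_(t <- x.2) t ^+ 2 = x.1 ^+ 2 & ~ commens x].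

Lemma cstep_commens_at g x a b c y : cstep x a b c y -> commens_at g x -> commens_at g y.
Proof.
case=> u [P E P'] [[k Ek] H].
have Ha : a \in x.2 by rewrite (perm_mem P) !inE eqxx.
have Hb : b \in x.2 by rewrite (perm_mem P) !inE eqxx ?orbT.
have Hc : c \in x.2 by rewrite (perm_mem P) !inE eqxx ?orbT.
have [ka Ea] := H _ Ha; have [kb Eb] := H _ Hb; have [kc Ec] := H _ Hc.
split.
  exists (k - (ka + kb + kc - k)); rewrite E Ek {1}Ea {1}Eb {1}Ec.
  by rewrite !(mulrzBr, mulrzDr).
move=> t; rewrite (perm_mem P') !inE => /or4P[/eqP->|/eqP->|/eqP->|tu].
- by exists (ka - (ka + kb + kc - k)); rewrite {1 2}Ea Eb Ec Ek !(mulrzBr, mulrzDr).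
- by exists (kb - (ka + kb + kc - k)); rewrite Ea {1 2}Eb Ec Ek !(mulrzBr, mulrzDr).
- by exists (kc - (ka + kb + kc - k)); rewrite Ea Eb {1 2}Ec Ek !(mulrzBr, mulrzDr).
- by apply: H; rewrite (perm_mem P) !inE tu !orbT.
Qed.

Lemma cstep_commens x a b c y : cstep x a b c y -> commens x -> commens y.
Proof. by move=> H [g Hg]; exists g; apply: cstep_commens_at H Hg. Qed.

Lemma cstep_sym x a b c y : cstep x a b c y ->
  cstep y (a - (a + b + c - x.1)) (b - (a + b + c - x.1)) (c - (a + b + c - x.1)) x.
Proof.
case=> u [P E P']; exists u; rewrite E; split=> //; first by ring.
by apply: perm_trans P _; apply: eq_perm; congr [:: _, _, _ & _]; ring.
Qed.

Lemma cstep_good x a b c y : cstep x a b c y -> good x -> good y.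
Proof.
move=> H [H1 H2 H3]; split; last by move=> /(cstep_commens (cstep_sym H)).
- case: H => u [P E P']; move: H1; rewrite (perm_big _ P) (perm_big _ P') /= !big_cons E.
  move=> H1; lra.
- case: H => u [P E P']; move: H2; rewrite (perm_big _ P) (perm_big _ P') /= !big_cons E.
  set v := bigop.body _ _ _ => H2.
  have -> : v = x.1 ^+ 2 - a ^+ 2 - b ^+ 2 - c ^+ 2 by rewrite -H2; ring.
  ring.
Qed.

Lemma good_neq0 x : good x -> x.1 != 0.
Proof.
move=> [H1 H2 H3]; apply/negP => /eqP E; apply: H3; exists 0; split; first by exists 0; rewrite E.
move=> y ys; exists 0; rewrite mul0rz.
move: H2; rewrite E expr0n /= => /eqP; rewrite psumr_eq0; last by move=> *; apply: sqr_ge0.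
by move=> /allP /(_ _ ys); rewrite /= sqrf_eq0 => /eqP.
Qed.

Lemma commens_rat d s :
  (forall y : R, y \in s -> exists (M k : int), M != 0 /\ y * M%:~R = d * k%:~R) -> commens (d, s).
Proof.
elim: s => [|y s IH] H /=; first by exists d; split=> //; exists 1.
have [|g [[k /= Ek] Hg]] := IH; first by move=> t ts; apply: H; rewrite inE ts orbT.
have [|M [l [M0 El]]] := H y; first by rewrite inE eqxx.
have M0' : (M%:~R : R) != 0 by rewrite intr_eq0.
have gE (j : int) : g *~ j = (g / M%:~R) *~ (j * M).
  by rewrite -mulrzr -[RHS]mulrzr intrM [_ * M%:~R]mulrC mulrA divfK.
exists (g / M%:~R); split; first by exists (k * M); rewrite /= Ek gE.
move=> t; rewrite inE => /orP[/eqP->|/Hg [j ->]]; last by exists (j * M).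
exists (k * l); apply: (mulIf M0'); rewrite El Ek.
by rewrite -[_ *~ (k * l)]mulrzr -[_ *~ k]mulrzr intrM; field.
Qed.

(** The factor 2 makes room for values such as d / 2 in [four_valued3]. *)
Lemma commens_lin d s r (M k : int) : M != 0 -> r * M%:~R = d * k%:~R ->
  (forall y : R, y \in s -> exists i j : int, 2 * y = r * i%:~R + d * j%:~R) -> commens (d, s).
Proof.
move=> M0 E H; apply: commens_rat => y /H [i [j Ey]].
exists (2 * M), (k * i + M * j); split; first by rewrite mulf_neq0.
rewrite !(intrM, intrD) mulrA [y * _]mulrC Ey.
have -> : (r * i%:~R + d * j%:~R) * M%:~R = (r * M%:~R) * i%:~R + d * j%:~R * M%:~R :> R by ring.
by rewrite E; ring.
Qed.

Lemma three_valued s p1 p2 p3 :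
  (forall y : R, y \in s -> [|| y == 0, y == p1, y == p2 | y == p3]) ->
  exists m n l : nat, \sum_(y <- s) (y : R) = m%:R * p1 + n%:R * p2 + l%:R * p3 /\
   \sum_(y <- s) (y : R) ^+ 2 = m%:R * p1 ^+ 2 + n%:R * p2 ^+ 2 + l%:R * p3 ^+ 2.
Proof.
elim: s => [|y s IH] H; first by exists 0%N, 0%N, 0%N; rewrite !big_nil !mul0r !addr0.
have [|m [n [l [E1 E2]]]] := IH; first by move=> t ts; apply: H; rewrite inE ts orbT.
rewrite !big_cons E1 E2; have /or4P[] := H y (mem_head _ _) => /eqP ->.
- by exists m, n, l; split; ring.
- by exists m.+1, n, l; rewrite -natr1; split; ring.
- by exists m, n.+1, l; rewrite -natr1; split; ring.
- by exists m, n, l.+1; rewrite -natr1; split; ring.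
Qed.

(** If c and d - c have different multiplicities, the linear identity makes c a rational multiple of
    d. If both have multiplicity n, and d has multiplicity l, then n + l = 3, and c^2 + (d - c)^2 >=
    d^2 / 2 makes the sum of squares at least 3 d^2 / 2. *)
Lemma four_valued d s c : good (d, s) ->
  (forall y : R, y \in s -> [|| y == 0, y == c, y == d - c | y == d]) -> False.
Proof.
move=> G H; have /= d0 := good_neq0 G; case: G => /= H1 H2 NC; apply: NC.
have [m [n [l [E1 E2]]]] := three_valued H.
rewrite {}E1 in H1; rewrite {}E2 in H2.
have [mn|mn] := eqVneq (m%:Z - n%:Z) 0; last first.
  apply: (commens_lin (k := 3 - n%:Z - l%:Z) mn (r := c)).
    rewrite !(intrD, intrN) -?pmulrn; lra.
  move=> y /H /or4P[] /eqP ->.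
  - by exists 0, 0; rewrite !mulr0 addr0.
  - by exists 2, 0; rewrite mulr0 addr0 mulrC.
  - by exists (-2), 2; rewrite intrN; ring.
  - by exists 0, 2; rewrite mulr0 add0r mulrC.
have {mn} E : m = n by lia.
rewrite {}E in H1 H2; exfalso.
have E3 : n%:R + l%:R = 3 :> R by apply: (mulIf d0); lra.
have n0 : 0 <= n%:R :> R by [].
have l0 : 0 <= l%:R :> R by [].
have d2 : 0 < d ^+ 2 by rewrite exprn_even_gt0.
have h1 := mulr_ge0 n0 (sqr_ge0 (2 * c - d)).
have h2 := mulr_ge0 l0 (sqr_ge0 d).
have E4 : n%:R = 3 - l%:R :> R by lra.
rewrite E4 in H2 h1; nra.
Qed.

(** Let m, n, l be the multiplicities of p, d - p, d - 2 p. If m <> n + 2 l, then p is a rational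
    multiple of d. Otherwise n + l = 3, and 2 p^2 + (d - 2 p)^2 = d^2 / 3 + 2 (3 p - d)^2 / 3 shows
    that the sum of squares is at least (1 + n / 6) d^2. Equality forces n = 0 and p = d / 3, which
    is commensurable with d. *)
Lemma four_valued2 d s p : good (d, s) ->
  (forall y : R, y \in s -> [|| y == 0, y == p, y == d - p | y == d - 2 * p]) -> False.
Proof.
move=> G H; have /= d0 := good_neq0 G; case: G => /= H1 H2 NC; apply: NC.
have [m [n [l [E1 E2]]]] := three_valued H.
rewrite {}E1 in H1; rewrite {}E2 in H2.
have lin (M k : int) : M != 0 -> p * M%:~R = d * k%:~R -> commens (d, s).
  move=> M0 E; apply: (commens_lin M0 E) => y /H /or4P[] /eqP ->.
  - by exists 0, 0; rewrite !mulr0 addr0.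
  - by exists 2, 0; rewrite mulr0 addr0 mulrC.
  - by exists (-2), 2; rewrite intrN; ring.
  - by exists (-4), 2; rewrite intrN; ring.
have [mn|mn] := eqVneq (m%:Z - n%:Z - 2 * l%:Z) 0; last first.
  apply: (lin _ (3 - n%:Z - l%:Z) mn).
  rewrite !(intrD, intrN, intrM) -?pmulrn; lra.
have {mn} E : m = (n + 2 * l)%N by lia.
rewrite {}E natrD natrM in H1 H2.
have E3 : n%:R + l%:R = 3 :> R by apply: (mulIf d0); lra.
have n0 : 0 <= n%:R :> R by [].
have l0 : 0 <= l%:R :> R by [].
have d2 : 0 < d ^+ 2 by rewrite exprn_even_gt0.
have h1 := mulr_ge0 n0 (sqr_ge0 (2 * p - d)).
have h2 := mulr_ge0 l0 (sqr_ge0 (3 * p - d)).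
have E4 : l%:R = 3 - n%:R :> R by lra.
apply: (lin 3 1) => //; rewrite mulr1.
suff : (3 * p - d) ^+ 2 = 0.
  by move/eqP; rewrite sqrf_eq0 => /eqP; lra.
have n1 : n%:R * d ^+ 2 = 0 :> R.
  have := mulr_ge0 n0 (ltW d2); rewrite E4 in H2 h2; nra.
have n2 : n%:R = 0 :> R by move/eqP: n1; rewrite mulf_eq0 (gt_eqF d2) orbF => /eqP.
rewrite E4 n2 in H2; nra.
Qed.

(** The two values d / 2 contribute d^2 / 2 to the sum of squares. The rest is bounded by r^2 + (d /
    2 - r)^2 >= d^2 / 8, with equality only for r = d / 4; as before, this leaves only commensurable
    cases. *)
Lemma four_valued3 d s r : good (d, s) ->
  (exists u, perm_eq s [:: d / 2, d / 2 & u]) ->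
  (forall y : R, y \in s -> [|| y == 0, y == r, y == d / 2 - r | y == d / 2]) -> False.
Proof.
move=> G [u P] H; have /= d0 := good_neq0 G; case: G => /= H1 H2 NC; apply: NC.
have [|m [n [l [E1 E2]]]] := @three_valued u r (d / 2 - r) (d / 2).
  by move=> y yu; apply: H; rewrite (perm_mem P) !inE yu !orbT.
rewrite (perm_big _ P) /= !big_cons {}E1 in H1; rewrite (perm_big _ P) /= !big_cons {}E2 in H2.
have lin (M k : int) : M != 0 -> r * M%:~R = d * k%:~R -> commens (d, s).
  move=> M0 E; apply: (commens_lin M0 E) => y /H /or4P[] /eqP ->.
  - by exists 0, 0; rewrite !mulr0 addr0.
  - by exists 2, 0; rewrite mulr0 addr0 mulrC.
  - by exists (-2), 1; rewrite intrN; field.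
  - by exists 0, 1; rewrite mulr0 add0r; field.
have [mn|mn] := eqVneq (2 * (m%:Z - n%:Z)) 0; last first.
  apply: (lin _ (4 - n%:Z - l%:Z) mn).
  rewrite !(intrD, intrN, intrM) -?pmulrn; lra.
have {mn} E : m = n by lia.
rewrite {}E in H1 H2.
have E3 : n%:R + l%:R = 4 :> R by apply: (mulIf d0); lra.
have n0 : 0 <= n%:R :> R by [].
have l0 : 0 <= l%:R :> R by [].
have d2 : 0 < d ^+ 2 by rewrite exprn_even_gt0.
have h1 := mulr_ge0 n0 (sqr_ge0 (4 * r - d)).
have E4 : n%:R = 4 - l%:R :> R by lra.
apply: (lin 4 1) => //; rewrite mulr1.
suff : (4 * r - d) ^+ 2 = 0.
  by move/eqP; rewrite sqrf_eq0 => /eqP; lra.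
have l1 : l%:R * d ^+ 2 = 0 :> R.
  have := mulr_ge0 l0 (ltW d2); rewrite E4 in H2 h1; nra.
have l2 : l%:R = 0 :> R by move/eqP: l1; rewrite mulf_eq0 (gt_eqF d2) orbF => /eqP.
rewrite E4 l2 in H2; nra.
Qed.

(* The reflection in e_0 - e_a - e_b - e_c is s (b x) s for the reflection s in
   e_0 - e_a - e_c - e_x, whence the two steps. *)
Lemma reach_two_equal d a c u : good (d, [:: a, a, c & u]) -> 0 \in u -> a != c -> a + a + c != d ->
  reach (d, [:: a, a, c & u]) (d - (a + a + c - d),
    [:: a - (a + a + c - d), a - (a + a + c - d), c - (a + a + c - d) & u]).
Proof.
move=> G u0 ac Sd.
(* The excluded values are those for which one of the two steps is not legal. If all values were
   excluded, so would be 0; then one of the four excluded values is 0, and what remains is ruled out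
   by a [four_valued] lemma. *)
have [x xs xA] : exists2 x, x \in [:: a, a, c & u] & ~~ [|| x == a, x == c, x == d - a - c | x == d - 2 * a].
  apply/hasP; rewrite has_predC; apply/negP => /allP H.
  have s0 : 0 \in [:: a, a, c & u] by rewrite !inE u0 !orbT.
  have /or4P[] := H _ s0 => /eqP E.
  - apply: (four_valued (c := c) G) => y /H /or4P[] /eqP ->; rewrite -?E ?eqxx ?orbT //.
    + by rewrite subr0 eqxx ?orbT.
    + by rewrite mulr0 subr0 eqxx ?orbT.
  - apply: (four_valued2 (p := a) G) => y /H /or4P[] /eqP ->; rewrite -?E ?eqxx ?orbT //.
    by rewrite subr0 eqxx ?orbT.
  - have Ec : c = d - a by lra.
    apply: (four_valued2 (p := a) G) => y /H /or4P[] /eqP ->; rewrite -?E ?Ec ?eqxx ?orbT //.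
  - have Ea : a = d / 2 by lra.
    apply: (four_valued3 (r := c) G).
      by exists (c :: u); rewrite Ea.
    move=> y /H /or4P[] /eqP ->; rewrite -?E ?Ea ?eqxx ?orbT //.
    by rewrite (_ : d - d / 2 = d / 2) ?eqxx ?orbT //; field.
move: xA; rewrite !negb_or => /and4P[xa xc x1 x2].
have xu : x \in u by move: xs; rewrite !inE (negbTE xa) (negbTE xc).
have [u' P] : exists u', perm_eq u (x :: u') by exists (rem x u); apply: perm_to_rem.
pose S := a + c + x - d.
have S0 : S != 0 by apply: contraNneq x1; rewrite /S => E; apply/eqP; lra.
apply: (@reachS _ a c x (d - S, [:: a - S, c - S, x - S, a & u'])).
- split=> //=; first by rewrite eq_sym.
    by rewrite eq_sym.
  by apply: contraNneq S0; rewrite /S => ->; rewrite subrr.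
- exists (a :: u'); split=> //=.
  have P1 : perm_eq [:: a, a, c & u] [:: a, a, c, x & u'] by rewrite !perm_cons.
  by apply: perm_trans P1 _; rewrite perm_cons perm_rot3.
apply: (@reachS _ (a - S) (c - S) a (d - (a + a + c - d),
    [:: a - (a + a + c - d), c - (a + a + c - d), x, x - S & u'])); last first.
- apply: reach0 => //=.
  (* The second a has become x, and x has become the value wanted for the second a: the
     transposition (b x). *)
  have -> : x - S = a - (a + a + c - d) by rewrite /S; ring.
  rewrite perm_sym; have P1 := P; rewrite -(perm_cons (c - (a + a + c - d))) in P1.
  apply: (@perm_trans _ [:: a - (a + a + c - d), a - (a + a + c - d), c - (a + a + c - d), x & u']).
    by rewrite !perm_cons.
  by rewrite perm_cons perm_rot3.
- exists (x - S :: u'); split=> /=.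
  + by rewrite !perm_cons perm_swap.
  + rewrite /S; ring.
  + by apply: eq_perm; rewrite /S; congr [:: _, _, _, _ & _]; ring.
- split=> /=.
  + by apply: contra ac => /eqP E; apply/eqP; lra.
  + by apply: contra S0 => /eqP E; apply/eqP; lra.
  + by apply: contra x2 => /eqP E; rewrite /S in E; apply/eqP; lra.
  + by apply: contra xa => /eqP E; rewrite /S in E; apply/eqP; lra.
Qed.

(** Two zeros are required because in the case a = b = c one of them may be consumed as the
    auxiliary value x, while [reach_two_equal] still needs a zero among the remaining values. *)
Lemma reach_step d a b c u : good (d, [:: a, b, c & u]) -> (2 <= count_mem 0%R u)%N ->
  reach (d, [:: a, b, c & u]) (d - (a + b + c - d),
    [:: a - (a + b + c - d), b - (a + b + c - d), c - (a + b + c - d) & u]).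
Proof.
move=> G u2; have u0 : 0 \in u by rewrite -has_pred1 has_count (leq_trans _ u2).
have [S0|S0] := eqVneq (a + b + c) d.
  by rewrite S0 subrr !subr0; apply: reach0.
have twist a1 b1 c1 : perm_eq [:: a; b; c] [:: a1; b1; c1] -> a1 + b1 + c1 = a + b + c ->
  reach (d, [:: a1, b1, c1 & u]) (d - (a1 + b1 + c1 - d),
    [:: a1 - (a1 + b1 + c1 - d), b1 - (a1 + b1 + c1 - d), c1 - (a1 + b1 + c1 - d) & u]) ->
  reach (d, [:: a, b, c & u]) (d - (a + b + c - d),
    [:: a - (a + b + c - d), b - (a + b + c - d), c - (a + b + c - d) & u]).
  move=> P -> H; apply: reach_trans (reach_trans H _); apply: reach0 => //=.
    by rewrite -[X in perm_eq X]/([:: a; b; c] ++ u) -[X in perm_eq _ X]/([:: a1; b1; c1] ++ u) perm_cat2r.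
  rewrite -[X in perm_eq X]/(map (fun t => t - (a + b + c - d)) [:: a1; b1; c1] ++ u).
  rewrite -[X in perm_eq _ X]/(map (fun t => t - (a + b + c - d)) [:: a; b; c] ++ u).
  by rewrite perm_cat2r perm_map // perm_sym.
have goodP a1 b1 c1 : perm_eq [:: a; b; c] [:: a1; b1; c1] -> good (d, [:: a1, b1, c1 & u]).
  move=> P; have P' : perm_eq [:: a, b, c & u] [:: a1, b1, c1 & u].
    by rewrite -[X in perm_eq X]/([:: a; b; c] ++ u) -[X in perm_eq _ X]/([:: a1; b1; c1] ++ u) perm_cat2r.
  case: G => /= G1 G2 G3; split=> /=; rewrite -?(perm_big _ P') //.
  move=> [g [/= gd H]]; apply: G3; exists g; split=> // y; rewrite (perm_mem P'); exact: H.
have P1 : perm_eq [:: a; b; c] [:: a; c; b] by rewrite perm_cons (perm_catC [:: b] [:: c]).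
have P2 : perm_eq [:: a; b; c] [:: b; c; a] by rewrite (perm_catC [:: a] [:: b; c]).
have [ab|ab] := eqVneq a b.
  subst b; have [ac|ac] := eqVneq a c; last exact: reach_two_equal.
  subst c.
  (* For a triple value, replace one a by x: the reflection is again s (b x) s, where both
     reflections now have two equal values and are covered by [reach_two_equal]. *)
  have [x xu xA] : exists2 x, x \in u & ~~ ((x == a) || (x == d - 2 * a)).
    apply/hasP; rewrite has_predC; apply/negP => /allP H.
    have HH (y : R) : y \in [:: a, a, a & u] -> (y == a) || (y == d - 2 * a).
      by rewrite !inE => /or4P[/eqP->|/eqP->|/eqP->|/H]; rewrite ?eqxx.
    apply: (four_valued2 (p := a) G) => y /HH /orP[] /eqP ->; rewrite eqxx ?orbT //.
  move: xA; rewrite negb_or => /andP[xa xd].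
  have [u' P] : exists u', perm_eq u (x :: u') by exists (rem x u); apply: perm_to_rem.
  have u'0 : 0 \in u'.
    rewrite -has_pred1 has_count; move: u2; rewrite (seq.permP P) /=.
    by case: (x == 0) => //; apply: ltnW.
  pose S := a + a + x - d.
  have S0' : S != 0 by apply: contraNneq xd; rewrite /S => E; apply/eqP; lra.
  pose st1 := (d, [:: a, a, x, a & u']).
  pose st2 := (d - S, [:: a - S, a - S, x - S, a & u']).
  pose st2' := (d - S, [:: a - S, a - S, a, x - S & u']).
  have Px : perm_eq [:: a, a, a & u] [:: a, a, x, a & u'].
    apply: (@perm_trans _ [:: a, a, a, x & u']); first by rewrite !perm_cons.
    by rewrite !perm_cons perm_swap.
  have Px2 : perm_eq st2.2 st2'.2.
    by rewrite /= !perm_cons perm_swap.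
  have G1 : good st1.
    case: G => /= G1 G2 G3; split=> /=; rewrite -?(perm_big _ Px) //.
    move=> [g [/= gd H]]; apply: G3; exists g; split=> // y; rewrite (perm_mem Px); exact: H.
  have G2 : good st2'.
    by apply: (@cstep_good st1 a a x) => //; exists (a :: u'); split=> //=; rewrite perm_sym.
  apply: (@reach_trans _ st1); first exact: reach0.
  apply: (@reach_trans _ st2).
    apply: reach_two_equal => //; first by rewrite inE u'0 orbT.
      by rewrite eq_sym.
    by apply: contraNneq S0'; rewrite /S => ->; rewrite subrr.
  apply: (@reach_trans _ st2'); first exact: reach0.
  apply: reach_trans (reach_two_equal G2 _ _ _) _.
  - by rewrite inE u'0 orbT.
  - by apply: contra S0' => /eqP E; apply/eqP; lra.
  - by apply: contra xa => /eqP E; rewrite /S in E; apply/eqP; lra.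
  apply: reach0 => /=; first by rewrite /S; ring.
  have -> : a - S - (a - S + (a - S) + a - (d - S)) = a - (a + a + a - d) + (x - a) - (x - a) by rewrite /S; ring.
  rewrite addrK perm_cons perm_cons.
  have -> : a - (a - S + (a - S) + a - (d - S)) = x by rewrite /S; ring.
  have -> : x - S = a - (a + a + a - d) by rewrite /S; ring.
  rewrite perm_sym; apply: (@perm_trans _ [:: a - (a + a + a - d), x & u']); first by rewrite perm_cons.
  by rewrite perm_swap.
have [ac|ac] := eqVneq a c.
  subst c; apply: (twist a a b) => //; first by ring.
  by apply: reach_two_equal => //; [apply: goodP | rewrite addrAC].
have [bc|bc] := eqVneq b c.
  subst c; apply: (twist b b a) => //; first by ring.
  apply: reach_two_equal => //; first exact: goodP.
    by rewrite eq_sym.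
  by rewrite addrC addrA.
apply: (@reachS _ a b c (d - (a + b + c - d),
    [:: a - (a + b + c - d), b - (a + b + c - d), c - (a + b + c - d) & u])) => //.
  by exists u.
exact: reach0.
Qed.
End Paths.

Lemma in_enumT (T : finType) (x : T) : x \in enum T.
Proof. by rewrite mem_enum. Qed.

(** * The path of values attached to an orbit data *)

Section PathOfOrbitData.
Variables (R : realType) (tau : orbit_data).
Local Notation basis := Defs.basis.
Local Notation n := (od_n tau).
Local Notation T := {iota : Kset n & 'I_(od_kappa tau iota)}.
Implicit Types (rho : basis tau -> R).

(* The two zeros stand for two more points, which serve to perturb the triples. *)
Definition cstate rho : R * seq R :=
  (rho None, [seq rho (Some x) | x : T] ++ [:: 0; 0]).

Lemma cstate_q rho (m : 'I_n) : exists a b c u,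
  [/\ (2 <= count_mem 0%R u)%N, perm_eq (cstate rho).2 [:: a, b, c & u],
   (cstate (pull (@q tau m) rho)).1 = rho None - (a + b + c - rho None) &
   perm_eq (cstate (pull (@q tau m) rho)).2
     [:: a - (a + b + c - rho None), b - (a + b + c - rho None), c - (a + b + c - rho None) & u]].
Proof.
pose B := [:: first_index (m, 0); first_index (m, 1); first_index (m, 2%:R)] : seq T.
pose U := [seq x <- enum {: T} | x \notin B].
have bB x : is_base m (Some x) = (x \in B).
  rewrite /B !inE /=; apply/existsP/or3P => [[a /eqP ->]|].
    case: a => [[|[|[|//]]] lt]; [apply: Or31|apply: Or32|apply: Or33]; apply/eqP;
    by congr (first_index (m, _)); apply: val_inj.
  by case=> /eqP ->; [exists 0 | exists 1 | exists 2%:R].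
have uB : uniq B.
  by rewrite /B /= !inE !(inj_eq (@first_index_inj tau m)).
have P : perm_eq (enum {: T}) (B ++ U).
  apply: uniq_perm; first exact: enum_uniq.
    rewrite cat_uniq uB filter_uniq ?enum_uniq // andbT -all_predC; apply/allP => x.
    by rewrite mem_filter => /andP[].
  by move=> x; rewrite in_enumT mem_cat [x \in U]mem_filter in_enumT andbT orbN.
have S3 : defect rho m = rho (Some (first_index (m, 0))) + rho (Some (first_index (m, 1))) + rho (Some (first_index (m, 2%:R))) - rho None.
  rewrite /defect !big_ord_recl big_ord0 addr0 addrA.
  by congr (_ + rho (Some (first_index (m, _))) + rho (Some (first_index (m, _))) - _); apply: val_inj.
exists (rho (Some (first_index (m, 0)))), (rho (Some (first_index (m, 1)))), (rho (Some (first_index (m, 2%:R)))).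
exists ([seq rho (Some x) | x <- U] ++ [:: 0; 0]).
rewrite -S3; split=> /=.
- by rewrite count_cat /= eqxx; lia.
- rewrite -[X in perm_eq _ X]/(([seq rho (Some x) | x <- B] ++ [seq rho (Some x) | x <- U]) ++ [:: 0; 0]).
  by rewrite -map_cat perm_cat2r perm_map.
- by rewrite pull_q mul1r.
- rewrite -[X in perm_eq _ X]/(([seq rho (Some x) - defect rho m | x <- B] ++ [seq rho (Some x) | x <- U]) ++ [:: 0; 0]).
  rewrite perm_cat2r.
  have -> : [seq rho (Some x) - defect rho m | x <- B] ++ [seq rho (Some x) | x <- U] =
     [seq pull (@q tau m) rho (Some x) | x <- B ++ U].
    rewrite map_cat; congr (_ ++ _); apply/eq_in_map => x xB; rewrite pull_q bB.
      by rewrite xB mul1r.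
    by move: xB; rewrite mem_filter => /andP[/negbTE -> _]; rewrite mul0r subr0.
  by rewrite perm_map.
Qed.

Lemma cstate_r rho : (cstate (pull (@r_tau tau) rho)).1 = (cstate rho).1 /\
  perm_eq (cstate (pull (@r_tau tau) rho)).2 (cstate rho).2.
Proof.
split; first by rewrite /= pull_r.
rewrite perm_cat2r.
have -> : [seq pull (@r_tau tau) rho (Some x) | x : T] = [seq rho (Some x) | x <- [seq r_index x | x : T]].
  by rewrite -map_comp; apply: eq_map => x /=; rewrite pull_r.
apply: perm_map; apply: uniq_perm; rewrite ?enum_uniq //.
  by rewrite map_inj_uniq ?enum_uniq //; apply: r_index_inj.
move=> x; rewrite in_enumT; apply/mapP.
have /codomP [y ->] : x \in codom (@r_index tau).
  by have /inj_card_onto -> := @r_index_inj tau.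
by exists y => //; rewrite in_enumT.
Qed.

Lemma cstate_stage (P : R * seq R -> Prop) rho ms :
  (forall x a b c y, cstep x a b c y -> P x -> P y) -> P (cstate rho) -> P (cstate (stage rho ms)).
Proof.
move=> H; elim: ms rho => //= m ms IH rho Px; apply: IH.
have [a [b [c [u [u2 P1 E P2]]]]] := cstate_q rho m.
by apply: H Px; exists u; split; [exact: P1 | exact: E | exact: P2].
Qed.

Lemma commens_at_perm (g : R) x y : x.1 = y.1 -> perm_eq x.2 y.2 -> commens_at g x -> commens_at g y.
Proof. by move=> E P [H1 H2]; split; rewrite -?E // => t; rewrite -(perm_mem P); apply: H2. Qed.

Definition cscale (k : R) (x : R * seq R) := (k * x.1, [seq k * t | t <- x.2]).

Lemma cstate_scale k rho : cstate (fun b => k * rho b) = cscale k (cstate rho).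
Proof. by rewrite /cscale /cstate /= map_cat /= mulr0 -map_comp. Qed.

(** The quantities sum t - 3 d and sum t^2 - d^2 are invariant under steps, but scaling by c
    multiplies them by c and c^2, so both vanish. If all values were multiples of g, the steps would
    show the same for c times the values, so g / c would do as well. Then 1 is an integer multiple
    of g / c^k for all k, which forces g = 0. *)
Lemma eigenfun_good rho c : rho None = 1 -> 0 < c < 1 -> eigenfun rho c -> good (cstate rho).
Proof.
move=> r1 /andP[c0 c1] Hr; have [Er Pr] := cstate_r rho.
have Es : cstate (stage (pull (@r_tau tau) rho) (enum 'I_n)) = cscale c (cstate rho).
  by rewrite -cstate_scale; congr cstate; apply/funext => b; rewrite -pull_w Hr.
split.
- pose P x := \sum_(t <- x.2) t - 3 * x.1 = \sum_(t <- (cstate rho).2) t - 3 * (cstate rho).1.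
  have : P (cscale c (cstate rho)).
    rewrite -Es; apply: cstate_stage; last by rewrite /P Er (perm_big _ Pr).
    move=> x a' b' c' y [u [P1 E P2]]; rewrite /P => <-.
    rewrite (perm_big _ P1) (perm_big _ P2) /= !big_cons E; ring.
  rewrite /P /= big_map -mulr_sumr r1.
  set s := bigop.body _ _ _; move=> E; apply/eqP; rewrite -subr_eq0.
  have : (1 - c) * (s - 3 * 1) = (s - 3 * 1) - (c * s - 3 * (c * 1)) by ring.
  rewrite E subrr.
  by move/eqP; rewrite mulf_eq0 [1 - _ == 0]subr_eq0 gt_eqF.
- pose P x := \sum_(t <- x.2) t ^+ 2 - x.1 ^+ 2 = \sum_(t <- (cstate rho).2) t ^+ 2 - (cstate rho).1 ^+ 2.
  have : P (cscale c (cstate rho)).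
    rewrite -Es; apply: cstate_stage; last by rewrite /P Er (perm_big _ Pr).
    move=> x a' b' c' y [u [P1 E P2]]; rewrite /P => <-.
    rewrite (perm_big _ P1) (perm_big _ P2) /= !big_cons E; ring.
  rewrite /P /= big_map r1.
  under eq_bigr do rewrite exprMn.
  rewrite -mulr_sumr; set s := bigop.body _ _ _; move=> E; apply/eqP; rewrite -subr_eq0.
  have : (1 - c ^+ 2) * (s - 1 ^+ 2) = (s - 1 ^+ 2) - (c ^+ 2 * s - (c * 1) ^+ 2) by ring.
  rewrite E subrr.
  by move/eqP; rewrite mulf_eq0 [1 - _ == 0]subr_eq0 gt_eqF // expr_lt1 // ltW.
- move=> [g Hg].
  have step h : commens_at h (cstate rho) -> commens_at (h / c) (cstate rho).
    move=> Hh; have : commens_at h (cscale c (cstate rho)).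
      rewrite -Es; apply: cstate_stage; first by move=> *; apply: cstep_commens_at; eassumption.
      by apply: commens_at_perm Hh; rewrite // perm_sym.
    have cE (t : R) (k : int) : c * t = h *~ k -> t = (h / c) *~ k.
      move=> E; apply: (mulfI (lt0r_neq0 c0)); rewrite E -[h *~ k]mulrzr -[_ *~ k]mulrzr; field; exact: lt0r_neq0.
    move=> [[k Ek] H]; split; first by exists k; apply: cE.
    move=> t ts; have [|j Ej] := H (c * t); first by apply: map_f.
    by exists j; apply: cE.
  have {}step k : commens_at (g / c ^+ k) (cstate rho).
    elim: k => [|k IH]; first by rewrite expr0 divr1.
    by have := step _ IH; rewrite -mulrA -invfM -exprSr.
  have bound k : `|g| <= c ^+ k.
    have [[z /= Ez] _] := step k; rewrite r1 in Ez.
    have z0 : z != 0 by apply/eqP => z0; move/eqP: Ez; rewrite z0 mulr0z oner_eq0.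
    have ck := exprn_gt0 k c0.
    have : 1 = `|g| / c ^+ k * `|z|%:~R.
      have := congr1 Num.norm Ez; rewrite -[_ *~ z]mulrzr !normrM normr1 normfV (gtr0_norm ck).
      by rewrite intr_norm.
    have : 1 <= `|z|%:~R :> R by rewrite ler1z; lia.
    move=> z1 E; rewrite -[leRHS]mul1r -ler_pdivrMr // E ler_peMr //.
    by rewrite divr_ge0 // ltW.
  have g0 : g != 0.
    by apply/eqP => g0; have [[z /= Ez] _] := Hg; move/eqP: Ez; rewrite r1 g0 mul0rz oner_eq0.
  have cv : (fun k : nat => c ^+ k) @ \oo --> (0 : R).
    by apply: cvg_expr; rewrite gtr0_norm.
  have : `|g| <= 0 by apply: (cvgr_to_ge cv); near=> k; apply: bound.
  by rewrite normr_le0 (negbTE g0).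
Unshelve. all: by end_near. Qed.

Lemma eigenfun_reach rho c : rho None = 1 -> 0 < c < 1 -> eigenfun rho c ->
  reach (cstate rho) (cscale c (cstate rho)).
Proof.
move=> r1 c01 Hr; have G := eigenfun_good r1 c01 Hr.
have [Er Pr] := cstate_r rho.
have Es : cstate (stage (pull (@r_tau tau) rho) (enum 'I_n)) = cscale c (cstate rho).
  by rewrite -cstate_scale; congr cstate; apply/funext => b; rewrite -pull_w Hr.
have Gr : good (cstate (pull (@r_tau tau) rho)).
  case: G => G1 G2 G3; split; rewrite ?Er ?(perm_big _ Pr) //.
  move=> [g Hg]; apply: G3; exists g; exact: commens_at_perm Hg.
rewrite -Es; apply: (@reach_trans _ _ (cstate (pull (@r_tau tau) rho))).
  by apply: reach0; rewrite ?Er // perm_sym.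
elim: (enum _) (pull _ rho) Gr => [|m ms IH] r' Gr /=; first exact: reach0.
have [a [b [c' [u [u2 P1 E P2]]]]] := cstate_q r' m.
apply: reach_trans; last first.
  apply: IH; apply: cstep_good Gr; by exists u; split; [exact: P1 | exact: E | exact: P2].
have G' : good (r' None, [:: a, b, c' & u]).
  case: Gr => G1 G2 G3; split; rewrite /= -?(perm_big _ P1) //.
  move=> [g Hg]; apply: G3; exists g; apply: commens_at_perm Hg => //=; by rewrite perm_sym.
apply: (@reach_trans _ _ (r' None, [:: a, b, c' & u])); first exact: reach0.
apply: reach_trans (reach_step G' u2) _; apply: reach0 => /=; first by rewrite -E.
by rewrite perm_sym.
Qed.
End PathOfOrbitData.

(** * Orbits of points of the cubic *)

Section PointMap.
Variable F : numFieldType.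
Implicit Types (b : 'I_3 -> F) (dl t : F) (p : F * nat).

Definition bsum b : F := \sum_a b a.
(** A parameter is a value minus d / 3. A step lowers d by S = [bsum b], so the parameter of an
    unchanged value increases by S / 3, and that of a base value, which is lowered by S, decreases
    by 2 S / 3. Geometrically, [bminus b dl a] is the image of b a - S, the third point of C^* on
    the line through the other two base points, which is contracted. *)
Definition aff b dl t : F := dl * (t + bsum b / 3).
Definition bminus b dl (a : 'I_3) : F := dl * (b a - 2 * bsum b / 3).

(* (t, h) is the point of height h over the point of parameter t of C^*. Blowing up a base point
   lowers the points over it by 1, and contracting a line onto a base point of the inverse raises
   them by 1. *)
Definition point_map b dl p : F * nat :=
  if [pick a | p == (b a, 0%N)] is Some a then (bminus b dl a, 0%N)
  else (aff b dl p.1,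
        (p.2 - [exists a, p.1 == b a] + [exists a, aff b dl p.1 == bminus b dl a])%N).

Lemma bsum_minus b dl : bsum (bminus b dl) = - dl * bsum b.
Proof. by rewrite /bsum /bminus /bsum !big_ord_recl !big_ord0; field. Qed.

Lemma aff_minusK b dl : dl != 0 -> cancel (aff b dl) (aff (bminus b dl) dl^-1).
Proof. by move=> d0 t; rewrite /aff bsum_minus; field. Qed.

Lemma bminusK b dl : dl != 0 -> bminus (bminus b dl) dl^-1 = b.
Proof. by move=> d0; apply/funext => a; rewrite /bminus bsum_minus; field. Qed.

Lemma bminus_inj b dl : dl != 0 -> injective b -> injective (bminus b dl).
Proof. by move=> d0 bi a a' /(mulfI d0) /addIr /bi. Qed.

Lemma point_map_base b dl a : injective b -> point_map b dl (b a, 0%N) = (bminus b dl a, 0%N).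
Proof.
move=> bi; rewrite /point_map; case: pickP => [a' /eqP [/bi -> //]|/(_ a)].
by rewrite eqxx.
Qed.

Lemma point_map_nbase b dl p : (forall a, p <> (b a, 0%N)) -> point_map b dl p =
  (aff b dl p.1,
  (p.2 - [exists a, p.1 == b a] + [exists a, aff b dl p.1 == bminus b dl a])%N).
Proof. by move=> H; rewrite /point_map; case: pickP => // a /eqP /H. Qed.

Lemma point_map_nbase_minus b dl p a' : (forall a, p <> (b a, 0%N)) -> point_map b dl p <> (bminus b dl a', 0%N).
Proof.
move=> H; rewrite point_map_nbase // => -[E] /eqP; rewrite addn_eq0 => /andP[_].
by case: existsP => // -[]; exists a'; rewrite E.
Qed.

Lemma point_mapK b dl : injective b -> dl != 0 -> cancel (point_map b dl) (point_map (bminus b dl) dl^-1).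
Proof.
move=> bi d0 p; have bi' := bminus_inj d0 bi.
have [[a ->]|nb] := pselect (exists a, p = (b a, 0%N)).
  by rewrite point_map_base // point_map_base // bminusK.
have nb1 a : p <> (b a, 0%N) by move=> E; apply: nb; exists a.
rewrite point_map_nbase; last by move=> a; apply: point_map_nbase_minus.
rewrite point_map_nbase // bminusK //= aff_minusK //.
case: p nb nb1 => t h nb nb1 /=; congr (_, _); rewrite addnK.
case: existsP => [[a /eqP E]|]; last by rewrite subn0 addn0.
have : (0 < h)%N by rewrite lt0n; apply/negP => /eqP h0; apply: (nb1 a); rewrite E h0.
by move=> h0; rewrite subnK.
Qed.

Lemma point_map_inj b dl : injective b -> dl != 0 -> injective (point_map b dl).
Proof. by move=> bi d0; apply: can_inj (point_mapK bi d0). Qed.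

Lemma point_mapVK b dl : injective b -> dl != 0 -> cancel (point_map (bminus b dl) dl^-1) (point_map b dl).
Proof.
move=> bi d0 p; have := @point_mapK (bminus b dl) dl^-1 (bminus_inj d0 bi); rewrite invr_eq0 => /(_ d0 p).
by rewrite bminusK // invrK.
Qed.

(* If the lower of two points over the same proper point is not a base point, neither is the higher,
   and their order is preserved. *)
Lemma point_map_tower b dl t h h' : injective b -> dl != 0 -> (h < h')%N ->
  (forall a, (t, h) <> (b a, 0%N)) ->
  (point_map b dl (t, h)).1 = (point_map b dl (t, h')).1 /\ ((point_map b dl (t, h)).2 < (point_map b dl (t, h')).2)%N.
Proof.
move=> bi d0 hh nb; rewrite !point_map_nbase //; last by move=> a [_ E]; rewrite E ltn0 in hh.
split=> //=; rewrite ltn_add2r.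
case: existsP => [[a /eqP E]|_]; last by rewrite !subn0.
have : (0 < h)%N by rewrite lt0n; apply/negP => /eqP h0; apply: (nb a); rewrite E h0.
by move=> h0; rewrite !subn1; lia.
Qed.

Definition mult_step b dl (s s' : seq F) := exists u,
  perm_eq s ([seq b a | a : 'I_3] ++ u) /\
  perm_eq s' ([seq bminus b dl a | a : 'I_3] ++ [seq aff b dl t | t <- u]).

(** The finite set of points encoded by a multiset of parameters: over t, the heights below the
    multiplicity of t. *)
Definition in_towers (s : seq F) p := (p.2 < count_mem p.1 s)%N.

Lemma count_base b t : injective b -> count_mem t [seq b a | a : 'I_3] = [exists a, t == b a].
Proof.
move=> bi; rewrite count_uniq_mem; last by rewrite map_inj_uniq ?enum_uniq.
by congr nat_of_bool; apply/mapP/existsP => [[a _ ->]|[a /eqP ->]]; exists a => //; rewrite mem_enum.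
Qed.

Lemma in_towers_point_map b dl s s' p : injective b -> dl != 0 -> mult_step b dl s s' ->
  in_towers s' (point_map b dl p) = in_towers s p.
Proof.
move=> bi d0 [u [P P']]; rewrite /in_towers (seq.permP P) (seq.permP P') !count_cat.
rewrite !count_base //; last exact: bminus_inj.
have [[a ->]|nb] := pselect (exists a, p = (b a, 0%N)).
  rewrite point_map_base //=.
  have -> : [exists a0, bminus b dl a == bminus b dl a0] by apply/existsP; exists a.
  by have -> : [exists a0, b a == b a0] by apply/existsP; exists a.
have nb1 a : p <> (b a, 0%N) by move=> E; apply: nb; exists a.
rewrite point_map_nbase //=.
have -> : count_mem (aff b dl p.1) [seq aff b dl t | t <- u] = count_mem p.1 u.
  rewrite count_map; apply: eq_count => t /=.
  by rewrite (inj_eq (can_inj (aff_minusK b d0))).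
rewrite [(_ + count _ _)%N]addnC ltn_add2r.
case: existsP => [[a /eqP E]|_]; last by rewrite subn0.
have : (0 < p.2)%N by rewrite lt0n; apply/negP => /eqP h0; apply: (nb1 a); rewrite [p]surjective_pairing h0 E.
by move=> h0; rewrite subn1 add1n; case: (p.2) h0.
Qed.
End PointMap.

(** * Periodic orbits, their orbit data and its eigenfunction *)

Section Orbits.
Variables (F : numFieldType) (n : nat) (b : nat -> 'I_3 -> F) (dl : nat -> F) (ts : nat -> seq F).
Hypothesis n0 : (0 < n)%N.
Hypothesis bi : forall l, (l < n)%N -> injective (b l).
Hypothesis d0 : forall l, (l < n)%N -> dl l != 0.
Hypothesis st : forall l, (l < n)%N -> mult_step (b l) (dl l) (ts l) (ts l.+1).
Hypothesis stn : perm_eq (ts n) (ts 0).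

Local Notation K := (Kset n).
Local Notation pt := (F * nat)%type.
Implicit Types (iota : K) (p : pt).

Let g m := point_map (b (m %% n)) (dl (m %% n)).
Let ltm m : (m %% n < n)%N. Proof. by rewrite ltn_mod. Qed.

Fixpoint flow m (p : pt) : pt := if m is m'.+1 then g m' (flow m' p) else p.
Fixpoint flowV m (p : pt) : pt :=
  if m is m'.+1 then flowV m' (point_map (bminus (b (m' %% n)) (dl (m' %% n))) (dl (m' %% n))^-1 p) else p.

Lemma flowVK m : cancel (flowV m) (flow m).
Proof. by elim: m => //= m IH p; rewrite IH /g point_mapVK //; [apply: bi|apply: d0]. Qed.

Lemma flow_inj m : injective (flow m).
Proof. by elim: m => //= m IH p p' /point_map_inj E; apply: IH; apply: E; [apply: bi|apply: d0]. Qed.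

Lemma flowD k m p : flow (k * n + m) p = flow m (flow (k * n) p).
Proof. by elim: m => [|m IH]; rewrite ?addn0 // addnS /= IH /g modnMDl. Qed.

Definition round := flow n.
Lemma flow_round k p : flow (k * n) p = iter k round p.
Proof. by elim: k => // k IH; rewrite mulSnr flowD IH. Qed.

Lemma flow_mod m p : flow m p = flow (m %% n) (iter (m %/ n) round p).
Proof. by rewrite {1}(divn_eq m n) flowD flow_round. Qed.

(** The point of plane 0 that reaches the base point p_iota^+ after iota.1 maps. Because [point_map]
    sends this base point to p_iota^-, the orbit prescribed by the realization starts at time iota.1
    + 1. *)
Definition start (iota : K) : pt := flowV iota.1 (b iota.1 iota.2, 0%N).

Lemma flow_start iota : flow iota.1 (start iota) = (b iota.1 iota.2, 0%N).
Proof. by rewrite flowVK. Qed.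

Lemma flow_start_next iota :
  flow iota.1.+1 (start iota) = (bminus (b iota.1) (dl iota.1) iota.2, 0%N).
Proof. by rewrite /= flow_start /g modn_small // point_map_base //; apply: bi. Qed.

Definition hit p m := [exists j, flow m p == (b (m %% n) j, 0%N)].

Lemma in_towers_flow m p : in_towers (ts (m %% n)) (flow m p) = in_towers (ts 0) p.
Proof.
elim: m => [|m IH]; first by rewrite mod0n.
rewrite -IH /= /g -(in_towers_point_map _ (bi (ltm m)) (d0 (ltm m)) (st (ltm m))).
rewrite -addn1 -modnDml addn1; have := ltm m; rewrite leq_eqVlt => /orP[/eqP E|lt].
  by rewrite E modnn /in_towers (seq.permP stn).
by rewrite modn_small.
Qed.

Lemma start_in_towers iota : in_towers (ts 0) (start iota).
Proof.
rewrite -(in_towers_flow iota.1) flow_start modn_small //.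
have [u [P _]] := st (ltn_ord iota.1).
rewrite /in_towers /= (seq.permP P) count_cat count_base ?bi //; last exact: bi.
by have -> : [exists a, b iota.1 iota.2 == b iota.1 a] by apply/existsP; exists iota.2.
Qed.

(** A round permutes the finite set of points in the towers of [ts 0], which contains [start iota];
    conclude by the pigeonhole principle and injectivity. *)
Lemma round_periodic iota : exists2 k, (0 < k)%N & iter k round (start iota) = start iota.
Proof.
pose L := [seq (t, h) | t <- ts 0, h <- seq.iota 0 (size (ts 0))].
have inL p : in_towers (ts 0) p -> p \in L.
  case: p => t h; rewrite /in_towers /= => lt; apply/allpairsP; exists (t, h); split=> //=.
    by rewrite -has_pred1 has_count (leq_ltn_trans _ lt).
  by rewrite mem_iota /= (leq_trans lt) // count_size.
have rt k p : in_towers (ts 0) (iter k round p) = in_towers (ts 0) p.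
  by have := in_towers_flow (k * n) p; rewrite flow_round modnMl.
pose x k := iter k round (start iota).
have : ~~ uniq [seq x k | k <- seq.iota 0 (size L).+1].
  apply/negP => ux; have : (size [seq x k | k <- seq.iota 0 (size L).+1] <= size L)%N.
    apply: uniq_leq_size ux _ => p /mapP [k _ ->]; apply: inL; rewrite rt.
    exact: start_in_towers.
  by rewrite size_map size_iota ltnn.
move=> /(uniqPn (x 0%N)) [i [j [ij]]]; rewrite size_map size_iota => jL.
rewrite !(nth_map 0%N) ?size_iota ?(ltn_trans ij) // !nth_iota ?(ltn_trans ij) // !add0n => E.
exists (j - i)%N; rewrite ?subn_gt0 //.
have inj k : injective (iter k round) by elim: k => //= k IH p q /flow_inj /IH.
by apply: (inj i); rewrite -iterD subnKC 1?ltnW // -/(x j) -E.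
Qed.

Lemma next_hit iota : exists m, (iota.1 < m)%N && hit (start iota) m.
Proof.
have [k k0 E] := round_periodic iota; exists (k * n + iota.1)%N; apply/andP; split.
  by rewrite -[X in (X < _)%N]add0n ltn_add2r muln_gt0 k0.
apply/existsP; exists iota.2; rewrite flowD flow_round E modnMDl modn_small // flow_start //.
Qed.

Definition return_time iota := ex_minn (next_hit iota).

Lemma return_timeP iota : [/\ (iota.1 < return_time iota)%N, hit (start iota) (return_time iota) &
  forall m, (iota.1 < m < return_time iota)%N -> ~~ hit (start iota) m].
Proof.
rewrite /return_time; case: ex_minnP => m /andP[h1 h2] h3; split=> // m' /andP[lt lt'].
by apply: contraL lt' => h; rewrite -leqNgt h3 // lt.
Qed.

Definition succ iota : K :=
  (Ordinal (ltm (return_time iota)),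
   odflt 0 [pick j | flow (return_time iota) (start iota) == (b (return_time iota %% n) j, 0%N)]).

Lemma flow_succ iota : flow (return_time iota) (start iota) = (b (succ iota).1 (succ iota).2, 0%N).
Proof.
rewrite /succ /=; case: pickP => [j /eqP ->//|no].
by have [_ /existsP [j] + _] := return_timeP iota; rewrite no.
Qed.

Definition wraps iota := (return_time iota %/ n)%N.

Lemma return_timeE iota : return_time iota = (wraps iota * n + (succ iota).1)%N.
Proof. exact: divn_eq. Qed.

Lemma start_succ iota : start (succ iota) = iter (wraps iota) round (start iota).
Proof.
by apply: (@flow_inj (succ iota).1); rewrite flow_start -flow_succ [in LHS]flow_mod.
Qed.

Lemma no_hit_between iota iota' k : (iota.1 < k * n + iota'.1 < return_time iota)%N ->
  start iota' <> iter k round (start iota).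
Proof.
move=> lt E; have [_ _ /(_ _ lt)] := return_timeP iota; apply/negP; rewrite negbK.
apply/existsP; exists iota'.2; rewrite flowD flow_round -E flow_start modnMDl modn_small //.
Qed.

(** If two orbits end at the same base point, one is a continuation of the other. The start of the
    shorter one would be a base point met by the longer one before its return, unless both start at
    the same place. *)
Lemma succ_inj : injective succ.
Proof.
move=> iota iota'; wlog le : iota iota' / (wraps iota <= wraps iota')%N.
  move=> W E; case: (leqP (wraps iota) (wraps iota')) => [le|/ltnW le]; first exact: W.
  by apply/esym; apply: W.
move=> E; pose k := (wraps iota' - wraps iota)%N.
have inj m : injective (iter m round) by elim: m => //= m IH p q /flow_inj /IH.
have Es : start iota = iter k round (start iota').
  apply: (inj (wraps iota)); rewrite -iterD subnKC // -!start_succ E //.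
have [lt1 _ _] := return_timeP iota; have [lt2 _ _] := return_timeP iota'.
have EN : return_time iota' = (k * n + return_time iota)%N.
  by rewrite !return_timeE E addnA -mulnDl subnK.
have le2 : (k * n + iota.1 <= iota'.1)%N.
  rewrite leqNgt; apply/negP => lt; apply: (no_hit_between (k := k)) Es.
  by rewrite lt EN ltn_add2l.
have k0 : k = 0%N.
  apply/eqP; rewrite -leqn0 leqNgt; apply/negP => k0.
  have := ltn_ord iota'.1; rewrite ltnNge => /negP; apply.
  by apply: leq_trans le2; rewrite (leq_trans _ (leq_addr _ _)) // leq_pmull.
rewrite k0 mul0n add0n in le2; rewrite k0 mul0n add0n in EN; rewrite k0 /= in Es.
have E1 : iota.1 = iota'.1.
  apply: val_inj; apply/eqP; rewrite eqn_leq le2 leqNgt; apply/negP => lt.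
  by apply: (@no_hit_between iota iota' 0) => //; rewrite mul0n add0n lt -EN.
have := flow_start iota'; rewrite -Es -E1 flow_start => -[/bi E2].
by rewrite [iota]surjective_pairing [iota']surjective_pairing -E1 E2.
Qed.

Lemma slot_inj iota iota' k k' : (k < wraps iota)%N -> (k' < wraps iota')%N ->
  iter k round (start iota) = iter k' round (start iota') -> iota = iota' /\ k = k'.
Proof.
wlog le : iota iota' k k' / (k' <= k)%N.
  move=> W kk kk' E; case: (leqP k' k) => [le|/ltnW le]; first exact: W.
  by have [] := W _ _ _ _ le kk' kk (esym E).
move=> kk kk' E.
have inj m : injective (iter m round) by elim: m => //= m IH p q /flow_inj /IH.
have Es : start iota' = iter (k - k') round (start iota).
  by apply: (inj k'); rewrite -iterD subnKC.
have N1 : (wraps iota * n <= return_time iota)%N by rewrite return_timeE leq_addr.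
have N2 : (wraps iota' * n <= return_time iota')%N by rewrite return_timeE leq_addr.
have le2 : ((k - k') * n + iota'.1 <= iota.1)%N.
  rewrite leqNgt; apply/negP => lt; apply: no_hit_between Es; rewrite lt /=.
  apply: leq_trans N1; apply: (@leq_trans ((k - k').+1 * n)).
    by rewrite mulSnr ltn_add2l.
  by rewrite leq_mul2r (leq_trans _ kk) ?orbT // ltnS leq_subr.
have j0 : (k - k' = 0)%N.
  apply/eqP; rewrite -leqn0 leqNgt; apply/negP => j0.
  have := ltn_ord iota.1; rewrite ltnNge => /negP; apply.
  by apply: leq_trans le2; rewrite (leq_trans _ (leq_addr _ _)) // leq_pmull.
rewrite j0 mul0n add0n in le2; rewrite j0 /= in Es.
have E1 : iota'.1 = iota.1.
  apply: val_inj; apply/eqP; rewrite eqn_leq le2 leqNgt; apply/negP => lt.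
  apply: (@no_hit_between iota' iota 0) => //; rewrite mul0n add0n lt /=.
  by apply: leq_trans N2; rewrite (leq_trans (ltn_ord iota.1)) // leq_pmull // (leq_ltn_trans _ kk').
have := flow_start iota; rewrite -Es -E1 flow_start => -[/bi E2].
split; last by apply/eqP; rewrite eqn_leq le -subn_eq0 j0.
by rewrite [iota]surjective_pairing [iota']surjective_pairing E1 E2.
Qed.

(** With kappa the number of full rounds, kappa(iota) n + i_1 is the return time, and mu(iota) is
    the number of maps from p_iota^- to the next base point. *)
Definition orbit_of_quadratics : orbit_data.
Proof.
apply: (@OrbitData n (perm succ_inj) wraps n0) => iota.
by rewrite permE -return_timeE; have [] := return_timeP iota.
Defined.

Lemma mu_orbit iota : @mu orbit_of_quadratics iota = (return_time iota - iota.1.+1)%N.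
Proof. by rewrite /mu /= permE -return_timeE. Qed.

Variable dd : nat -> F.
Hypothesis dd_step : forall l, (l < n)%N -> dd l.+1 = dl l * (dd l - bsum (b l)).
Hypothesis dd_n : dd n = dd 0.
Hypothesis b0 : forall l, (l < n)%N -> bsum (b l) != 0.

Local Notation tau := orbit_of_quadratics.
Local Notation T := {iota : Kset n & 'I_(od_kappa tau iota)}.

(* [class_fun l] lives on the l-th plane, where the basis vector (iota, k) stands for the point of the
   orbit of iota which is met in the (k + 1)-st round. *)
Definition slot_point (x : T) : pt := iter (tagged x) round (start (tag x)).
Definition class_fun l (v : Defs.basis tau) : F :=
  if v is Some x then (flow l (slot_point x)).1 + dd l / 3 else dd l.

Lemma start_sigma0 (iota : K) : od_kappa tau iota = 0%N -> start (od_sigma tau iota) = start iota.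
Proof. by move=> k0; rewrite /= permE start_succ [wraps iota]k0. Qed.

(** An index with kappa = 0 meets the next base point in the same round, so both correspond to one
    point of plane 0. This is the identification made by [sigma_bar]. *)
Lemma start_bar (iota : K) : start (@sigma_bar tau iota) = start iota.
Proof.
have [k _ [-> H]] := @sigma_bar_has tau iota.
elim: k H => [//|k IH] H; rewrite iterS start_sigma0; last by apply: H.
by apply: IH => l lk; apply: H; apply: ltnW.
Qed.

Lemma slot_point_first (iota : K) : slot_point (@first_index tau iota) = start iota.
Proof. exact: start_bar. Qed.

Lemma slot_point_inj : injective slot_point.
Proof.
move=> [iota k] [iota' k'] /slot_inj /= [||E1 E2]; try exact: ltn_ord.
by subst iota'; congr existT; apply: val_inj.
Qed.

Lemma class_fun_q (m : 'I_n) v : dl m * pull (@q tau m) (class_fun m) v = class_fun m.+1 v.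
Proof.
have E (a : 'I_3) : flow m (slot_point (@first_index tau (m, a))) = (b m a, 0%N).
  by rewrite slot_point_first -(flow_start (m, a)).
have S : defect (class_fun m) m = bsum (b m).
  rewrite /defect /class_fun /= /bsum (eq_bigr (fun a => b m a + dd m / 3)); last by move=> a _; rewrite E.
  by rewrite big_split /= sumr_const card_ord -mulr_natr; field.
rewrite pull_q S; case: v => [x|]; last by rewrite /= mul1r dd_step.
rewrite /= /g modn_small // dd_step //.
case: existsP => [[a /eqP ->]|nb].
  by rewrite E point_map_base /= ?/bminus; [field | apply: bi].
rewrite point_map_nbase /=; first by rewrite /aff; field.
move=> a Ea; case: nb; exists a; apply/eqP/slot_point_inj.
by apply: (@flow_inj m); rewrite E.
Qed.

Lemma class_fun_r v : pull (@r_tau tau) (class_fun n) v = class_fun 0 v.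
Proof.
rewrite pull_r; case: v => [x|] /=; last by rewrite dd_n.
rewrite dd_n; congr (_ + _); congr fst.
rewrite -/round -[round _]/(iter (tagged (r_index x)).+1 round (start (tag (r_index x)))).
case: (r_indexP x) => [[E1 E2]|[E1 E2 E3]].
  by rewrite /slot_point E2 E1.
rewrite E2 /slot_point E1 /= -E3 start_bar /= permE start_succ //.
Qed.

Lemma class_fun_stage l v : (l <= n)%N ->
  (\prod_(i < l) dl i) * stage (class_fun 0) (take l (enum 'I_n)) v = class_fun l v.
Proof.
elim: l v => [|l IH] v ln; first by rewrite big_ord0 mul1r take0.
rewrite big_ord_recr /= (take_nth (Ordinal ln)) ?size_enum_ord // /stage foldl_rcons.
have -> : nth (Ordinal ln) (enum (ordinal n)) l = Ordinal ln by exact: (nth_ord_enum _ (Ordinal ln)).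
rewrite -/(stage _ _) -[RHS](class_fun_q (Ordinal ln)).
rewrite [_ * dl l]mulrC -mulrA /pull; congr (_ * _).
rewrite -extZ; apply: eq_ext => u; rewrite IH //; exact: ltnW.
Qed.

Lemma prod_dl_neq0 l : (l <= n)%N -> \prod_(i < l) dl i != 0.
Proof. by move=> ln; apply/prodf_neq0 => i _; apply: d0; apply: leq_trans ln. Qed.

Lemma ext_class_fun_w v : ext (class_fun n) (w v) = ext (stage (class_fun 0) (enum 'I_n)) v.
Proof. by rewrite ext_w; congr (ext (stage _ _) _); apply/funext => u; rewrite class_fun_r. Qed.

(** Precomposing [class_fun n] with r gives [class_fun 0], and each q_m then moves on to the next
    plane up to the factor dl m. *)
Lemma class_fun_eigen : eigenfun (class_fun n) (\prod_(i < n) dl i)^-1.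
Proof.
move=> v; rewrite /pull ext_class_fun_w ext_unit -(class_fun_stage v (leqnn n)) take_oversize ?size_enum_ord //.
by rewrite mulKf // prod_dl_neq0.
Qed.

Lemma pull_qK (rho : Defs.basis tau -> F) (m : 'I_n) : pull (@q tau m) (pull (@q tau m) rho) = rho.
Proof.
apply/funext => v; rewrite !pull_q.
have -> : defect (pull (@q tau m) rho) m = - defect rho m.
  rewrite {1}/defect pull_q mul1r (eq_bigr (fun a => rho (Some (@first_index tau (m, a))) - defect rho m)).
    by rewrite sumrB sumr_const card_ord /defect -mulr_natr; ring.
  move=> a _; rewrite pull_q.
  have -> : @is_base tau m (Some (@first_index tau (m, a))) by apply/existsP; exists a.
  by rewrite mul1r.
by ring.
Qed.

Lemma stage_foldl (rho : Defs.basis tau -> F) ms v :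
  ext (stage rho ms) (foldl (fun u m => @q tau m u) v ms) = ext rho v.
Proof.
elim: ms rho v => //= m ms IH rho v.
by rewrite IH /q ext_linear -/(@q tau m) pull_qK.
Qed.

(** The q_m are involutions, so those with m > l in w cancel against [q_above l]; the vector v is
    thus evaluated on the plane l + 1 to which it belongs. *)
Lemma ext_q_above (l : 'I_n) v : (\prod_(i < l.+1) dl i) * ext (class_fun n) (w (@q_above tau l v)) = ext (class_fun l.+1) v.
Proof.
rewrite ext_class_fun_w /q_above.
have -> : [seq m : 'I_n <- enum 'I_n | (l < m)%N] = drop l.+1 (enum 'I_n).
  have E : map (@nat_of_ord n) [seq m : 'I_n <- enum 'I_n | (l < m)%N] = map (@nat_of_ord n) (drop l.+1 (enum 'I_n)).
    rewrite map_drop val_enum_ord drop_iota add0n.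
    transitivity [seq i <- map (@nat_of_ord n) (enum 'I_n) | (l < i)%N]; first by rewrite filter_map.
    rewrite val_enum_ord.
    have -> : seq.iota 0 n = seq.iota 0 l.+1 ++ seq.iota l.+1 (n - l.+1).
      by rewrite -{1}(subnKC (ltn_ord l)) iotaD.
    rewrite filter_cat; have /eqP -> : [seq i <- seq.iota 0 l.+1 | (l < i)%N] == [::].
      rewrite -[_ == _]negbK -has_filter; apply/hasPn => i; rewrite mem_iota /= add0n.
      by rewrite -leqNgt ltnS.
    by apply/all_filterP/allP => i; rewrite mem_iota => /andP[].
  exact: (inj_map val_inj E).
rewrite -{1}(cat_take_drop l.+1 (enum 'I_n)) /stage foldl_cat -!/(stage _ _) stage_foldl.
by rewrite -extZ; apply: eq_ext => u; rewrite class_fun_stage.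
Qed.

Hypothesis lam : forall k, (0 < k)%N -> (\prod_(i < n) dl i) ^+ k != 1.

Lemma periodic_class_fun0 (l : 'I_n) v k : (0 < k)%N ->
  iter k (@w tau) (@q_above tau l v) = @q_above tau l v -> ext (class_fun l.+1) v = 0.
Proof.
move=> k0 E; set al := @q_above tau l v in E.
have p0 := prod_dl_neq0 (leqnn n).
have it j u : ext (class_fun n) (iter j (@w tau) u) = (\prod_(i < n) dl i) ^- j * ext (class_fun n) u.
  elim: j u => [|j IH] u; first by rewrite expr0 invr1 mul1r.
  by rewrite iterS (eigenfun_ext _ class_fun_eigen) IH mulrA -invfM -exprS.
have z : ext (class_fun n) al = 0.
  have /eqP := it k al; rewrite E -subr_eq0 -{1}[ext _ _]mul1r -mulrBl mulf_eq0.
  rewrite subr_eq0 eq_sym invr_eq1 (negbTE (lam k0)) => /eqP //.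
by rewrite -ext_q_above (eigenfun_ext _ class_fun_eigen) z !mulr0.
Qed.

Lemma e_next_slot (iota : K) k : (k <= wraps iota)%N -> exists x,
  @e_next tau iota k = unit_vector (Some x) /\ slot_point x = iter k round (start iota).
Proof.
move=> kk; rewrite /e_next; case: ifP => [/andP[k0 /eqP ->]|C].
  exists (@first_index tau (od_sigma tau iota)); rewrite -e_unit; split=> //.
  by rewrite slot_point_first /= permE start_succ.
have [k0|k0] := posnP (od_kappa tau iota).
  have -> : k = 0%N by apply/eqP; rewrite -leqn0 -k0.
  by exists (@first_index tau iota); rewrite -e_unit slot_point_first.
have lt : (k < od_kappa tau iota)%N.
  by rewrite ltn_neqAle kk andbT; move: C; rewrite k0 /= => ->.
exists (@basis_index tau iota (Ordinal lt)); rewrite -e_unit sigma_bar_id //.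
Qed.

Lemma flow_tower m m' p p' s : m = m' %[mod n] -> (flow m p).1 = (flow m' p').1 ->
  ((flow m' p').2 < (flow m p).2)%N -> (forall l, (l < s)%N -> ~~ hit p' (m' + l)) ->
  (flow (m + s) p).1 = (flow (m' + s) p').1 /\ ((flow (m' + s) p').2 < (flow (m + s) p).2)%N.
Proof.
move=> E E1 lt; elim: s => [|s IH] H; first by rewrite !addn0.
have {IH} [|E2 lt2] := IH; first by move=> l ls; apply: H; apply: ltnW.
rewrite !addnS /= /g; have -> : ((m + s) %% n = (m' + s) %% n)%N by rewrite -modnDml E modnDml.
case: (flow (m + s) p) E2 lt2 => t h; have := H s (ltnSn s); rewrite /hit.
case: (flow (m' + s) p') => t' h' /= nb -> lt2.
have nb' a : (t', h') <> (b ((m' + s) %% n) a, 0%N).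
  by move=> Ea; move/existsPn: nb => /(_ a); rewrite Ea eqxx.
by have [-> ?] := point_map_tower (bi (ltm (m' + s))) (d0 (ltm (m' + s))) lt2 nb'.
Qed.

Lemma orbit_realizability : realizability tau.
Proof.
move=> v Gv k k0 E; case: Gv => [[l _ Ev]|[[iota [iota' [m [/andP[th0 th] [h [H1 H2]] Ev]]]]|]].
(* The value on this root is minus the sum of the [bminus], that is dl l * bsum (b l); it is
   non-zero because the base points are not collinear. *)
- move: E; rewrite -Ev => E; have /eqP := periodic_class_fun0 k0 E.
  rewrite extB e0_unit ext_sum ext_unit.
  rewrite (eq_bigr (fun a => bminus (b l) (dl l) a + dd l.+1 / 3)); last first.
    by move=> a _; rewrite e1_bar_unit ext_unit /class_fun slot_point_first (flow_start_next (l, a)).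
  rewrite big_split /= -/(bsum (bminus (b l) (dl l))) bsum_minus sumr_const card_ord -mulr_natr.
  move=> /eqP H; have /eqP : dl l * bsum (b l) = 0 by rewrite -H; field.
  by rewrite mulf_eq0 (negbTE (d0 _)) // (negbTE (b0 _)).
- move: th0 th H1 H2; rewrite /theta !mu_orbit -[od_n tau]/n => th0 th H1 H2.
  have [N1 h1 nh1] := return_timeP iota; have [N2 h2 nh2] := return_timeP iota'.
  set i := nat_of_ord iota.1 in th0 th H1 H2 N1 h1 nh1.
  set i' := nat_of_ord iota'.1 in th0 th H1 H2 N2 h2 nh2.
  set N := return_time iota in th0 th H1 H2 N1 h1 nh1.
  set N' := return_time iota' in th0 th H1 H2 N2 h2 nh2.
  (* For h = 0 as for h > 0: counted from plane i' + 1, the orbit of iota returns no later than that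
     of iota'. *)
  have th' : (N - i.+1 <= N' - i'.+1 + (m * n + i' - i))%N.
    case: h H1 H2 => [|h] H1 H2.
      by move: H2; rewrite /= mul1n => /ltnW.
    by have := H1 0%N isT; rewrite /= !mu_orbit -/i -/N -/N' -/i' mul1n => ->.
  have mN : (m * n + i' < N)%N by lia.
  have mi : (i < m * n + i')%N by lia.
  have mk : (m <= wraps iota)%N.
    rewrite leqNgt; apply/negP => lt; have : (N < m * n)%N.
      rewrite /N return_timeE; apply: (@leq_trans ((wraps iota).+1 * n)).
        by rewrite mulSnr ltn_add2l.
      by rewrite leq_mul2r lt orbT.
    lia.
  have [x [Ex Px]] := e_next_slot mk.
  move: E; rewrite Ev => E; have /eqP := periodic_class_fun0 k0 E.
  rewrite extB Ex ext_unit (_ : e _ 1 = unit_vector (Some (@first_index tau iota'))); last by rewrite -e_unit.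
  rewrite ext_unit /class_fun Px slot_point_first opprD addrACA subrr addr0 subr_eq0 => /eqP E1.
  have {}E1 : (flow (m * n + i').+1 (start iota)).1 = (flow i'.+1 (start iota')).1.
    by rewrite -addnS flowD flow_round /= E1.
  have P' : flow i'.+1 (start iota') = (bminus (b i') (dl i') iota'.2, 0%N).
    exact: flow_start_next.
  have nb : forall a, flow (m * n + i') (start iota) <> (b i' a, 0%N).
    move=> a Ea; have := nh1 (m * n + i')%N; rewrite mi mN => /(_ isT) /negP; apply.
    by apply/existsP; exists a; rewrite Ea modnMDl (modn_small (ltn_ord iota'.1)).
  (* The orbit of iota has just passed a point that is not a base point, so it cannot be at
     p_iota'^-; having the same parameter, it is above it. *)
  have lt : ((flow i'.+1 (start iota')).2 < (flow (m * n + i').+1 (start iota)).2)%N.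
    rewrite P' lt0n; apply/negP => /eqP h0.
    have : flow (m * n + i').+1 (start iota) = (bminus (b i') (dl i') iota'.2, 0%N).
      by rewrite [LHS]surjective_pairing h0 E1 P'.
    rewrite /= /g modnMDl (modn_small (ltn_ord iota'.1)); exact: point_map_nbase_minus.
  (* The orbit of iota stays strictly above until it reaches its next base point; but this has
     height 0. *)
  have [||_] := @flow_tower (m * n + i').+1 i'.+1 (start iota) (start iota') (N - (m * n + i').+1) _ E1 lt.
  + by rewrite -addnS modnMDl.
  + move=> l ll; apply: nh2; lia.
  + by rewrite subnKC // /N flow_succ ltn0.
(* Here two distinct base points of the same inverse map would have the same parameter. *)
- move=> [iota [iota' [Ei nj _ _ Ev]]].
  have [x [Ex Px]] := @e_next_slot iota 0 (leq0n _).
  move: E; rewrite Ev => E; have /eqP := periodic_class_fun0 k0 E.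
  rewrite extB Ex ext_unit (_ : e _ 1 = unit_vector (Some (@first_index tau iota'))); last by rewrite -e_unit.
  rewrite ext_unit /class_fun Px slot_point_first opprD addrACA subrr addr0 subr_eq0.
  rewrite [iter _ _ _]/= flow_start_next -Ei flow_start_next Ei.
  by move=> /eqP /= /(bminus_inj (d0 (ltn_ord _)) (bi (ltn_ord _))).
Qed.
End Orbits.

(** * Quadratic maps preserving the cubic *)

Lemma ord3D (a : 'I_3) :
  [/\ a + 1 + 1 = a + 2%:R, a + 1 + 2%:R = a, a + 2%:R + 1 = a & a + 2%:R + 2%:R = a + 1].
Proof. by case: a => [[|[|[|//]]] lt]; split; apply: val_inj. Qed.
Lemma ord3_11 (a : 'I_3) : a + 1 + 1 = a + 2%:R. Proof. by case: (ord3D a). Qed.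
Lemma ord3_12 (a : 'I_3) : a + 1 + 2%:R = a. Proof. by case: (ord3D a). Qed.
Lemma ord3_21 (a : 'I_3) : a + 2%:R + 1 = a. Proof. by case: (ord3D a). Qed.
Lemma ord3_22 (a : 'I_3) : a + 2%:R + 2%:R = a + 1. Proof. by case: (ord3D a). Qed.
Definition ord3E := (ord3_11, ord3_12, ord3_21, ord3_22).

Lemma ord3_cases (a c : 'I_3) : [\/ c = a, c = a + 1 | c = a + 2%:R].
Proof.
case: a c => [[|[|[|//]]] lt] [[|[|[|//]]] lt'];
by [apply: Or31; apply: val_inj | apply: Or32; apply: val_inj | apply: Or33; apply: val_inj].
Qed.

Lemma ord3_neq (a : 'I_3) : [/\ a + 1 != a, a + 2%:R != a & a + 1 != a + 2%:R].
Proof. by case: a => [[|[|[|//]]] lt]. Qed.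

Lemma big_ord3 (V : Type) (idx : V) (op : Monoid.com_law idx) (f : 'I_3 -> V) (a : 'I_3) :
  \big[op/idx]_c f c = op (f a) (op (f (a + 1)) (f (a + 2%:R))).
Proof.
have [n1 n2 n3] := ord3_neq a.
rewrite (bigD1 a) //= (bigD1 (a + 1)) //= (bigD1 (a + 2%:R)); last by rewrite n2 eq_sym.
rewrite big1 ?Monoid.mulm1 // => c /andP[/andP[c1 c2] c3].
by case: (ord3_cases a c) c1 c2 c3 => ->; rewrite eqxx.
Qed.

Lemma row3P (R : nzRingType) (x y : 'rV[R]_3) :
  x 0 0 = y 0 0 -> x 0 1 = y 0 1 -> x 0 2%:R = y 0 2%:R -> x = y.
Proof.
move=> E0 E1 E2; apply/rowP => -[[|[|[|//]]] lt].
- by rewrite (_ : Ordinal lt = 0) //; apply: val_inj.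
- by rewrite (_ : Ordinal lt = 1) //; apply: val_inj.
- by rewrite (_ : Ordinal lt = 2%:R) //; apply: val_inj.
Qed.

Section Algebra.
Variable C : numFieldType.
Implicit Types (b : 'I_3 -> C) (dl t : C) (x : 'rV[C]_3) (a : 'I_3).

Lemma vec3E (x y z : C) : (vec3 x y z 0 0 = x) * (vec3 x y z 0 1 = y) * (vec3 x y z 0 2%:R = z).
Proof. by rewrite !mxE. Qed.

Lemma bsum3 b a : bsum b = b a + (b (a + 1) + b (a + 2%:R)).
Proof. exact: big_ord3. Qed.

(* The equation of the line through the points of parameters b (a + 1) and b (a + 2). *)
Definition line b a x : C :=
  x 0 1 - (b (a + 1) ^+ 2 + b (a + 1) * b (a + 2%:R) + b (a + 2%:R) ^+ 2) * x 0 0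
  + b (a + 1) * b (a + 2%:R) * (b (a + 1) + b (a + 2%:R)) * x 0 2%:R.

Lemma line_param b a t : line b a (cubic_param t) =
  (t - b (a + 1)) * (t - b (a + 2%:R)) * (t + b (a + 1) + b (a + 2%:R)).
Proof. by rewrite /line /cubic_param !vec3E; ring. Qed.

Lemma line0 b a : line b a 0 = 0. Proof. by rewrite /line !mxE; ring. Qed.
Lemma lineD b a x y : line b a (x + y) = line b a x + line b a y.
Proof. by rewrite /line !mxE; ring. Qed.
Lemma lineZ b a k x : line b a (k *: x) = k * line b a x.
Proof. by rewrite /line !mxE; ring. Qed.

Definition nondeg b := injective b /\ bsum b != 0.

Lemma nondeg_sub b a : nondeg b ->
  [/\ b a - b (a + 1) != 0, b a - b (a + 2%:R) != 0 & b (a + 1) - b (a + 2%:R) != 0].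
Proof.
move=> [bi _]; have [n1 n2 n3] := ord3_neq a.
by rewrite !subr_eq0 !(inj_eq bi) eq_sym n1 eq_sym n2 n3.
Qed.

Lemma nondeg_minus b dl : dl != 0 -> nondeg b -> nondeg (bminus b dl).
Proof.
move=> d0 [bi b0]; split; first exact: bminus_inj.
by rewrite bsum_minus mulf_neq0 ?oppr_eq0.
Qed.

Lemma line_eq0_base b a x : nondeg b -> line b (a + 1) x = 0 -> line b (a + 2%:R) x = 0 ->
  x = x 0 2%:R *: cubic_param (b a).
Proof.
move=> nb; have [n1 n2 n3] := nondeg_sub a nb; have := nb.2; rewrite (bsum3 b a).
rewrite /line !ord3E; move: (b a) (b (a + 1)) (b (a + 2%:R)) n1 n2 n3 => p q r n1 n2 n3 S0 E1 E2.
have E0 : x 0 0 = x 0 2%:R * p.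
  have K : (q - r) * (p + (q + r)) != 0 by rewrite mulf_neq0.
  apply: (mulfI K); apply/eqP; rewrite -subr_eq0; apply/eqP; rewrite -[RHS](subrr (0 : C)) -{1}E1 -E2; ring.
apply: row3P; rewrite !mxE /= ?mulr1 //.
by apply/eqP; rewrite -subr_eq0; apply/eqP; rewrite -E1 E0; ring.
Qed.

Lemma line_eq0 b x : nondeg b -> (forall a, line b a x = 0) -> x = 0.
Proof.
move=> nb H; have E := line_eq0_base nb (H (0 + 1)) (H (0 + 2%:R)).
have [n1 n2 n3] := nondeg_sub 0 nb; have b0 := nb.2; rewrite (bsum3 b 0) addrA in b0.
have /eqP := H 0; rewrite E lineZ line_param !mulf_eq0 (negbTE n1) (negbTE n2) (negbTE b0) !orbF.
by move=> /eqP ->; rewrite scale0r.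
Qed.

Lemma line_inj b x y : nondeg b -> (forall a, line b a x = line b a y) -> x = y.
Proof.
move=> nb H; apply/eqP; rewrite -subr_eq0; apply/eqP; apply: (line_eq0 nb) => a.
by rewrite -scaleN1r lineD lineZ H mulN1r subrr.
Qed.

(** Up to dl^3, the inverse of the value of side a of the target triangle at its opposite vertex.
    With this normalization C is mapped to C, as [qmap_param] shows. *)
Definition qcoef b a : C := - ((bsum b) * (b a - b (a + 1)) * (b a - b (a + 2%:R)))^-1.

(** The standard involution X_a |-> X_(a+1) X_(a+2), up to the factor dl^3, where X_a is the
    equation of side a of the triangle of the b at the source and of the triangle of the [bminus] at
    the target. *)
Definition qmap b dl x : 'rV[C]_3 :=
  \sum_a (line b (a + 1) x * line b (a + 2%:R) x * qcoef b a) *: cubic_param (bminus b dl a).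

Lemma line_minus_param b dl a c : line (bminus b dl) a (cubic_param (bminus b dl c)) =
  if c == a then dl ^+ 3 / qcoef b a else 0.
Proof.
have [E|/eqP ne] := eqVneq c a.
  by rewrite E line_param /bminus /qcoef !(bsum3 b a) invrN invrK; field.
rewrite line_param; case: (ord3_cases a c) ne => -> // _; by rewrite subrr ?mulr0 !mul0r.
Qed.

Lemma qcoef_neq0 b a : nondeg b -> qcoef b a != 0.
Proof.
move=> nb; have [n1 n2 n3] := nondeg_sub a nb; have b0 := nb.2.
by rewrite /qcoef oppr_eq0 invr_eq0 !mulf_neq0.
Qed.

Lemma line_qmap b dl a x : nondeg b ->
  line (bminus b dl) a (qmap b dl x) = dl ^+ 3 * (line b (a + 1) x * line b (a + 2%:R) x).
Proof.
move=> nb; have [n1 n2 n3] := ord3_neq a.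
rewrite /qmap (big_ord3 _ _ a) /= !lineD !lineZ !line_minus_param eqxx (negbTE n1) (negbTE n2).
rewrite !mulr0 !addr0; have := qcoef_neq0 a nb.
by move: (line _ _ _) (line _ _ _) (qcoef b a) => u v w w0; field.
Qed.

Lemma qmapK b dl x : dl != 0 -> nondeg b ->
  qmap (bminus b dl) dl^-1 (qmap b dl x) = (dl ^+ 3 * \prod_a line b a x) *: x.
Proof.
move=> d0 nb; have nb' := nondeg_minus d0 nb.
apply: (line_inj nb) => a; have := line_qmap dl^-1 a (qmap b dl x) nb'.
rewrite (bminusK b d0) => ->; rewrite !line_qmap // lineZ (big_ord3 _ _ a) /= !ord3E.
by move: (line _ _ _) (line _ _ _) (line _ _ _) => u v w; field.
Qed.

Lemma qmap_param b dl t : dl != 0 -> nondeg b ->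
  qmap b dl (cubic_param t) = (\prod_a (t - b a)) *: cubic_param (aff b dl t).
Proof.
move=> d0 nb; apply: (line_inj (nondeg_minus d0 nb)) => a.
rewrite line_qmap // lineZ !line_param !ord3E (big_ord3 _ _ a) /= /aff /bminus.
by rewrite (bsum3 b a); field.
Qed.

Lemma qmapZ b dl k x : qmap b dl (k *: x) = k ^+ 2 *: qmap b dl x.
Proof.
rewrite /qmap scaler_sumr; apply: eq_bigr => a _; rewrite scalerA !lineZ; congr (_ *: _); ring.
Qed.
End Algebra.

(** * The quadratic maps as rational maps *)

Section Forms.
Variable C : numFieldType.
Hypothesis closed : forall p : {poly C}, size p != 1 -> exists x, root p x.
Implicit Types (b : 'I_3 -> C) (dl t : C) (x : 'rV[C]_3) (a : 'I_3).
Local Notation form := (mpoly 3 C).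

Definition lineform b a : form :=
  mpolyX C (mnm1 1) - (b (a + 1) ^+ 2 + b (a + 1) * b (a + 2%:R) + b (a + 2%:R) ^+ 2) *: mpolyX C (mnm1 0)
  + (b (a + 1) * b (a + 2%:R) * (b (a + 1) + b (a + 2%:R))) *: mpolyX C (mnm1 2%:R).

Lemma lineform_eval b a x : form_eval (lineform b a) x = line b a x.
Proof. by rewrite /form_eval /lineform !(mevalD, mevalN, mevalZ, mevalXU). Qed.

Lemma homog_lineform b a : homog 1 (lineform b a).
Proof.
rewrite /homog /lineform.
by apply: dhomogD; [apply: dhomogD; [|rewrite dhomogN; apply: dhomogZ]|apply: dhomogZ];
   rewrite dhomogX; apply/eqP; apply: mdeg1.
Qed.

Lemma lineform_neq0 b a : nondeg b -> lineform b a != 0.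
Proof.
move=> nb; apply/negP => /eqP E; have := lineform_eval b a (cubic_param (b a)).
rewrite E /form_eval meval0 line_param => /esym/eqP.
have [n1 n2 n3] := nondeg_sub a nb; have b0 := nb.2; rewrite (bsum3 b a) addrA in b0.
by rewrite !mulf_eq0 (negbTE n1) (negbTE n2) (negbTE b0).
Qed.

Definition qform b dl (k : 'I_3) : form :=
  \sum_a (qcoef b a * cubic_param (bminus b dl a) 0 k) *: (lineform b (a + 1) * lineform b (a + 2%:R)).

Lemma homog_qform b dl k : homog 2 (qform b dl k).
Proof.
apply: rpred_sum => a _; apply: dhomogZ.
exact: (dhomogM (d := 1) (e := 1)) (homog_lineform _ _) (homog_lineform _ _).
Qed.

Lemma qform_eval b dl k x : form_eval (qform b dl k) x = qmap b dl x 0 k.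
Proof.
rewrite /form_eval /qform raddf_sum /qmap summxE; apply: eq_bigr => a _.
rewrite /= mevalZ mevalM -!/(form_eval _ _) !lineform_eval !mxE; ring.
Qed.

Lemma form_evalZ d (g : form) c x : homog d g -> form_eval g (c *: x) = c ^+ d * form_eval g x.
Proof.
move=> /dhomogP H; rewrite /form_eval !mevalE mulr_sumr; apply: eq_big_seq => m /H Hm; have <- : mdeg m = d := Hm.
rewrite mulrCA; congr (_ * _); rewrite mdegE -prodrXr -big_split /=.
by apply: eq_bigr => i _; rewrite mxE exprMn.
Qed.

Lemma form_eval_line (g : form) (v w : 'rV[C]_3) : exists G : {poly C},
  forall s, G.[s] = form_eval g (v + s *: w).
Proof.
exists (\sum_(m <- msupp g) mcoeff m g *: \prod_i ((v 0 i)%:P + w 0 i *: 'X) ^+ m i) => s.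
rewrite horner_sum /form_eval mevalE; apply: eq_bigr => m _.
rewrite hornerZ horner_prod; congr (_ * _); apply: eq_bigr => i _.
by rewrite horner_exp !hornerE !mxE [s * _]mulrC.
Qed.

Lemma qmap_eq0 b dl x : dl != 0 -> nondeg b -> qmap b dl x = 0 ->
  forall a, line b (a + 1) x * line b (a + 2%:R) x = 0.
Proof.
move=> d0 nb E a; have := line_qmap dl a x nb; rewrite E line0 => /esym/eqP.
by rewrite mulf_eq0 expf_eq0 (negbTE d0) andbF => /eqP.
Qed.

(** Restrict a common factor g to the line X_0 + X_1 + X_2 = 0, with X_a normalized to 1 at the base
    point a. The line avoids the base points, so g has no zero on it and is constant in both affine
    charts. Homogeneity relates the constants by c = s^d c' for s <> 0, and s = 1, 2 give 2^d =
    1. *)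
Lemma qform_coprime b dl (d : nat) (g : form) (h : 'I_3 -> form) : dl != 0 -> nondeg b ->
  homog d g -> (forall k, qform b dl k = g * h k) -> d = 0%N.
Proof.
move=> d0 nb hg fac.
pose p a := (line b a (cubic_param (b a)))^-1 *: cubic_param (b a).
have pa a : line b a (p a) = 1.
  rewrite lineZ mulVf // line_param.
  have [n1 n2 n3] := nondeg_sub a nb; have b0 := nb.2; rewrite (bsum3 b a) addrA in b0.
  by rewrite !mulf_neq0.
have pac a c : c != a -> line b a (p c) = 0.
  rewrite lineZ [line b a _]line_param; case: (ord3_cases a c) => ->; first by rewrite eqxx.
    by rewrite subrr !mul0r mulr0.
  by rewrite subrr mulr0 mul0r mulr0.
pose v := p 0 - p 1; pose w := p 1 - p 2%:R.
have lv a : line b a v = (a == 0)%:R - (a == 1)%:R.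
  rewrite /v -scaleN1r lineD [line b a (-1 *: _)]lineZ mulN1r; congr (_ - _).
    by case: eqP => [->|/eqP]; rewrite ?pa // eq_sym => /pac ->.
  by case: eqP => [->|/eqP]; rewrite ?pa // eq_sym => /pac ->.
have lw a : line b a w = (a == 1)%:R - (a == 2%:R)%:R.
  rewrite /w -scaleN1r lineD [line b a (-1 *: _)]lineZ mulN1r; congr (_ - _).
    by case: eqP => [->|/eqP]; rewrite ?pa // eq_sym => /pac ->.
  by case: eqP => [->|/eqP]; rewrite ?pa // eq_sym => /pac ->.
have nz s r : (s != 0) || (r != 0) -> form_eval g (s *: v + r *: w) != 0.
  move=> sr; apply/negP => /eqP E.
  have Q0 : qmap b dl (s *: v + r *: w) = 0.
    apply/rowP => k; rewrite -qform_eval fac /form_eval mevalM -/(form_eval g _) E mul0r mxE //.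
  have Z := qmap_eq0 d0 nb Q0.
  have := Z 0; have := Z 1; have := Z 2%:R.
  rewrite !lineD !lineZ !lv !lw /= !(mulr0, mulr1, subr0, sub0r, subrr, addr0, add0r, mulrN1, mulr1).
  move=> /eqP; rewrite mulf_eq0 => Z2 /eqP; rewrite mulf_eq0 => Z1 /eqP; rewrite mulf_eq0 => Z0.
  move: sr Z0 Z1 Z2; rewrite ?oppr_eq0.
  have [->|s0] := eqVneq s 0; have [->|r0] := eqVneq r 0; rewrite ?oppr0 ?addr0 ?add0r ?oppr_eq0 ?(negbTE s0) ?(negbTE r0) ?eqxx ?orbF ?orbT //.
have [G HG] := form_eval_line g v w.
have [H HH] := form_eval_line g w v.
have constG (P : {poly C}) : (forall s, P.[s] != 0) -> exists c, c != 0 /\ forall s, P.[s] = c.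
  move=> P0; have sP : size P = 1%N.
    apply/eqP; apply: contraT => /closed [s /rootP]; have := P0 s; by move=> /eqP.
  exists P.[0]; split=> // s; by rewrite (size1_polyC (eq_leq sP)) !hornerC.
have [|c [c0 Gc]] := constG G.
  by move=> s; rewrite HG; have := nz 1 s; rewrite scale1r oner_eq0 => /(_ isT).
have [|c' [c'0 Hc]] := constG H.
  by move=> s; rewrite HH addrC; have := nz s 1; rewrite scale1r oner_eq0 orbT => /(_ isT).
have rel s : s != 0 -> c = s ^+ d * c'.
  move=> s0; rewrite -(Gc s) -(Hc s^-1) HG HH -form_evalZ //.
  by congr form_eval; rewrite [s *: (w + _)]scalerDr [s *: (_ *: v)]scalerA mulfV // scale1r addrC.
have E1 := rel 1 (oner_neq0 _); rewrite expr1n mul1r in E1.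
have n2 : (2%:R : C) != 0 by rewrite pnatr_eq0.
have E2 : (2 ^ d)%N%:R = 1%:R :> C.
  by apply: (mulIf c'0); rewrite natrX -(rel _ n2) E1 mul1r.
move/eqP: E2; rewrite eqr_nat; case: d {hg rel} => // d.
by rewrite expnS; have := expn_gt0 2 d; lia.
Qed.

Definition rmap b dl (d0 : dl != 0) (nb : nondeg b) : rational_map C :=
  RationalMap (homog_qform b dl) (fun d g h => @qform_coprime b dl d g h d0 nb).

Lemma rmap_eval b dl d0 nb x : rat_eval (@rmap b dl d0 nb) x = qmap b dl x.
Proof. by apply/rowP => k; rewrite mxE qform_eval. Qed.

Lemma line_generic b : nondeg b -> exists t, forall a, line b a (cubic_param t) != 0.
Proof.
move=> nb; pose P : {poly C} := \prod_a (('X - (b (a + 1))%:P) * ('X - (b (a + 2%:R))%:P) * ('X + (b (a + 1) + b (a + 2%:R))%:P)).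
have P0 : P != 0.
  apply/prodf_neq0 => a _; rewrite !mulf_neq0 ?polyXsubC_eq0 //.
  by rewrite -[(_ + _)%:P]opprK -polyCN polyXsubC_eq0.
have [t Pt] : exists t, P.[t] != 0.
  apply/not_existsP => H; move/eqP: P0; apply.
  apply: (roots_geq_poly_eq0 (rs := [seq k%:R | k <- seq.iota 0 (size P)])).
  - by apply/allP => y _; apply/rootP/eqP; apply: contraT => /H.
  - by rewrite map_inj_uniq ?iota_uniq //; apply: mulrIn; apply: oner_neq0.
  - by rewrite size_map size_iota.
exists t => a; move: Pt; rewrite horner_prod => /prodf_neq0 /(_ a isT).
by rewrite !hornerE line_param addrA.
Qed.

Lemma qmap_left_inverse b dl (d0 : dl != 0) (nb : nondeg b) d0' nb' :
  Defs.left_inverse (@rmap (bminus b dl) dl^-1 d0' nb') (@rmap b dl d0 nb).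
Proof.
split=> [x|].
  by exists (dl ^+ 3 * \prod_a line b a x); rewrite !rmap_eval qmapK.
have [t Ht] := line_generic nb; exists (cubic_param t); rewrite !rmap_eval qmapK //.
rewrite scaler_eq0 mulf_eq0 expf_eq0 (negbTE d0) /=; apply/norP; split.
  by apply/prodf_neq0 => a _.
by apply/negP => /eqP /rowP /(_ 2%:R); rewrite !mxE /= => /eqP; rewrite oner_eq0.
Qed.

Lemma qmap_right_inverse b dl (d0 : dl != 0) (nb : nondeg b) d0' nb' :
  Defs.left_inverse (@rmap b dl d0 nb) (@rmap (bminus b dl) dl^-1 d0' nb').
Proof.
(* The rational map carries proofs about b and dl, so the equations are substituted for generalized
   b1 and dl1. *)
have H b1 dl1 d1 nb1 : bminus (bminus b dl) dl^-1 = b1 -> (dl^-1)^-1 = dl1 ->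
   Defs.left_inverse (@rmap b1 dl1 d1 nb1) (@rmap (bminus b dl) dl^-1 d0' nb').
  by move=> E1 E2; subst b1 dl1; apply: qmap_left_inverse.
by apply: H; rewrite ?invrK ?bminusK.
Qed.

Definition quad b dl (d0 : dl != 0) (nb : nondeg b) : quadratic_map C :=
  @QuadraticMap C (rmap d0 nb) (rmap (invr_neq0 d0) (nondeg_minus d0 nb)) erefl
   (qmap_left_inverse _ _ _ _) (qmap_right_inverse _ _ _ _).
End Forms.

(** * Germs of holomorphic functions *)

Section Germs.
Variable C : numFieldType.
Implicit Types (f g : C * C -> C) (z : C * C).

Definition hol f := holomorphic_at0 (f : C * C -> C^o).

Lemma hol_cst (k : C) : hol (fun=> k).
Proof. by apply: filterE => z; apply: differentiable_cst. Qed.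

Lemma diff_fst z : differentiable (fun z : C * C => z.1 : C^o) z.
Proof. by apply: (@linear_differentiable C (C * C)%type C^o fst z) => x; apply: cvg_fst. Qed.

Lemma diff_snd z : differentiable (fun z : C * C => z.2 : C^o) z.
Proof. by apply: (@linear_differentiable C (C * C)%type C^o snd z) => x; apply: cvg_snd. Qed.

Lemma hol_add f g : hol f -> hol g -> hol (fun z => f z + g z).
Proof. by move=> hf hg; near=> z; apply: differentiableD; near: z. Unshelve. all: by end_near. Qed.

Lemma hol_opp f : hol f -> hol (fun z => - f z).
Proof. by move=> hf; near=> z; apply: differentiableN; near: z. Unshelve. all: by end_near. Qed.

Lemma hol_mul f g : hol f -> hol g -> hol (fun z => f z * g z).
Proof. by move=> hf hg; near=> z; apply: differentiableM; near: z. Unshelve. all: by end_near. Qed.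

Lemma hol_exp f k : hol f -> hol (fun z => f z ^+ k).
Proof.
move=> hf; elim: k => [|k IH]; first exact: hol_cst.
by under eq_fun do rewrite exprS; apply: hol_mul.
Qed.

Lemma hol_continuous f : hol f -> \forall z \near (0 : C * C), {for z, continuous f}.
Proof. by move=> hf; near=> z; apply: differentiable_continuous; near: z. Unshelve. all: by end_near. Qed.

Lemma cont_neq0 f z : {for z, continuous f} -> f z != 0 -> \forall w \near z, f w != 0.
Proof. by move=> cf f0; exact: (cvgr_neq0 _ cf). Qed.

Lemma hol_neq0 f : hol f -> f 0 != 0 -> \forall z \near (0 : C * C), f z != 0.
Proof. by move=> /hol_continuous /nbhs_singleton cf f0; apply: cont_neq0. Qed.

Lemma hol_inv f : hol f -> f 0 != 0 -> hol (fun z => (f z)^-1).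
Proof.
move=> hf f0; have n0 := hol_neq0 hf f0.
by near=> z; apply: differentiableV; near: z.
Unshelve. all: by end_near. Qed.

Lemma near0_comp (phi : C * C -> C * C) (P : C * C -> Prop) : phi 0 = 0 -> holomorphic_at0 phi ->
  (\forall z \near (0 : C * C), P z) -> \forall z \near (0 : C * C), P (phi z).
Proof.
move=> p0 hp HP; have cp : phi z @[z --> (0 : C * C)] --> phi 0.
  by apply: differentiable_continuous; apply: nbhs_singleton hp.
by apply: cp; rewrite p0.
Qed.

Lemma hol_comp f (phi : C * C -> C * C) : phi 0 = 0 -> holomorphic_at0 phi -> hol f ->
  hol (fun z => f (phi z)).
Proof.
move=> p0 hp hf; have := near0_comp p0 hp hf => hf'.
by near=> z; apply: (@differentiable_comp _ _ _ _ phi f); near: z.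
Unshelve. all: by end_near. Qed.

Lemma hol_fst : hol fst. Proof. by apply: filterE => z; apply: diff_fst. Qed.
Lemma hol_snd : hol snd. Proof. by apply: filterE => z; apply: diff_snd. Qed.

Lemma hol_pair f g : hol f -> hol g -> holomorphic_at0 (fun z => (f z, g z)).
Proof.
by move=> hf hg; near=> z; apply: (@differentiable_pair C _ C^o C^o); near: z.
Unshelve. all: by end_near. Qed.

(* The locus f <> 0 is dense near 0. *)
Definition thick f := \forall z0 \near (0 : C * C), ~ \forall z \near z0, f z = 0.

(** Plays the part of the identity theorem and uses only continuity: if u and v differed at z0, they
    would differ around z0, where f would then be 0. *)
Lemma thick_eq f u v : thick f -> hol u -> hol v ->
  (\forall z \near (0 : C * C), f z != 0 -> u z = v z) -> \forall z \near (0 : C * C), u z = v z.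
Proof.
move=> tf hu hv H.
have hw := hol_continuous (hol_add hu (hol_opp hv)).
have H' := near_join H.
near=> z0; apply/eqP; rewrite -subr_eq0; apply: contraT => n0; exfalso.
have : ~ \forall z \near z0, f z = 0 by near: z0.
apply; have cw : {for z0, continuous (fun z => u z + - v z)} by near: z0.
have Hz : \forall z \near z0, f z != 0 -> u z = v z by near: z0.
have nz := cont_neq0 cw n0.
near=> z; apply/eqP; apply: contraT => fz.
have : u z - v z != 0 by near: z.
have -> : u z = v z by apply: (near Hz z) => //; near: z.
by rewrite subrr eqxx.
Unshelve. all: by end_near. Qed.

Lemma thick_mul f g : hol f -> thick f -> thick g -> thick (fun z => f z * g z).
Proof.
move=> hf tf tg; have cf := near_join (hol_continuous hf); have tg' := near_join tg.
near=> z0; move=> H.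
have : ~ \forall z \near z0, f z = 0 by near: z0.
apply; have H' := near_join H.
have cz : \forall z \near z0, {for z, continuous f} by near: z0.
have tz : \forall z \near z0, ~ \forall w \near z, g w = 0 by near: z0.
near=> z1; apply/eqP; apply: contraT => f1; exfalso.
have : ~ \forall w \near z1, g w = 0 by near: z1.
apply; have c1 : {for z1, continuous f} by near: z1.
have n1 := cont_neq0 c1 f1.
have h1 : \forall w \near z1, f w * g w = 0 by near: z1.
near=> w; have : f w * g w == 0 by apply/eqP; near: w.
rewrite mulf_eq0 => /orP[|/eqP //]; have : f w != 0 by near: w.
by move=> /negbTE ->.
Unshelve. all: by end_near. Qed.

Lemma thick_comp f (phi psi : C * C -> C * C) : phi 0 = 0 -> holomorphic_at0 phi ->
  psi 0 = 0 -> holomorphic_at0 psi ->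
  (\forall z \near (0 : C * C), psi (phi z) = z) -> (\forall z \near (0 : C * C), phi (psi z) = z) ->
  thick f -> thick (fun z => f (phi z)).
Proof.
move=> p0 hp q0 hq K1 K2 tf.
have tf' := near0_comp p0 hp tf; have hq' := near0_comp p0 hp hq.
have K2' := near0_comp p0 hp (near_join K2).
near=> z0; move=> H.
have : ~ \forall w \near phi z0, f w = 0 by near: z0.
apply; have k1 : psi (phi z0) = z0 by near: z0.
have cq : psi w @[w --> phi z0] --> psi (phi z0) by apply: differentiable_continuous; near: z0.
rewrite k1 in cq; have := cq _ H => H1.
have k2 : \forall w \near phi z0, phi (psi w) = w by near: z0.
near=> w; have <- : phi (psi w) = w by near: w.
by near: w.
Unshelve. all: by end_near. Qed.
End Germs.

(** * The sides of the triangle in the charts of infinitely near points *)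

Section Charts.
Variable C : numFieldType.
Implicit Types (f g : C * C -> C) (z : C * C) (b : 'I_3 -> C) (a c : 'I_3) (ds : seq (option C)).

Definition blowups ds z : C * C := foldr (@blowup_chart C) z ds.

Lemma blowup0 (d : option C) : blowup_chart d 0 = 0.
Proof. by case: d => [k|]; rewrite /blowup_chart /= mul0r. Qed.

Lemma blowups0 ds : blowups ds 0 = 0.
Proof. by elim: ds => //= d ds; rewrite /blowups /= => ->; apply: blowup0. Qed.

Lemma diff_blowup (d : option C) z : differentiable (blowup_chart d) z.
Proof.
case: d => [k|]; rewrite /blowup_chart.
  apply: (@differentiable_pair C _ C^o C^o); first exact: diff_fst.
  apply: differentiableM; first exact: diff_fst.
  by apply: differentiableD; [exact: diff_snd | exact: differentiable_cst].
apply: (@differentiable_pair C _ C^o C^o); last exact: diff_snd.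
by apply: differentiableM; [exact: diff_fst | exact: diff_snd].
Qed.

Lemma diff_blowups ds z : differentiable (blowups ds) z.
Proof.
elim: ds z => [|d ds IH] z; first by have -> : blowups [::] = id by []; apply: ex_diff.
by apply: (@differentiable_comp _ _ _ _ (blowups ds) (blowup_chart d)) => //; apply: diff_blowup.
Qed.

Lemma hol_blowups ds : holomorphic_at0 (blowups ds).
Proof. by apply: filterE => z; apply: diff_blowups. Qed.

Definition vanishes_nowhere f := forall z0, ~ \forall z \near z0, f z = 0.

Lemma nowhere_affine (k k1 k2 : C) : [|| k != 0, k1 != 0 | k2 != 0] ->
  vanishes_nowhere (fun z => k + k1 * z.1 + k2 * z.2).
Proof.
move=> nz z0 H; have H0 := nbhs_singleton H.
have dir (v : C * C) : exists2 s : C, s != 0 & k + k1 * (z0.1 + s * v.1) + k2 * (z0.2 + s * v.2) = 0.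
  have lin (x y : C) : differentiable (fun s : C => x + s * y : C^o) (0 : C).
    apply: differentiableD; first exact: differentiable_cst.
    by apply: differentiableM; [apply: ex_diff | exact: differentiable_cst].
  have : {for (0 : C), continuous (fun s : C => (z0.1 + s * v.1, z0.2 + s * v.2) : C^o * C^o)}.
    by apply: differentiable_continuous; apply: differentiable_pair; apply: lin.
  move=> cv; have Ez : (z0.1 + 0 * v.1, z0.2 + 0 * v.2) = z0.
    by rewrite !mul0r !addr0 -surjective_pairing.
  rewrite -Ez in H; have /= H1 := cv _ H.
  have H2 : \forall s \near (0 : C)^', k + k1 * (z0.1 + s * v.1) + k2 * (z0.2 + s * v.2) = 0.
    by apply: nbhs_dnbhs.
  have H3 : \forall s \near (0 : C)^', s != 0 by apply: nbhs_dnbhs_neq.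
  by have [s [s1 s2]] := filter_ex (filterI H2 H3); exists s.
have [s s0 E1] := dir (1, 0); have [r r0 E2] := dir (0, 1).
move: E1 E2; rewrite /= !(mulr1, mulr0, addr0) => E1 E2.
have k10 : k1 = 0.
  have : k1 * s = 0 by rewrite -[RHS](subrr 0) -{1}E1 -H0; ring.
  by move/eqP; rewrite mulf_eq0 (negbTE s0) orbF => /eqP.
have k20 : k2 = 0.
  have : k2 * r = 0 by rewrite -[RHS](subrr 0) -{1}E2 -H0; ring.
  by move/eqP; rewrite mulf_eq0 (negbTE r0) orbF => /eqP.
by move: nz H0; rewrite k10 k20 !mul0r !addr0 eqxx !orbF => /eqP.
Qed.

Lemma nowhere_fst : vanishes_nowhere fst.
Proof.
have := @nowhere_affine 0 1 0; rewrite oner_eq0 orbT => /(_ isT) H z0 Hz; apply: (H z0).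
by apply: filterS Hz => z ->; rewrite mulr0 mul0r !addr0.
Qed.

Lemma nowhere_snd : vanishes_nowhere snd.
Proof.
have := @nowhere_affine 0 0 1; rewrite oner_eq0 !orbT => /(_ isT) H z0 Hz; apply: (H z0).
by apply: filterS Hz => z ->; rewrite mulr0 mul0r !addr0.
Qed.

(* Off the exceptional curve, a blowup has a continuous local inverse. *)
Lemma nowhere_blowup f (d : option C) : vanishes_nowhere f -> vanishes_nowhere (fun z => f (blowup_chart d z)).
Proof.
move=> nf z0 H; have H' := near_join H.
have [z1 [Hz1 e1]] : exists z1, (\forall z \near z1, f (blowup_chart d z) = 0) /\ exceptional_coord d z1 != 0.
  apply/not_existsP => no.
  have : \forall z \near z0, exceptional_coord d z = 0.
    near=> z; apply/eqP; apply: contraT => e; exfalso; apply: (no z); split=> //; near: z; exact: H'.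
  by case: (d) => [k|] /=; [apply: nowhere_fst | apply: nowhere_snd].
pose sg w : C * C := if d is Some k then (w.1, w.2 / w.1 - k) else (w.1 / w.2, w.2).
have sgz : sg (blowup_chart d z1) = z1.
  rewrite /sg; case: (d) e1 => [k|] /= e1; rewrite [RHS]surjective_pairing; congr (_, _); by field.
have ez : exceptional_coord d (blowup_chart d z1) != 0 by case: (d) e1.
apply: (nf (blowup_chart d z1)).
have csg : {for blowup_chart d z1, continuous sg}.
  apply: differentiable_continuous; rewrite /sg; case: (d) ez => [k|] /= ez.
    apply: (@differentiable_pair C _ C^o C^o); first exact: diff_fst.
    apply: differentiableB; last exact: differentiable_cst.
    apply: differentiableM; first exact: diff_snd.
    by apply: differentiableV => //; exact: diff_fst.
  apply: (@differentiable_pair C _ C^o C^o); last exact: diff_snd.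
  apply: differentiableM; first exact: diff_fst.
  by apply: differentiableV => //; exact: diff_snd.
have cs : sg w @[w --> blowup_chart d z1] --> z1 by rewrite -[X in _ --> X]sgz; apply: csg.
have H1 := cs _ Hz1.
have ce : {for blowup_chart d z1, continuous (exceptional_coord d : C * C -> C)}.
  by apply: differentiable_continuous; case: (d) => [k|] /=; [exact: diff_fst | exact: diff_snd].
have n1 := cont_neq0 ce ez.
near=> w; have e : exceptional_coord d w != 0 by near: w.
have E : blowup_chart d (sg w) = w.
  rewrite /sg; case: (d) e => [k|] /= e; rewrite [RHS]surjective_pairing; congr (_, _); by field.
by rewrite -E; near: w.
Unshelve. all: by end_near. Qed.

Lemma nowhere_blowups f ds : vanishes_nowhere f -> vanishes_nowhere (fun z => f (blowups ds z)).
Proof.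
elim: ds f => [|d ds IH] f nf //; rewrite /blowups /=.
exact: (IH (fun z => f (blowup_chart d z)) (nowhere_blowup nf)).
Qed.

Lemma nowhere_thick f : vanishes_nowhere f -> thick f.
Proof. by move=> nf; apply: filterE. Qed.

Lemma line_vec3 b a (x y w : C) : line b a (vec3 x y w) =
  y - (b (a + 1) ^+ 2 + b (a + 1) * b (a + 2%:R) + b (a + 2%:R) ^+ 2) * x
  + b (a + 1) * b (a + 2%:R) * (b (a + 1) + b (a + 2%:R)) * w.
Proof. by rewrite /line !vec3E. Qed.

Lemma line_proper_chart b a P : exists k k1 k2 : C, [|| k != 0, k1 != 0 | k2 != 0] /\
  forall z, line b a (proper_chart P z) = k + k1 * z.1 + k2 * z.2.
Proof.
set m := b (a + 1) ^+ 2 + b (a + 1) * b (a + 2%:R) + b (a + 2%:R) ^+ 2.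
set r := b (a + 1) * b (a + 2%:R) * (b (a + 1) + b (a + 2%:R)).
case: P => [p q|p|].
- exists (q - m * p + r), (- m), 1; rewrite oner_eq0 !orbT; split=> // z.
  by rewrite /= line_vec3 -/m -/r; ring.
- exists (1 - m * p), (- m), r; split.
    have [->|m0] := eqVneq m 0; first by rewrite mul0r subr0 oner_eq0.
    by rewrite oppr_eq0 m0 orbT.
  by move=> z; rewrite /= line_vec3 -/m -/r; ring.
- exists (- m), 1, r; rewrite oner_eq0 orbT; split=> // z.
  by rewrite /= line_vec3 -/m -/r; ring.
Qed.

Lemma chartE (p : Defs.point C) z : chart p z = proper_chart p.1 (blowups p.2 z).
Proof. by []. Qed.

Lemma thick_line b a (p : Defs.point C) : thick (fun z => line b a (chart p z)).
Proof.
have [k [k1 [k2 [nz E]]]] := line_proper_chart b a p.1.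
apply: nowhere_thick => z0 H.
apply: (@nowhere_blowups (fun z => k + k1 * z.1 + k2 * z.2) p.2 (nowhere_affine nz) z0).
by apply: filterS H => z; rewrite chartE E.
Qed.

Lemma hol_line b a (p : Defs.point C) : hol (fun z => line b a (chart p z)).
Proof.
have [k [k1 [k2 [_ E]]]] := line_proper_chart b a p.1.
have -> : (fun z => line b a (chart p z)) = fun z => k + k1 * (blowups p.2 z).1 + k2 * (blowups p.2 z).2.
  by apply/funext => z; rewrite chartE E.
have h1 := hol_comp (blowups0 p.2) (@hol_blowups p.2) (@hol_fst C).
have h2 := hol_comp (blowups0 p.2) (@hol_blowups p.2) (@hol_snd C).
by apply: hol_add; [apply: hol_add; [apply: hol_cst|]|]; apply: hol_mul => //; apply: hol_cst.
Qed.

Definition cbase (t : C) : Defs.point C := (Affine t (t ^+ 3), [::]).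

(* The shape near 0 of the pull-backs X of the three lines and of the equations E of the exceptional
   curves over the three base points, at a point which is not a base point. *)
Definition loc_type (X E : 'I_3 -> C * C -> C) : Prop :=
  [/\ forall a, hol (X a), forall a, thick (X a) &
  ((forall a z, E a z = 1) /\ (forall a c, a != c -> X a 0 = 0 -> X c 0 != 0)) \/
  exists c (A : 'I_3 -> C * C -> C),
   [/\ [/\ hol (E c), thick (E c), E c 0 = 0 & X c 0 != 0],
     forall a, a != c -> hol (A a) /\ forall z, E a z = 1 /\ X a z = E c z * A a z
    & forall a a', a != c -> a' != c -> a != a' -> A a 0 = 0 -> A a' 0 != 0]].

Lemma line_base b a c : a != c -> line b a (cubic_param (b c)) = 0.
Proof.
by rewrite line_param; case: (ord3_cases a c) => -> // ne; rewrite ?eqxx // in ne *; rewrite subrr ?mulr0 ?mul0r ?mul0r.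
Qed.

Lemma line_base_neq0 b a : nondeg b -> line b a (cubic_param (b a)) != 0.
Proof.
move=> nb; have [n1 n2 n3] := nondeg_sub a nb; have b0 := nb.2; rewrite (bsum3 b a) addrA in b0.
by rewrite line_param !mulf_neq0.
Qed.

(** The slope of the chord of y = x^3 between the other two base points. By [slope_inj], sides
    meeting at a base point are separated by blowing it up. *)
Definition slope b a : C := b (a + 1) ^+ 2 + b (a + 1) * b (a + 2%:R) + b (a + 2%:R) ^+ 2.

Lemma slope_inj b : nondeg b -> injective (slope b).
Proof.
move=> nb a a'; have S0 := nb.2.
have main c : slope b (c + 1) != slope b (c + 2%:R).
  have [_ _ n3] := nondeg_sub c nb; rewrite (bsum3 b c) in S0.
  rewrite -subr_eq0 /slope !ord3E.
  have -> : b (c + 2%:R) ^+ 2 + b (c + 2%:R) * b c + b c ^+ 2 - (b c ^+ 2 + b c * b (c + 1) + b (c + 1) ^+ 2) =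
     - ((b (c + 1) - b (c + 2%:R)) * (b c + (b (c + 1) + b (c + 2%:R)))) by ring.
  by rewrite oppr_eq0 mulf_neq0.
case: (ord3_cases a a') => -> // E; exfalso.
  by have := main (a + 2%:R); rewrite !ord3E E eqxx.
by have := main (a + 1); rewrite !ord3E E eqxx.
Qed.

Lemma line_near_base b a c (x y : C) : a != c ->
  line b a (vec3 (b c + x) (b c ^+ 3 + y) 1) = y - slope b a * x.
Proof. by move=> ac; have := line_base b ac; rewrite /cubic_param !line_vec3 /slope => E; rewrite -[RHS]addr0 -E; ring. Qed.

Lemma proper_chart_param P (k t : C) : k != 0 -> proper_chart P 0 = k *: cubic_param t ->
  P = Affine t (t ^+ 3).
Proof.
move=> k0 E; have E0 := congr1 (fun M : 'rV[C]_3 => M 0 0) E; have E1 := congr1 (fun M : 'rV[C]_3 => M 0 1) E.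
have E2 := congr1 (fun M : 'rV[C]_3 => M 0 2%:R) E; move: E0 E1 E2 {E}.
case: P => [p q|p|]; rewrite /= /cubic_param !mxE /= ?addr0 ?mulr1.
- by move=> E0 E1 E2; rewrite E0 E1 -E2 !mul1r.
- by move=> _ _ E2; rewrite -E2 eqxx in k0.
- by move=> _ _ E2; rewrite -E2 eqxx in k0.
Qed.

Lemma proper_chart_neq0 P : proper_chart P (0 : C * C) != 0.
Proof.
apply/negP => /eqP E; move: (congr1 (fun M : 'rV[C]_3 => M 0 0) E) (congr1 (fun M : 'rV[C]_3 => M 0 1) E) (congr1 (fun M : 'rV[C]_3 => M 0 2%:R) E).
by case: P {E} => [p q|p|]; rewrite /= !mxE /= => /eqP + /eqP + /eqP; rewrite oner_eq0.
Qed.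

(** Two sides meet only at a base point, which is the first alternative when p does not lie over
    one. Over the base point c, the two sides through it acquire the factor E_c, and their strict
    transforms are disjoint because the slopes differ. *)
Lemma loc_type_point b (p : Defs.point C) : nondeg b -> (forall a, p <> cbase (b a)) ->
  loc_type (fun a z => line b a (chart p z)) (fun a => exceptional_eq (cbase (b a)) p).
Proof.
move=> nb np; split=> [a|a|]; [exact: hol_line | exact: thick_line |].
have [[c Ec]|nP] := pselect (exists c, p.1 = Affine (b c) (b c ^+ 3)); last first.
  left; split=> [a z|a c ac Xa].
    rewrite /exceptional_eq /=; case: eqP => //= E; case: nP; exists a; exact: E.
  apply/negP => /eqP Xc; apply: nP.
  have [e [Ea1 Ea2]] : exists e, line b (e + 1) (proper_chart p.1 0) = 0 /\ line b (e + 2%:R) (proper_chart p.1 0) = 0.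
    move: Xa Xc; rewrite !chartE blowups0; case: (ord3_cases a c) ac => -> ac; first by rewrite eqxx in ac.
      by exists (a + 2%:R); rewrite !ord3E.
    by exists (a + 1); rewrite !ord3E.
  exists e; have E := line_eq0_base nb Ea1 Ea2; apply: (proper_chart_param _ E).
  apply/negP => /eqP z0; move: E; rewrite z0 scale0r => /eqP; rewrite (negbTE (proper_chart_neq0 _)) //.
right; exists c; case: p np Ec => P [|d ds] /= np Ec; first by case: (np c); rewrite Ec.
subst P; have h1 := hol_comp (blowups0 ds) (@hol_blowups ds) (@hol_fst C).
have h2 := hol_comp (blowups0 ds) (@hol_blowups ds) (@hol_snd C).
(* The side v - slope u divided by the exceptional coordinate of the first blowup, which is u for a
   direction [Some k] and v for [None]. *)
pose A a (z : C * C) := if d is Some k then (blowups ds z).2 + (k - slope b a) else 1 - slope b a * (blowups ds z).1.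
have Ec : exceptional_eq (cbase (b c)) (Affine (b c) (b c ^+ 3), d :: ds) = fun z => exceptional_coord d (blowups ds z).
  by apply/funext => z; rewrite /exceptional_eq /= eqxx.
exists A; split.
- rewrite Ec; split.
  + by case: (d).
  + by apply: nowhere_thick; apply: nowhere_blowups; case: (d) => [k|]; [apply: nowhere_fst | apply: nowhere_snd].
  + by rewrite blowups0; case: (d).
  + rewrite chartE blowups0 /= !addr0; exact: line_base_neq0.
- move=> a ac; split.
    rewrite /A; case: (d) => [k|]; first by apply: hol_add => //; apply: hol_cst.
    by apply: hol_add; [apply: hol_cst | apply: hol_opp; apply: hol_mul => //; apply: hol_cst].
  move=> z; split.
    rewrite /exceptional_eq /=; case: eqP => //= -[/nb.1 E]; by rewrite E eqxx in ac.
  rewrite Ec /chart /= line_near_base //= -/(blowups ds z) /A; case: (d) => [k|] /=; ring.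
- move=> a a' ac ac' aa' ; rewrite /A blowups0; case: (d) => [k|] /=; last by rewrite mulr0 subr0 => /eqP; rewrite oner_eq0.
  rewrite !add0r => /eqP; rewrite subr_eq0 => /eqP ->; rewrite subr_eq0.
  by apply: contra_neq aa' => /(slope_inj nb).
Qed.
End Charts.

(** * Labelling of the base points *)

Section Labelling.
Variable C : numFieldType.
Implicit Types (f g : C * C -> C) (z : C * C) (b : 'I_3 -> C) (dl : C) (a c : 'I_3).
Implicit Types (X Y E : 'I_3 -> C * C -> C).

(* Away from the lines, the quadratic map is X_a |-> 1 / X_a. *)
Lemma inverse_relation dl X Y : dl != 0 -> (forall a, hol (X a)) -> (forall a, thick (X a)) ->
  (forall a, hol (Y a)) ->
  (\forall z \near (0 : C * C), exists k, forall a, dl * (X (a + 1) z * X (a + 2%:R) z) = k * Y a z) ->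
  forall a c, \forall z \near (0 : C * C), X a z * Y a z = X c z * Y c z.
Proof.
move=> d0 hX tX hY H a c.
pose f z := X a z * (X (a + 1) z * X (a + 2%:R) z).
have tf : thick f by apply: thick_mul => //; apply: thick_mul.
apply: (thick_eq tf); [exact: hol_mul | exact: hol_mul |].
near=> z; rewrite /f !mulf_eq0 !negb_or => /and3P[x0 x1 x2].
have [k Hk] : exists k, forall a, dl * (X (a + 1) z * X (a + 2%:R) z) = k * Y a z by near: z.
have k0 : k != 0.
  apply/negP => /eqP k0; have /eqP := Hk a; rewrite k0 mul0r !mulf_eq0.
  by rewrite (negbTE d0) (negbTE x1) (negbTE x2).
apply: (mulfI k0); have E e : k * (X e z * Y e z) = dl * (X a z * (X (a + 1) z * X (a + 2%:R) z)).
  rewrite mulrCA -Hk; case: (ord3_cases a e) => ->; rewrite ?ord3E; ring.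
by rewrite !E.
Unshelve. all: by end_near. Qed.

Lemma ord3_others a : exists c e, [/\ c != a, e != a & c != e].
Proof. by exists (a + 1), (a + 2%:R); have [? ? ?] := ord3_neq a. Qed.

Lemma ord3_third a c : a != c -> exists e, [/\ e != a, e != c & forall i, [\/ i = a, i = c | i = e]].
Proof.
have [n1 n2 n3] := ord3_neq a.
case: (ord3_cases a c) => -> ac; first by rewrite eqxx in ac.
  exists (a + 2%:R); rewrite [_ == a + 1]eq_sym n2 n3; split=> // i.
  by case: (ord3_cases a i) => ->; [apply: Or31 | apply: Or32 | apply: Or33].
exists (a + 1); rewrite n1 n3; split=> // i.
by case: (ord3_cases a i) => ->; [apply: Or31 | apply: Or33 | apply: Or32].
Qed.

Lemma prod_others (F : 'I_3 -> C) a c e : c != a -> e != a -> c != e ->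
  \prod_(i | i != a) F i = F c * F e.
Proof.
move=> ca ea ce; rewrite (bigD1 c) //= (bigD1 e) ?ea 1?eq_sym //= big1 ?mulr1 // => i.
have [h [h1 h2 h3]] := ord3_third ca.
have Eh : e = h by case: (h3 e) => // E; [rewrite E eqxx in ce | rewrite E eqxx in ea].
by case: (h3 i) => ->; rewrite -?Eh !eqxx ?andbF.
Qed.

Definition unit_times X E E' a := exists g, [/\ hol g, g 0 != 0 &
  \forall z \near (0 : C * C), X a z = g z * (E' a z * \prod_(c | c != a) E c z)].

(** Local form of the statement that the total transform of side a consists of the pull-back of
    E_a^- and of the E_c with c <> a. The relations say that X a * Y a does not depend on a; the
    cases are whether p and p' lie over base points. *)
Lemma loc_match X E Y E' : loc_type X E -> loc_type Y E' ->
  (forall a c, \forall z \near (0 : C * C), X a z * Y a z = X c z * Y c z) ->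
  forall a, unit_times X E E' a.
Proof.
move=> [hX tX LX] [hY tY LY] R.
have R0 a c : X a 0 * Y a 0 = X c 0 * Y c 0 by apply: (nbhs_singleton (R a c)).
case: LX => [[E1 NX]|[c [A [[hE tE E0 Xc] HA NA]]]]; case: LY => [[E1' NY]|[c' [A' [[hE' tE' E0' Yc] HA' NA']]]].
(* Over no base point: X a = 0 would make two of the Y vanish together. *)
- move=> a; exists (X a); split=> //; last first.
    by apply: filterE => z; rewrite E1' big1 ?mulr1 // => c _; rewrite E1.
  apply/negP => /eqP Xa; have [c [e [ca ea ce]]] := ord3_others a.
  have z i : i != a -> Y i 0 = 0.
    move=> ia; have /eqP := R0 i a; rewrite Xa mul0r mulf_eq0 (negbTE (NX a i _ Xa)) 1?eq_sym //= => /eqP //.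
  by have := NY c e ce (z c ca); rewrite z // eqxx.
(* Only p' lies over a base point: p is on the side c' contracted to it, and X c' is E' c' times a
   unit. *)
- have [i [j [ic jc ij]]] := ord3_others c'.
  have Xc' : X c' 0 = 0.
    have [_ /(_ 0) [_ Yi]] := HA' i ic; have /eqP := R0 c' i.
    by rewrite Yi E0' mul0r mulr0 mulf_eq0 (negbTE Yc) orbF => /eqP.
  move=> a; have [ac|ac] := eqVneq a c'.
    subst a; have [e [ec Ae]] : exists e, e != c' /\ A' e 0 != 0.
      have [Ai|Ai] := eqVneq (A' i 0) 0; last by exists i.
      by exists j; split=> //; apply: NA' Ai.
    have [hAe HYe] := HA' e ec.
    exists (fun z => X e z * A' e z * (Y c' z)^-1); split.
    + by apply: hol_mul; [exact: hol_mul | exact: hol_inv].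
    + by rewrite !mulf_neq0 ?invr_eq0 // (NX c') // eq_sym.
    + have ny := hol_neq0 (hY c') Yc; have r := R c' e.
      near=> z; rewrite big1 ?mulr1 => [|k _]; last by rewrite E1.
      have y0 : Y c' z != 0 by near: z.
      apply: (mulIf y0); have -> : X c' z * Y c' z = X e z * Y e z by near: z.
      by have [_ ->] := HYe z; field.
  exists (X a); split=> //; first by rewrite (NX c') // eq_sym.
  by apply: filterE => z; have [_ /(_ z) [-> _]] := HA' a ac; rewrite big1 ?mulr1 // => k _; rewrite E1.
(* Only p lies over a base point: no strict transform passes through p, since A k = 0 would make Y c
   and another Y vanish together. *)
- have [i [j [ic jc ij]]] := ord3_others c.
  have Yc' : Y c 0 = 0.
    have [_ /(_ 0) [_ Xi]] := HA i ic; have /eqP := R0 c i.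
    by rewrite Xi E0 !mul0r mulf_eq0 (negbTE Xc) => /eqP.
  have Ak k : k != c -> A k 0 != 0.
    move=> kc; apply/negP => /eqP Ak.
    have [l [lk lc _]] := ord3_third kc.
    have [hAk HAk] := HA k kc; have [hAl HAl] := HA l lc.
    have Al : A l 0 != 0 by apply: (NA k) => //; rewrite eq_sym.
    have : \forall z \near (0 : C * C), A k z * Y k z = A l z * Y l z.
      apply: (thick_eq tE); [exact: hol_mul | exact: hol_mul |].
      have r := R k l; near=> z => e0; apply: (mulfI e0); rewrite !mulrA.
      have [_ <-] := HAk z; have [_ <-] := HAl z; near: z; exact: r.
    move=> /nbhs_singleton /esym/eqP; rewrite Ak mul0r mulf_eq0 (negbTE Al) /=.
    by apply/negP; apply: (NY c) => //; rewrite eq_sym.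
  move=> a; have [->|ac] := eqVneq a c.
    exists (X c); split=> //; apply: filterE => z; rewrite E1' (prod_others _ ic jc ij).
    by have [_ /(_ z) [-> _]] := HA i ic; have [_ /(_ z) [-> _]] := HA j jc; rewrite !mulr1.
  have [l [la lc _]] := ord3_third ac.
  have [hAa HAa] := HA a ac; exists (A a); split=> //; first exact: Ak.
  apply: filterE => z; rewrite E1' (@prod_others _ a c l) // 1?eq_sym //.
  by have [_ ->] := HAa z; have [_ /(_ z) [-> _]] := HA l lc; ring.
(* Both lie over base points: p is then on E_c and on the strict transform of side c'. Equality of c
   and c' would make X c * Y c non-zero and X i * Y i zero. *)
- have cc : c != c'.
    apply/negP => /eqP cc; subst c'.
    have [i [j [ic jc ij]]] := ord3_others c; have [_ /(_ 0) [_ Xi]] := HA i ic.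
    by have /eqP := R0 c i; rewrite Xi E0 !mul0r mulf_eq0 (negbTE Xc) (negbTE Yc).
  have c'c : c' != c by rewrite eq_sym.
  have [j [jc jc' _]] := ord3_third cc.
  have [hAc' HAc'] := HA c' c'c; have [hAj HAj] := HA j jc.
  have [hBc HBc] := HA' c cc; have [hBj HBj] := HA' j jc'.
  have R1 : \forall z \near (0 : C * C), A c' z * Y c' z = A j z * (E' c' z * A' j z).
    apply: (thick_eq tE); [exact: hol_mul | by apply: hol_mul => //; apply: hol_mul |].
    have r := R c' j; near=> z => e0; apply: (mulfI e0).
    have : X c' z * Y c' z = X j z * Y j z by near: z.
    have [_ ->] := HAc' z; have [_ ->] := HAj z; have [_ ->] := HBj z.
    by move=> H; rewrite [LHS]mulrA H; ring.
  have R2 : \forall z \near (0 : C * C), X c z * A' c z = E c z * A j z * A' j z.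
    apply: (thick_eq tE'); [exact: hol_mul | by apply: hol_mul => //; apply: hol_mul |].
    have r := R c j; near=> z => e0; apply: (mulfI e0).
    have : X c z * Y c z = X j z * Y j z by near: z.
    have [_ ->] := HAj z; have [_ ->] := HBj z; have [_ ->] := HBc z.
    by move=> H; rewrite mulrCA H; ring.
  have Ac' : A c' 0 = 0.
    by have /eqP := nbhs_singleton R1; rewrite E0' mul0r mulr0 mulf_eq0 (negbTE Yc) orbF => /eqP.
  have Bc : A' c 0 = 0.
    by have /eqP := nbhs_singleton R2; rewrite E0 !mul0r mulf_eq0 (negbTE Xc) => /eqP.
  have Aj : A j 0 != 0 by apply: (NA c') => //; rewrite eq_sym.
  have Bj : A' j 0 != 0 by apply: (NA' c) => //; rewrite eq_sym.
  move=> a; have [->|ac] := eqVneq a c.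
    exists (X c); split=> //; apply: filterE => z.
    rewrite (prod_others _ c'c jc) 1?eq_sym //; have [-> _] := HBc z.
    by have [-> _] := HAc' z; have [-> _] := HAj z; rewrite !mulr1.
  have [->|ac'] := eqVneq a c'.
    exists (fun z => A j z * A' j z * (Y c' z)^-1); split.
    + by apply: hol_mul; [exact: hol_mul | exact: hol_inv].
    + by rewrite !mulf_neq0 ?invr_eq0.
    + have ny := hol_neq0 (hY c') Yc.
      near=> z; have y0 : Y c' z != 0 by near: z.
      rewrite (prod_others _ cc jc') 1?eq_sym //.
      have [_ ->] := HAc' z; have [-> _] := HAj z; rewrite mulr1.
      apply: (mulIf y0); rewrite -[LHS]mulrA; have -> : A c' z * Y c' z = A j z * (E' c' z * A' j z) by near: z.
      by field.
  have Ea : a = j.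
    have [h [h1 h2 h3]] := ord3_third cc.
    have -> : j = h by case: (h3 j) => // e; [rewrite e eqxx in jc | rewrite e eqxx in jc'].
    by case: (h3 a) => // e; [rewrite e eqxx in ac | rewrite e eqxx in ac'].
  subst a; exists (A j); split=> //; apply: filterE => z.
  rewrite (@prod_others _ j c c') // 1?eq_sym //.
  have [_ ->] := HAj z; have [-> _] := HBj z; have [-> _] := HAc' z; ring.
Unshelve. all: by end_near. Qed.
End Labelling.

(** * Base points, labelling and invariance of the cubic *)

Section Quadratic.
Variable C : numFieldType.
Hypothesis closed : forall p : {poly C}, size p != 1 -> exists x, root p x.
Implicit Types (b : 'I_3 -> C) (dl t : C) (a c : 'I_3) (x : 'rV[C]_3).

Lemma path_near (V : normedModType C) (ga : C -> V) (P : V -> Prop) (Q : C -> Prop) :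
  differentiable ga 0 -> (\forall v \near ga 0, P v) -> (\forall s \near (0 : C)^', Q s) ->
  exists s, [/\ s != 0, P (ga s) & Q s].
Proof.
move=> /differentiable_continuous cg HP HQ.
have H1 : \forall s \near (0 : C)^', P (ga s) by apply: nbhs_dnbhs; apply: cg.
have H3 : \forall s \near (0 : C)^', s != 0 by apply: nbhs_dnbhs_neq.
by have [s [s1 [s2 s3]]] := filter_ex (filterI H3 (filterI H1 HQ)); exists s.
Qed.

Lemma diff_id (x : C) : differentiable (fun s : C => s : C^o) x.
Proof. exact: ex_diff. Qed.

Lemma line_chart_base b a c z : a != c -> line b a (chart (cbase (b c)) z) = z.2 - slope b a * z.1.
Proof. by move=> ac; rewrite /chart /= line_near_base. Qed.

(** At the base point c, let a and j be the two sides through it. Along side j the relation gives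
    X_a Y_a = 0 with X_a <> 0, because the slopes differ; hence Y_a vanishes at 0. For the side c,
    compare values at 0. *)
Lemma no_extension b b' c (h : C * C -> 'rV[C]_3) : nondeg b -> nondeg b' ->
  (forall a, hol (fun z => line b' a (h z))) ->
  (forall a e, \forall z \near (0 : C * C), line b a (chart (cbase (b c)) z) * line b' a (h z) =
     line b e (chart (cbase (b c)) z) * line b' e (h z)) -> h 0 = 0.
Proof.
move=> nb nb' hh R; apply: (line_eq0 nb') => a.
have lc : line b c (chart (cbase (b c)) 0) != 0.
  by rewrite /chart /= !addr0; apply: line_base_neq0.
have [ac|ac] := eqVneq a c.
  subst a; have [i [j [ic jc ij]]] := ord3_others c.
  have /eqP := nbhs_singleton (R c i); rewrite (line_chart_base _ _ ic) /= mulr0 subr0 mul0r.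
  by rewrite mulf_eq0 (negbTE lc) => /eqP.
have [j [ja jc _]] := ord3_third ac.
apply/eqP; apply: contraT => H0; exfalso.
have nz := hol_neq0 (hh a) H0; have r := R a j.
pose ga (s : C) : C^o * C^o := (s, slope b j * s).
have dg : differentiable ga (0 : C).
  apply: differentiable_pair; first exact: diff_id.
  by apply: differentiableM; [exact: differentiable_cst | exact: diff_id].
have g0 : ga 0 = 0 by rewrite /ga mulr0.
rewrite -g0 in nz r.
have [s [s0 [E n] _]] := path_near (Q := fun=> True) dg (filterI r nz) (filterE _ (fun=> I)).
move/eqP: E; rewrite !line_chart_base // /ga /= subrr mul0r mulf_eq0 (negbTE n) orbF.
rewrite -mulrBl mulf_eq0 (negbTE s0) orbF subr_eq0 => /eqP /(slope_inj nb) E.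
by rewrite E eqxx in ja.
Qed.

Lemma hol_coord (h : C * C -> 'rV[C]_3) k : holomorphic_at0 h -> hol (fun z => h z 0 k).
Proof.
move=> hh; near=> z.
apply: (@differentiable_comp _ _ _ _ h (fun M : 'rV[C]_3 => M 0 k : C^o)); first by near: z.
exact: differentiable_coord.
Unshelve. all: by end_near. Qed.

Lemma hol_line_comp b a (h : C * C -> 'rV[C]_3) : holomorphic_at0 h -> hol (fun z => line b a (h z)).
Proof.
move=> hh; rewrite /line; apply: hol_add; last by apply: hol_mul; [exact: hol_cst | exact: hol_coord].
apply: hol_add; first exact: hol_coord.
by apply: hol_opp; apply: hol_mul; [exact: hol_cst | exact: hol_coord].
Qed.

Lemma collinear_relation b dl (p : Defs.point C) (h : C * C -> 'rV[C]_3) : dl != 0 -> nondeg b ->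
  (forall a, hol (fun z => line (bminus b dl) a (h z))) ->
  (\forall z \near (0 : C * C), collinear (qmap b dl (chart p z)) (h z)) ->
  forall a e, \forall z \near (0 : C * C), line b a (chart p z) * line (bminus b dl) a (h z) =
     line b e (chart p z) * line (bminus b dl) e (h z).
Proof.
move=> d0 nb hh H; have d3 : dl ^+ 3 != 0 by rewrite expf_neq0.
apply: (inverse_relation d3 (fun a => hol_line b a p) (fun a => thick_line b a p) hh).
near=> z; have [k Ek] : collinear (qmap b dl (chart p z)) (h z) by near: z.
by exists k => a; rewrite -line_qmap // Ek lineZ.
Unshelve. all: by end_near. Qed.

Definition qlift b dl (W : 'I_3 -> C) : 'rV[C]_3 :=
  \sum_a (W a * qcoef b a) *: cubic_param (bminus b dl a).

Lemma qmap_qlift b dl x : qmap b dl x = qlift b dl (fun a => line b (a + 1) x * line b (a + 2%:R) x).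
Proof. by []. Qed.

Lemma line_qlift b dl a W : nondeg b -> line (bminus b dl) a (qlift b dl W) = dl ^+ 3 * W a.
Proof.
move=> nb; have [n1 n2 n3] := ord3_neq a.
rewrite /qlift (big_ord3 _ _ a) /= !lineD !lineZ !line_minus_param eqxx (negbTE n1) (negbTE n2).
rewrite !mulr0 !addr0; have := qcoef_neq0 a nb.
by move: (W a) (qcoef b a) => u w w0; field.
Qed.

Lemma hol_qlift b dl (W : 'I_3 -> C * C -> C) : (forall a, hol (W a)) ->
  holomorphic_at0 (fun z => qlift b dl (fun a => W a z)).
Proof.
move=> hW; have hW0 := hW 0; have hW1 := hW 1; have hW2 := hW 2%:R.
have E : (fun z => qlift b dl (fun a => W a z)) = fun z =>
  (W 0 z * qcoef b 0) *: cubic_param (bminus b dl 0) + ((W 1 z * qcoef b 1) *: cubic_param (bminus b dl 1)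
   + (W 2%:R z * qcoef b 2%:R) *: cubic_param (bminus b dl 2%:R)).
  by apply/funext => z; rewrite /qlift (big_ord3 _ _ 0) /= !add0r.
rewrite E; near=> z.
have dz (w : C * C -> C) (k : C) (v : 'rV[C]_3) : differentiable (w : C * C -> C^o) z ->
    differentiable (fun z => (w z * k) *: v) z.
  move=> dw; apply: differentiableZl; apply: differentiableM => //; exact: differentiable_cst.
by apply: differentiableD; [|apply: differentiableD]; apply: dz; near: z.
Unshelve. all: by end_near. Qed.

Lemma base_pointP b dl (d0 : dl != 0) (nb : nondeg b) p :
  base_point (rmap closed d0 nb) p <-> exists j, p = cbase (b j).
Proof.
have nb' := nondeg_minus d0 nb; have d3 : dl ^+ 3 != 0 by rewrite expf_neq0.
split=> [bp|[c ->] [h [hh h0 H]]]; last first.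
  move/eqP: h0; apply; have hl a := hol_line_comp (bminus b dl) a hh.
  apply: (no_extension (c := c) nb nb' hl); apply: collinear_relation => //.
  by apply: filterS H => z; rewrite rmap_eval.
apply: contrapT => np; apply: bp.
have np' a : p <> cbase (b a) by move=> E; apply: np; exists a.
have [hX tX [[_ NX]|[c [A [[hE tE E0 Xc] HA NA]]]]] := loc_type_point nb np'.
  exists (fun z => qmap b dl (chart p z)); split.
  - by apply: (hol_qlift b dl (W := fun a z => _)) => a; apply: hol_mul.
  - apply/negP => /eqP E0; have Z := qmap_eq0 d0 nb E0.
    have [a Xa] : exists a, line b a (chart p 0) = 0.
      by move/eqP: (Z 0); rewrite mulf_eq0 => /orP[] /eqP E; eexists; exact: E.
    have [n1 n2 n3] := ord3_neq a; move/eqP: (Z a); rewrite mulf_eq0.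
    by rewrite (negbTE (NX a (a + 1) _ Xa)) ?(negbTE (NX a (a + 2%:R) _ Xa)) // eq_sym.
  - by apply: filterE => z; rewrite rmap_eval; exists 1; rewrite scale1r.
have [n1 n2 n3] := ord3_neq c.
set E := exceptional_eq _ _ in hE tE E0 HA.
have [h1 H1] := HA _ n1; have [h2 H2] := HA _ n2.
(* Over the base point c the three products of sides have the common factor E; W is what remains,
   and it does not vanish at 0. *)
pose W a z := if a == c then E z * (A (c + 1) z * A (c + 2%:R) z)
  else if a == c + 1 then A (c + 2%:R) z * line b c (chart p z)
  else line b c (chart p z) * A (c + 1) z.
exists (fun z => qlift b dl (fun a => W a z)); split.
- apply: hol_qlift => a; rewrite /W; case: eqP => _; first by apply: hol_mul => //; apply: hol_mul.
  by case: eqP => _; apply: hol_mul => //; apply: hX.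
- apply/negP => /eqP Z.
  have W0 a : W a 0 = 0.
    by have /eqP := line_qlift dl a (fun a => W a 0) nb; rewrite Z line0 eq_sym mulf_eq0 (negbTE d3) => /eqP.
  have := W0 (c + 1); have := W0 (c + 2%:R); rewrite /W (negbTE n1) (negbTE n2) eqxx eq_sym (negbTE n3).
  move=> /eqP; rewrite mulf_eq0 (negbTE Xc) /= => /eqP A1 /eqP; rewrite mulf_eq0 (negbTE Xc) orbF => A2.
  by have := NA _ _ n1 n2 n3 A1; rewrite A2.
apply: filterE => z; rewrite rmap_eval qmap_qlift; exists (E z).
rewrite /qlift scaler_sumr; apply: eq_bigr => a _; rewrite scalerA mulrA; congr ((_ * _) *: _).
have [_ e1] := H1 z; have [_ e2] := H2 z.
case: (ord3_cases c a) => ->; rewrite /W ?eqxx ?(negbTE n1) ?(negbTE n2) ?[_ == c + 1]eq_sym ?(negbTE n3) ?ord3E ?e1 ?e2; ring.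
Qed.

Lemma quad_labelling b dl (d0 : dl != 0) (nb : nondeg b) :
  labelling (quad closed d0 nb) (fun j => cbase (b j)) (fun j => cbase (bminus b dl j)).
Proof.
have nb' := nondeg_minus d0 nb.
have cinj (b' : 'I_3 -> C) : nondeg b' -> injective (fun j => cbase (b' j)).
  by move=> [bi _] j j' [/bi].
split; [split; [exact: cinj | by move=> p; apply: base_pointP] | split; [exact: cinj | by move=> p; apply: base_pointP] |].
(* For L the side a, the two divisors are equal, so that A / B = 1. *)
move=> a; exists (lineform b a), 0%N, (mpolyC 3 1), (mpolyC 3 1).
have h1 : homog 0 (mpolyC 3 (1 : C)) by apply: dhomog1.
have n1 : mpolyC 3 (1 : C) != 0 by apply: oner_neq0.
split=> // [|p p' phi [[p0 hp [psi [q0 hq K1 K2]]] lf]].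
  by split; [exact: homog_lineform | exact: lineform_neq0].
have hY e : hol (fun z => line (bminus b dl) e (chart p' (phi z))).
  exact: (@hol_comp C (fun w => line (bminus b dl) e (chart p' w)) phi p0 hp (hol_line _ _ _)).
have R := @collinear_relation b dl p (fun z => chart p' (phi z)) d0 nb hY.
have {R} R : forall a e, \forall z \near (0 : C * C),
    line b a (chart p z) * line (bminus b dl) a (chart p' (phi z)) =
    line b e (chart p z) * line (bminus b dl) e (chart p' (phi z)).
  by apply: R; apply: filterS lf => z; rewrite rmap_eval.
have cne (q : Defs.point C) : chart q 0 != 0 by rewrite chartE blowups0 proper_chart_neq0.
have np e : p <> cbase (b e).
  move=> E; move: (cne p'); rewrite -p0; apply/negP/negPn/eqP.
  by apply: (@no_extension b (bminus b dl) e (fun z => chart p' (phi z))) => //; rewrite -E.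
have np' e : p' <> cbase (bminus b dl e).
  move=> E; move: (cne p); rewrite -q0; apply/negP/negPn/eqP.
  apply: (@no_extension (bminus b dl) b e (fun z => chart p (psi z))) => // [i|i j].
    exact: (@hol_comp C (fun w => line b i (chart p w)) psi q0 hq (hol_line _ _ _)).
  rewrite -E; have r := near0_comp q0 hq (R i j).
  near=> w; have k2 : phi (psi w) = w by near: w.
  have : line b i (chart p (psi w)) * line (bminus b dl) i (chart p' (phi (psi w))) =
    line b j (chart p (psi w)) * line (bminus b dl) j (chart p' (phi (psi w))) by near: w.
  by rewrite k2 mulrC => ->; rewrite mulrC.
have LX := loc_type_point nb np.
have [hY' tY' LY'] := loc_type_point nb' np'.
have LY : loc_type (fun a z => line (bminus b dl) a (chart p' (phi z)))
   (fun a z => exceptional_eq (cbase (bminus b dl a)) p' (phi z)).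
  have tc f : thick f -> thick (fun z => f (phi z)) by apply: thick_comp p0 hp q0 hq K1 K2.
  split=> // [e|]; first exact: tc (tY' e).
  case: LY' => [[E1 NX]|[c [A [[hE tE E0 Xc] HA NA]]]].
    by left; split=> [e z|e c ec] ; [exact: E1 | rewrite p0; apply: NX].
  right; exists c, (fun e z => A e (phi z)); rewrite !p0; split=> //.
  - by split=> //; [exact: hol_comp p0 hp hE | exact: tc tE].
  - by move=> e ec; have [hA HA'] := HA e ec; split=> // ; exact: hol_comp p0 hp hA.
have [g [hg g0 Hg]] := loc_match LX LY R a.
exists g; split=> //; near=> z.
rewrite /form_eval !mevalC mul1r mulr1 -/(form_eval _ _) lineform_eval; near: z.
exact: Hg.
Unshelve. all: by end_near. Qed.

Lemma quad_delta b dl (d0 : dl != 0) (nb : nondeg b) : is_delta (quad closed d0 nb) dl.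
Proof.
split=> //; exists (dl * (bsum b / 3)) => t _; rewrite rmap_eval qmap_param //.
by exists (\prod_a (t - b a)); rewrite -mulrDr.
Qed.

(* [cubic] compares x, seen as a function, with the null function. *)
Lemma cubicP x : cubic x <-> x != 0 /\ x 0 1 * x 0 2%:R ^+ 2 = x 0 0 ^+ 3.
Proof.
split=> -[x0 E]; split=> //.
  by apply: contraNneq x0 => ->; apply/eqP/funext => i; apply/funext => j; rewrite mxE.
apply: contraNneq x0 => E0; apply/eqP/matrixP => i j; rewrite mxE.
by have := congr1 (fun g => g i j) E0.
Qed.

Lemma cubic_cases x : cubic x -> (exists k t, k != 0 /\ x = k *: cubic_param t) \/
  (exists k, k != 0 /\ x = k *: vec3 0 1 0).
Proof.
move=> /cubicP [x0 E]; have [z0|z0] := eqVneq (x 0 2%:R) 0.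
  right; exists (x 0 1); have x00 : x 0 0 = 0.
    by move: E; rewrite z0 expr0n mulr0 => /esym/eqP; rewrite expf_eq0 => /andP[_ /eqP].
  have Ex : x = x 0 1 *: vec3 0 1 0.
    by apply: row3P; rewrite !mxE /= ?mulr0 ?mulr1.
  by split=> //; apply: contraNneq x0 => E1; rewrite Ex E1 scale0r.
left; exists (x 0 2%:R), (x 0 0 / x 0 2%:R); split=> //.
apply: row3P; rewrite !mxE /= ?mulr1 //; first by rewrite mulrC divfK.
rewrite expr_div_n -E; field; exact: z0.
Qed.

Lemma cubic_paramP k t : k != 0 -> cubic (k *: cubic_param t).
Proof.
move=> k0; apply/cubicP; split; last by rewrite !mxE /=; ring.
apply/negP => /eqP /(congr1 (fun M : 'rV[C]_3 => M 0 2%:R)); rewrite !mxE /= mulr1.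
by move/eqP; rewrite (negbTE k0).
Qed.

Lemma qmap_flex b dl : nondeg b -> dl != 0 -> qmap b dl (vec3 0 1 0) = dl ^+ 3 *: vec3 0 1 0.
Proof.
move=> nb d0; apply: (line_inj (nondeg_minus d0 nb)) => a.
by rewrite line_qmap // lineZ !line_vec3; ring.
Qed.

(** [in_QC] works on cones and [qmap] has degree 2, so reaching a given representative takes a
    square root. *)
Lemma sqrt_ex (k : C) : exists r, r ^+ 2 = k.
Proof.
have [|r /rootP] := closed (p := 'X^2 - k%:P).
  by rewrite size_XnsubC.
by rewrite !hornerE => /eqP; rewrite subr_eq0 => /eqP E; exists r.
Qed.

Lemma diff_vec3 (f g h : C -> C) (s : C) : differentiable (f : C -> C^o) s -> differentiable (g : C -> C^o) s ->
  differentiable (h : C -> C^o) s -> differentiable (fun s => vec3 (f s) (g s) (h s)) s.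
Proof.
move=> df dg dh.
have -> : (fun s => vec3 (f s) (g s) (h s)) = fun s => f s *: vec3 1 0 0 + (g s *: vec3 0 1 0 + h s *: vec3 0 0 1).
  by apply/funext => u; apply: row3P; rewrite !mxE /=; ring.
by apply: differentiableD; [|apply: differentiableD]; apply: differentiableZl.
Qed.

Lemma diff_pow (V : normedModType C) (f : V -> C) k (s : V) :
  differentiable (f : V -> C^o) s -> differentiable (fun s => f s ^+ k : C^o) s.
Proof.
move=> df; elim: k => [|k IH]; first exact: differentiable_cst.
by under eq_fun do rewrite exprS; apply: differentiableM.
Qed.

Lemma quad_QC b dl (d0 : dl != 0) (nb : nondeg b) : in_QC (quad closed d0 nb).
Proof.
split.
  apply/seteqP; split=> y.
    move=> [cy y0]; apply/cubicP; split=> //.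
    pose P (x : 'rV[C]_3) : C^o := x 0 1 * x 0 2%:R ^+ 2 - x 0 0 ^+ 3.
    apply/eqP; rewrite -subr_eq0 -/(P y); apply: contraT => Py; exfalso.
    have dP : differentiable P y.
      apply: differentiableB; [apply: differentiableM|apply: diff_pow]; try exact: differentiable_coord.
      by apply: diff_pow; exact: differentiable_coord.
    have nP : \forall x \near y, P x != 0.
      exact: (cvgr_neq0 _ (differentiable_continuous dP)).
    have [_ [[x [cx Fx] <-] Pn]] := cy _ nP; move: Pn; rewrite /= rmap_eval.
    case: (cubic_cases cx) => [[k [t [k0 ->]]]|[k [k0 ->]]].
      rewrite qmapZ qmap_param // scalerA; set m := _ * _.
      by rewrite /P !mxE /=; apply/negP/negPn/eqP; ring.
    rewrite qmapZ qmap_flex // scalerA; set m := _ * _.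
    by rewrite /P !mxE /=; apply/negP/negPn/eqP; ring.
  move=> cy; split; last by case/cubicP: cy.
  case: (cubic_cases cy) => [[k [t [k0 ->]]]|[k [k0 ->]]]; last first.
    apply: subset_closure; have [r Er] := sqrt_ex (k / dl ^+ 3).
    have d3 : dl ^+ 3 != 0 by rewrite expf_neq0.
    have r0 : r != 0.
      by apply/negP => /eqP r0; move/eqP: Er; rewrite r0 expr0n eq_sym mulf_eq0 invr_eq0 (negbTE k0) (negbTE d3).
    have EF : rat_eval (quad closed d0 nb) (r *: vec3 0 1 0) = k *: vec3 0 1 0.
      by rewrite rmap_eval qmapZ qmap_flex // scalerA Er divfK.
    have nz m : m != 0 -> m *: vec3 0 1 0 != 0 :> 'rV[C]_3.
      move=> m0; apply/negP => /eqP /(congr1 (fun M : 'rV[C]_3 => M 0 1)); rewrite !mxE /= mulr1.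
      by move/eqP; rewrite (negbTE m0).
    exists (r *: vec3 0 1 0) => //; split; last by rewrite EF nz.
    by apply/cubicP; split; [exact: nz | rewrite !mxE /=; ring].
  move=> B HB.
  (* The parameter mapped to t + s. For s = 0 it may be a base parameter, where [qmap] vanishes, so
     t is approached by s <> 0. *)
  pose tt s := t / dl - bsum b / 3 + s / dl.
  have att s : aff b dl (tt s) = t + s by rewrite /aff /tt; field.
  have dtt s : differentiable (tt : C -> C^o) s.
    apply: differentiableD; first exact: differentiable_cst.
    by apply: differentiableM; [exact: diff_id | exact: differentiable_cst].
  have Q0 a : \forall s \near (0 : C)^', tt s - b a != 0.
    have [E|n0] := eqVneq (tt 0 - b a) 0.
      have : \forall s \near (0 : C)^', s != 0 by apply: nbhs_dnbhs_neq.
      apply: filterS => s s0; have -> : tt s - b a = s / dl.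
        by rewrite -[LHS]subr0 -E /tt; ring.
      by rewrite mulf_neq0 ?invr_eq0.
    apply: nbhs_dnbhs; have ds : differentiable (fun s => tt s - b a : C^o) (0 : C).
      by apply: differentiableB; [exact: dtt | exact: differentiable_cst].
    exact: (cvgr_neq0 _ (differentiable_continuous ds)).
  pose ga (s : C) := k *: cubic_param (t + s).
  have dg : differentiable ga (0 : C).
    apply: (@differentiableZ _ _ _ (fun s : C => cubic_param (t + s)) k).
    have dd : differentiable (fun s : C => t + s : C^o) (0 : C).
      by apply: differentiableD; [exact: differentiable_cst | exact: diff_id].
    by apply: diff_vec3 => //; apply: diff_pow.
  have HB' : \forall v \near ga 0, B v by rewrite /ga addr0; exact: HB.
  have [s [s0 Bs [q0 [q1 q2]]]] := path_near dg HB' (filterI (Q0 0) (filterI (Q0 1) (Q0 2%:R))).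
  exists (ga s); split=> //.
  pose m := \prod_a (tt s - b a).
  have m0 : m != 0 by rewrite /m (big_ord3 _ _ 0) /= !add0r !mulf_neq0.
  have [r Er] := sqrt_ex (k / m).
  have r0 : r != 0.
    by apply/negP => /eqP r0; move/eqP: Er; rewrite r0 expr0n eq_sym mulf_eq0 invr_eq0 (negbTE k0) (negbTE m0).
  have EF : rat_eval (quad closed d0 nb) (r *: cubic_param (tt s)) = ga s.
    by rewrite rmap_eval qmapZ qmap_param // scalerA Er -/m divfK // att.
  exists (r *: cubic_param (tt s)) => //; split; first exact: cubic_paramP.
  by rewrite EF; have /cubicP [] := @cubic_paramP k (t + s) k0.
move=> p /base_pointP [j ->]; split; first by exists (b j).
move=> B HB.
pose ga (s : C) : C^o * C^o := (s, (b j + s) ^+ 3 - b j ^+ 3).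
have dg : differentiable ga (0 : C).
  apply: differentiable_pair; first exact: diff_id.
  apply: differentiableB; last exact: differentiable_cst.
  by apply: diff_pow; apply: differentiableD; [exact: differentiable_cst | exact: diff_id].
have HB' : \forall v \near ga 0, B v by rewrite /ga addr0 subrr; exact: HB.
have [s [s0 Bs _]] := path_near (Q := fun=> True) dg HB' (filterE _ (fun=> I)).
have Ec : chart (cbase (b j)) (ga s) = cubic_param (b j + s).
  by rewrite /chart /= /cubic_param; congr vec3; ring.
exists (ga s); split=> //; split.
  by rewrite Ec -[cubic_param _]scale1r; apply: cubic_paramP; apply: oner_neq0.
rewrite Ec => -[k E]; have E2 := congr1 (fun M : 'rV[C]_3 => M 0 2%:R) E.
have E0 := congr1 (fun M : 'rV[C]_3 => M 0 0) E; move: E0 E2; rewrite !mxE /= mulr1 => + k1.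
by rewrite -k1 mul1r addr0 => /eqP; rewrite -subr_eq0 addrAC subrr add0r (negbTE s0).
Qed.
End Quadratic.

(** * Lifts at infinitely near points *)

Section Lifts.
Variable C : numFieldType.
Implicit Types (b : 'I_3 -> C) (dl t u w : C) (a c : 'I_3) (x : 'rV[C]_3) (z : C * C).

(* Taylor coefficients at t of the branch x |-> x ^+ 3 of the cubic. *)
Definition taylor t k : C := nth 0 [:: 3 * t ^+ 2; 3 * t; 1] k.

Definition cpoint (p : C * nat) : Defs.point C :=
  (Affine p.1 (p.1 ^+ 3), [seq Some (taylor p.1 k) | k <- seq.iota 0 p.2]).

(** The strict transform of C in the chart at height h is the graph z.2 = tail t h z.1. *)
Definition tail t h u : C :=
  match h with 0 => 3 * t ^+ 2 * u + 3 * t * u ^+ 2 + u ^+ 3 | 1 => 3 * t * u + u ^+ 2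
  | 2 => u | _ => 0 end.

Lemma tailS t h u : tail t h u = u * taylor t h + u * tail t h.+1 u.
Proof. by case: h => [|[|[|h]]] /=; rewrite /taylor /= ?nth_nil; ring. Qed.

Lemma tail0 t h : tail t h 0 = 0.
Proof. by case: h => [|[|[|h]]] /=; ring. Qed.

(* The curve is w = 0. *)
Definition cchart t h u w : 'rV[C]_3 := vec3 (t + u) ((t + u) ^+ 3 + u ^+ h * w) 1.

Lemma chart_cpoint t h z : chart (cpoint (t, h)) z = cchart t h z.1 (z.2 - tail t h z.1).
Proof.
elim: h z => [|h IH] z.
  by rewrite /chart /cchart /=; congr vec3; ring.
have -> : chart (cpoint (t, h.+1)) z = chart (cpoint (t, h)) (blowup_chart (Some (taylor t h)) z).
  by rewrite /chart /cpoint -[(t, h.+1).2]/(h.+1) -(addn1 h) iotaD map_cat foldr_cat.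
rewrite IH -[(blowup_chart _ z).1]/(z.1) -[(blowup_chart _ z).2]/(z.1 * (z.2 + taylor t h)).
by rewrite /cchart [tail t h _]tailS [z.1 ^+ h.+1]exprS; congr vec3; ring.
Qed.

Lemma cpoint_inj : injective cpoint.
Proof.
move=> [t h] [t' h'] [E _ /(congr1 size)]; rewrite !size_map !size_iota => Eh.
by rewrite E Eh.
Qed.

Lemma line_over b a (x D : C) : line b a (vec3 x (x ^+ 3 + D) 1) =
  \prod_c (x - b c) + D + bsum b * ((x - b (a + 1)) * (x - b (a + 2%:R))).
Proof. by rewrite line_vec3 (big_ord3 _ _ a) (bsum3 b a) /=; ring. Qed.

(** D is the vertical distance from the curve y = x^3, and Q is the last homogeneous coordinate of
    the image. The image lies at a distance divisible by D; for D = 0 the formula reduces to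
    [aff]. *)
Lemma qmap_over b dl (x D : C) : dl != 0 -> nondeg b ->
  let Q := \prod_c (x - b c) + D in Q != 0 ->
  qmap b dl (vec3 x (x ^+ 3 + D) 1) =
  Q *: (let X := dl * (x + bsum b / 3 - bsum b * D / Q) in
   vec3 X (X ^+ 3 + dl ^+ 3 * D * \prod_a line b a (vec3 x (x ^+ 3 + D) 1) / Q ^+ 3) 1).
Proof.
move=> d0 nb Q Q0; apply: (line_inj (nondeg_minus d0 nb)) => a.
rewrite line_qmap // lineZ (big_ord3 _ _ a) /=.
rewrite [line (bminus b dl) a _]line_vec3 !line_over !ord3E -/Q.
set X := dl * _.
have Ea : X + bminus b dl (a + 1) + bminus b dl (a + 2%:R) = dl * (x - b a - bsum b * D / Q).
  by rewrite /X /bminus (bsum3 b a); field.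
have EQ : Q = (x - b a) * ((x - b (a + 1)) * (x - b (a + 2%:R))) + D.
  by rewrite /Q (big_ord3 _ _ a).
have E1 : X - bminus b dl (a + 1) = dl * (x - b (a + 1)) * (Q + bsum b * ((x - b (a + 2%:R)) * (x - b a))) / Q.
  have -> : X - bminus b dl (a + 1) = dl * (x - b (a + 1) + bsum b * (Q - D) / Q) by rewrite /X /bminus; field.
  by rewrite {1}EQ addrK; field.
have E2 : X - bminus b dl (a + 2%:R) = dl * (x - b (a + 2%:R)) * (Q + bsum b * ((x - b a) * (x - b (a + 1)))) / Q.
  have -> : X - bminus b dl (a + 2%:R) = dl * (x - b (a + 2%:R) + bsum b * (Q - D) / Q) by rewrite /X /bminus; field.
  by rewrite {1}EQ addrK; field.
set D' := dl ^+ 3 * D * _ / _.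
have -> : X ^+ 3 + D' - (bminus b dl (a + 1) ^+ 2 + bminus b dl (a + 1) * bminus b dl (a + 2%:R) + bminus b dl (a + 2%:R) ^+ 2) * X
  + bminus b dl (a + 1) * bminus b dl (a + 2%:R) * (bminus b dl (a + 1) + bminus b dl (a + 2%:R)) * 1 =
  (X - bminus b dl (a + 1)) * (X - bminus b dl (a + 2%:R)) * (X + bminus b dl (a + 1) + bminus b dl (a + 2%:R)) + D' by ring.
rewrite Ea E1 E2 /D' ; move: (bsum b) EQ => S; move: (x - b a) (x - b (a + 1)) (x - b (a + 2%:R)) => p p1 p2 EQ.
have ED : D = Q - p * (p1 * p2) by rewrite {1}EQ; ring.
by rewrite ED; move: Q0; clear; clearbody Q => Q0; field.
Qed.

Lemma lift_power (S u w v : C) dl k : v != 0 ->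
  (dl * (u - S * (u ^+ k * w) / v)) ^+ k = u ^+ k * (dl * (1 - S * (u ^+ k.-1 * w) / v)) ^+ k.
Proof.
case: k => [|k] v0; first by rewrite !expr0 mulr1.
by rewrite -exprMn; congr (_ ^+ _); rewrite /= exprS; field.
Qed.

Section OneLift.
Variables (b : 'I_3 -> C) (dl t : C) (h1 : nat) (e el : bool) (Q1 G : C * C -> C).
Hypotheses (d0 : dl != 0) (nb : nondeg b).
Let S := bsum b.
Let U z : C := dl * (z.1 - S * (z.1 ^+ h1 * z.2) / Q1 z).
Let V z : C := dl * (1 - S * (z.1 ^+ h1.-1 * z.2) / Q1 z).
Let W z : C := z.2 * G z / V z ^+ h1.
Let x z := t + z.1.
Hypotheses (hQ : hol Q1) (Q10 : Q1 0 != 0) (hG : hol G).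
Hypothesis QE : forall z, \prod_c (x z - b c) + z.1 ^+ (h1 + e) * z.2 = z.1 ^+ e * Q1 z.
Hypothesis GE : \forall z \near (0 : C * C), z.1 ^+ e != 0 ->
  dl ^+ 3 * (z.1 ^+ (h1 + e) * z.2) * \prod_a line b a (cchart t (h1 + e) z.1 z.2) / (z.1 ^+ e * Q1 z) ^+ 3 =
  z.1 ^+ h1 * z.2 * G z * U z ^+ el.

Lemma hol_prod (f g : C * C -> C) k : hol f -> hol g -> hol (fun z => f z ^+ k * g z).
Proof. by move=> hf hg; apply: hol_mul => //; apply: hol_exp. Qed.

Lemma lift_aux k : hol (fun z : C * C => dl * (1 - S * (z.1 ^+ k * z.2) / Q1 z)).
Proof.
apply: hol_mul; first exact: hol_cst.
apply: hol_add; first exact: hol_cst.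
apply: hol_opp; apply: hol_mul; last exact: hol_inv.
by apply: hol_mul; [exact: hol_cst | apply: hol_prod; [exact: hol_fst | exact: hol_snd]].
Qed.

(** [e] and [el] tell whether t is a base parameter and whether its image is one for the inverse.
    Dividing Q by u^e leaves a unit Q1 and gives the new coordinate U. The distance u^(h1 + e) w
    becomes u^h1 w G U^el; as U^h1 = u^h1 V^h1 with V a unit, this is U^(h1 + el) W for W = w G /
    V^h1. *)
Lemma one_lift : exists U W : C * C -> C, [/\ hol U, hol W, U 0 = 0, W 0 = 0 &
  \forall z \near (0 : C * C), exists k,
   qmap b dl (cchart t (h1 + e) z.1 z.2) = k *: cchart (aff b dl t) (h1 + el) (U z) (W z)].
Proof.
have V0 : V 0 != 0 by rewrite /V /= mulr0 mulr0 mul0r subr0 mulr1.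
have hV : hol V by apply: lift_aux.
have hU : hol U.
  apply: hol_mul; first exact: hol_cst.
  apply: hol_add; first exact: hol_fst.
  apply: hol_opp; apply: hol_mul; last exact: hol_inv.
  by apply: hol_mul; [exact: hol_cst | apply: hol_prod; [exact: hol_fst | exact: hol_snd]].
exists U, W; split=> //.
- apply: hol_mul; first by apply: hol_mul => //; exact: hol_snd.
  by apply: hol_inv; [exact: hol_exp | rewrite expf_neq0].
- by rewrite /U /= mulr0 mulr0 mul0r subr0 mulr0.
- by rewrite /W /= !mul0r.
have nQ := hol_neq0 hQ Q10; have nV := hol_neq0 hV V0.
near=> z; exists (z.1 ^+ e * Q1 z).
have q0 : Q1 z != 0 by near: z.
have v0 : V z != 0 by near: z.
(* On the exceptional curve over a base point both sides are 0, as k = 0. *)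
have [ze|ze] := eqVneq (z.1 ^+ e) 0.
  have [z0 e1] : z.1 = 0 /\ e = true.
    by move: ze; case: (e) => /= /eqP; rewrite ?expr1 ?expr0 ?oner_eq0 => // /eqP ->.
  have E := QE z; move: E; rewrite /cchart z0 e1 addn1 expr0n exprS !mul0r !addr0 => E.
  rewrite -[vec3 _ _ _]/(cubic_param t) qmap_param // scale0r.
  by move: E; rewrite /x z0 addr0 => ->; rewrite scale0r.
have Ge : dl ^+ 3 * (z.1 ^+ (h1 + e) * z.2) * \prod_a line b a (cchart t (h1 + e) z.1 z.2) / (z.1 ^+ e * Q1 z) ^+ 3 =
  z.1 ^+ h1 * z.2 * G z * U z ^+ el.
  by apply: (near GE z) => //; near: z.
rewrite /cchart -/(x z) qmap_over //; last by rewrite QE mulf_neq0.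
rewrite QE /=; congr (_ *: _).
have EX : dl * (x z + bsum b / 3 - bsum b * (z.1 ^+ (h1 + e) * z.2) / (z.1 ^+ e * Q1 z)) = aff b dl t + U z.
  by rewrite /aff /U /x -/S exprD; field; rewrite q0 ze.
rewrite EX; congr vec3; congr (_ + _); rewrite Ge exprD.
have EU : U z ^+ h1 = z.1 ^+ h1 * V z ^+ h1 by apply: lift_power.
by rewrite EU /W; field; rewrite expf_neq0.
Unshelve. all: by end_near. Qed.
End OneLift.

Lemma prod3 (f : 'I_3 -> C) a c i : a != c -> i != a -> i != c -> \prod_j f j = f i * (f a * f c).
Proof.
move=> ac ia ic; rewrite (bigD1 i) //= (@prod_others C f i a c) // eq_sym //.
Qed.

Lemma line_over3 b a c i (x D : C) : a != c -> i != a -> i != c ->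
  line b i (vec3 x (x ^+ 3 + D) 1) = \prod_j (x - b j) + D + bsum b * ((x - b a) * (x - b c)).
Proof.
move=> ac ia ic; rewrite line_over; congr (_ + _ * _).
case: (ord3_cases i a) ia ac => -> ia ac; first by rewrite eqxx in ia.
  by case: (ord3_cases i c) ic ac => -> ic ac //; [rewrite eqxx in ic | rewrite eqxx in ac].
by case: (ord3_cases i c) ic ac => -> ic ac; [rewrite eqxx in ic | rewrite mulrC | rewrite eqxx in ac].
Qed.

Lemma hol_sub0 t (k : C) : hol (fun z : C * C => t + z.1 - k).
Proof.
apply: hol_add; last exact: hol_cst.
by apply: hol_add; [exact: hol_cst | exact: hol_fst].
Qed.

Lemma hol_line_cchart b a t h : hol (fun z => line b a (cchart t h z.1 z.2)).
Proof.
have -> : (fun z : C * C => line b a (cchart t h z.1 z.2)) = fun z => (t + z.1 - 0) ^+ 3 + z.1 ^+ h * z.2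
   - slope b a * (t + z.1 - 0) + b (a + 1) * b (a + 2%:R) * (b (a + 1) + b (a + 2%:R)).
  by apply/funext => z; rewrite line_vec3 /slope subr0; ring.
have hx := hol_sub0 t 0.
apply: hol_add; last exact: hol_cst.
apply: hol_add; last by apply: hol_opp; apply: hol_mul => //; exact: hol_cst.
apply: hol_add; first exact: hol_exp.
by apply: hol_prod; [exact: hol_fst | exact: hol_snd].
Qed.

Lemma aff_bminus_eq b dl t a : dl != 0 -> (aff b dl t == bminus b dl a) = (t == b a - bsum b).
Proof.
move=> d0; rewrite /aff /bminus (inj_eq (mulfI d0)) -subr_eq0 -[in RHS]subr_eq0.
by congr (_ == 0); field.
Qed.

Lemma hol_div (f g : C * C -> C) : hol f -> hol g -> g 0 != 0 -> hol (fun z => f z / g z).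
Proof. by move=> hf hg g0; apply: hol_mul => //; apply: hol_inv. Qed.

(** If t = b j, then Q and the two sides through b j are divisible by u, which lowers the height. If
    t = b a - bsum b, the third point of C^* on side a, then the equation of this side, freed of u,
    is U times a unit, which raises the height. G collects the remaining factors. *)
Lemma point_lift b dl t h : dl != 0 -> nondeg b -> (forall a, (t, h) <> (b a, 0%N)) ->
  exists U W : C * C -> C, [/\ hol U, hol W, U 0 = 0, W 0 = 0 &
  \forall z \near (0 : C * C), exists k, qmap b dl (cchart t h z.1 z.2) =
    k *: cchart (point_map b dl (t, h)).1 (point_map b dl (t, h)).2 (U z) (W z)].
Proof.
move=> d0 nb np; rewrite point_map_nbase //=.
set e := [exists a, t == b a]; set el := [exists a, _ == _].
have S0 := nb.2; pose h1 := (h - e)%N.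
have h0 : (0 < h)%N || ~~ e.
  case: posnP => //= h0; apply/existsPn => a; apply/eqP => E; by apply: (np a); rewrite E h0.
have Eh : h = (h1 + e)%N by rewrite subnK //; case: (e) h0 => //=; rewrite orbF.
rewrite -/h1; clearbody h1; subst h.
have eP : e -> exists j, t = b j by move=> /existsP [j /eqP ->]; exists j.
have eN : ~~ e -> forall c, t - b c != 0 by move=> eF c; rewrite subr_eq0; move/existsPn: eF.
have hzw k : hol (fun z : C * C => z.1 ^+ k * z.2) by apply: hol_prod; [exact: hol_fst | exact: hol_snd].
have elP : el -> exists a, t = b a - bsum b.
  by move=> /existsP [a]; rewrite aff_bminus_eq // => /eqP; exists a.
clearbody e el; case: e {h0 np} eP eN => eP eN; [move: eP => /(_ isT) [j tj]|move: eN => /(_ isT) tb].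
- clear eN.
  have hole a c : hol (fun z => (t + z.1 - b a) * (t + z.1 - b c) + z.1 ^+ h1 * z.2).
    by apply: hol_add => //; apply: hol_mul; exact: hol_sub0.
  case: el elP => elP; last first.
    have [n1 n2 n3] := ord3_neq j.
    pose Q1 z := (t + z.1 - b (j + 1)) * (t + z.1 - b (j + 2%:R)) + z.1 ^+ h1 * z.2.
    have [m1 m2 m3] := nondeg_sub j nb.
    have Q10 : Q1 0 != 0 by rewrite /Q1 /= !addr0 mulr0 addr0 tj mulf_neq0.
    have QE z : \prod_c (t + z.1 - b c) + z.1 ^+ (h1 + true) * z.2 = z.1 ^+ true * Q1 z.
      by rewrite (big_ord3 _ _ j) /= /Q1 addn1 exprS expr1 tj; ring.
    pose G z := dl ^+ 3 * ((Q1 z + bsum b * (t + z.1 - b (j + 2%:R))) * (Q1 z + bsum b * (t + z.1 - b (j + 1)))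
       * line b j (cchart t (h1 + true) z.1 z.2)) / Q1 z ^+ 3.
    apply: (@one_lift b dl t h1 true false Q1 G) => //; first exact: hole.
      apply: hol_div; [|apply: hol_exp; exact: hole|by rewrite expf_neq0].
      apply: hol_mul; first exact: hol_cst.
      apply: hol_mul; last exact: hol_line_cchart.
      by apply: hol_mul; apply: hol_add; [exact: hole| |exact: hole|]; apply: hol_mul; [exact: hol_cst|exact: hol_sub0|exact: hol_cst|exact: hol_sub0].
    have nQ := hol_neq0 (hole (j + 1) (j + 2%:R)) Q10.
    near=> z; rewrite expr1 => z0; have q0 : Q1 z != 0 by near: z.
    rewrite (big_ord3 _ _ j) /= /G /cchart !line_over !ord3E !QE expr1 expr0 addn1 [z.1 ^+ h1.+1]exprS.
    have -> : t + z.1 - b j = z.1 by rewrite tj; ring.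
    by field; rewrite q0 z0.
  have [a ta] := elP isT.
  have aj : a != j.
    apply: contraNneq S0 => aj; move: ta; rewrite aj -tj => /eqP.
    by rewrite -subr_eq0 opprB addrC subrK.
  have [k [ka kj _]] := ord3_third aj.
  have [ak ja jk] : [/\ a != k, j != a & j != k] by split; rewrite eq_sym.
  pose Q1 z := (t + z.1 - b a) * (t + z.1 - b k) + z.1 ^+ h1 * z.2.
  have Q10 : Q1 0 != 0.
    by rewrite /Q1 /= !addr0 mulr0 addr0 tj mulf_neq0 // subr_eq0 (inj_eq nb.1) eq_sym.
  have Pz z : \prod_c (t + z.1 - b c) = z.1 * ((t + z.1 - b a) * (t + z.1 - b k)).
    by rewrite (prod3 _ ak ja jk) tj; congr (_ * _); ring.
  have QE z : \prod_c (t + z.1 - b c) + z.1 ^+ (h1 + true) * z.2 = z.1 ^+ true * Q1 z.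
    by rewrite Pz /Q1 addn1 exprS expr1; ring.
  pose G z := dl ^+ 2 * ((Q1 z + bsum b * (t + z.1 - b a))
       * line b j (cchart t (h1 + true) z.1 z.2)) / (Q1 z ^+ 2 * (t + z.1 - b a)).
  have pa0 : t - b a != 0 by rewrite ta addrC addKr oppr_eq0.
  have nQ := hol_neq0 (hole a k) Q10.
  have npa : \forall z \near (0 : C * C), t + z.1 - b a != 0.
    by apply: (hol_neq0 (hol_sub0 t (b a))); rewrite /= addr0.
  apply: (@one_lift b dl t h1 true true Q1 G) => //; first exact: hole.
    apply: hol_div; last by rewrite /= addr0 mulf_neq0 // expf_neq0.
      apply: hol_mul; first exact: hol_cst.
      apply: hol_mul; last exact: hol_line_cchart.
      by apply: hol_add; [exact: hole | apply: hol_mul; [exact: hol_cst|exact: hol_sub0]].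
    by apply: hol_mul; [apply: hol_exp; exact: hole | exact: hol_sub0].
  near=> z; rewrite expr1 => z0; have q0 : Q1 z != 0 by near: z.
  have p0 : t + z.1 - b a != 0 by near: z.
  rewrite (prod3 _ ak ja jk) /G /cchart.
  rewrite (line_over3 _ _ _ kj ak aj) (line_over3 _ _ _ aj ka kj).
  rewrite (line_over3 _ _ _ ak ja jk) !QE !expr1 addn1 [z.1 ^+ h1.+1]exprS.
  have -> : t + z.1 - b j = z.1 by rewrite tj; ring.
  have Ew : z.1 ^+ h1 * z.2 = Q1 z - (t + z.1 - b a) * (t + z.1 - b k) by rewrite /Q1; ring.
  have Ez : z.1 = t + z.1 - b a + bsum b by rewrite ta; ring.
  rewrite -[z.1 * _ * z.2]mulrA Ew.
  move: (Q1 z) (t + z.1 - b a) (t + z.1 - b k) (bsum b) q0 p0 Ez {Ew} => Q p r S q0 p0 Ez.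
  have U1 : z.1 - S * (Q - p * r) / Q = p * (Q + S * r) / Q by rewrite Ez; field.
  by rewrite U1; field; rewrite q0 p0 z0.
pose Q1 z := \prod_c (t + z.1 - b c) + z.1 ^+ h1 * z.2.
have hQ : hol Q1.
  have -> : Q1 = fun z => (t + z.1 - b 0) * ((t + z.1 - b 1) * (t + z.1 - b 2%:R)) + z.1 ^+ h1 * z.2.
    by apply/funext => z; rewrite /Q1 (big_ord3 _ _ 0) /= !add0r.
  by apply: hol_add => //; apply: hol_mul; [|apply: hol_mul]; exact: hol_sub0.
have Q10 : Q1 0 != 0.
  rewrite /Q1 mulr0 addr0; apply/prodf_neq0 => c _; by rewrite /= addr0.
have nQ := hol_neq0 hQ Q10.
have QE z : \prod_c (t + z.1 - b c) + z.1 ^+ (h1 + false) * z.2 = z.1 ^+ false * Q1 z.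
  by rewrite addn0 expr0 mul1r.
case: el elP => elP; last first.
  pose G z := dl ^+ 3 * (line b 0 (cchart t (h1 + false) z.1 z.2) * (line b 1 (cchart t (h1 + false) z.1 z.2) * line b 2%:R (cchart t (h1 + false) z.1 z.2))) / Q1 z ^+ 3.
  apply: (@one_lift b dl t h1 false false Q1 G) => //.
    apply: hol_div; [|apply: hol_exp; exact: hQ|by rewrite expf_neq0].
    apply: hol_mul; first exact: hol_cst.
    by apply: hol_mul; [|apply: hol_mul]; exact: hol_line_cchart.
  near=> z => _; have q0 : Q1 z != 0 by near: z.
  by rewrite (big_ord3 _ _ 0) /= !add0r /G !expr0 addn0; field.
have [a ta] := elP isT; have [n1 n2 n3] := ord3_neq a.
pose G z := dl ^+ 2 * (line b (a + 1) (cchart t (h1 + false) z.1 z.2)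
   * line b (a + 2%:R) (cchart t (h1 + false) z.1 z.2)) / (Q1 z ^+ 2 * (t + z.1 - b a)).
have pa0 : t - b a != 0 by [].
have npa : \forall z \near (0 : C * C), t + z.1 - b a != 0.
  by apply: (hol_neq0 (hol_sub0 t (b a))); rewrite /= addr0.
apply: (@one_lift b dl t h1 false true Q1 G) => //.
  apply: hol_div; last by rewrite /= addr0 mulf_neq0 // expf_neq0.
    apply: hol_mul; first exact: hol_cst.
    by apply: hol_mul; exact: hol_line_cchart.
  by apply: hol_mul; [apply: hol_exp; exact: hQ | exact: hol_sub0].
near=> z => _; have q0 : Q1 z != 0 by near: z.
have p0 : t + z.1 - b a != 0 by near: z.
rewrite (big_ord3 _ _ a) /= /G expr0 expr1 /cchart; move: (line b (a + 1) _) (line b (a + 2%:R) _) => L1 L2.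
rewrite line_over QE expr0 mul1r addn0.
have EQ : Q1 z = (t + z.1 - b a) * ((t + z.1 - b (a + 1)) * (t + z.1 - b (a + 2%:R))) + z.1 ^+ h1 * z.2.
  by rewrite /Q1 (big_ord3 _ _ a).
have Ez : z.1 = t + z.1 - b a + bsum b by rewrite ta; ring.
move: (z.1 ^+ h1 * z.2) EQ => D EQ.
move: (Q1 z) (t + z.1 - b a) (t + z.1 - b (a + 1)) (t + z.1 - b (a + 2%:R)) (bsum b) q0 p0 Ez EQ => Q p r s S q0 p0 Ez EQ.
have U1 : z.1 - S * D / Q = p * (Q + S * (r * s)) / Q.
  have -> : D = Q - p * (r * s) by rewrite EQ; ring.
  by rewrite Ez; field.
by rewrite U1; field; rewrite q0 p0.
Unshelve. all: by end_near. Qed.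
End Lifts.

(** * Lifts as local biholomorphisms *)

Section MapsTo.
Variable C : numFieldType.
Hypothesis closed : forall p : {poly C}, size p != 1 -> exists x, root p x.
Implicit Types (b : 'I_3 -> C) (dl t u w : C) (a c : 'I_3) (x : 'rV[C]_3) (z : C * C).

Lemma cchart_eq t h (k : C) z z' : k != 0 -> z.1 != 0 ->
  k *: cchart t h z.1 z.2 = k *: cchart t h z'.1 z'.2 -> z' = z.
Proof.
move=> k0 z0 /(scalerI k0) E.
have := congr1 (fun M : 'rV[C]_3 => M 0 0) E; rewrite !mxE /= => /addrI E1.
have := congr1 (fun M : 'rV[C]_3 => M 0 1) E; rewrite !mxE /= E1 => /addrI.
have z0' : z'.1 ^+ h != 0 by rewrite expf_neq0 // -E1.
by move=> /(mulfI z0') E2; rewrite [z]surjective_pairing E1 E2 -surjective_pairing.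
Qed.

Lemma hol_tail t h (f : C * C -> C) : hol f -> hol (fun z => tail t h (f z)).
Proof.
have hk (k : C) i : hol f -> hol (fun z => k * f z ^+ i).
  by move=> hf; apply: hol_mul; [exact: hol_cst | exact: hol_exp].
move=> hf; case: h => [|[|[|h]]] /=; last exact: hol_cst.
- by apply: hol_add; [apply: hol_add|]; [apply: hol_mul; [exact: hol_cst|]|exact: hk|exact: hol_exp].
- by apply: hol_add; [apply: hol_mul; [exact: hol_cst|]|exact: hol_exp].
- exact: hf.
Qed.

Definition shear t h z : C * C := (z.1, z.2 - tail t h z.1).
Definition unshear t h z : C * C := (z.1, z.2 + tail t h z.1).

Lemma shearK t h : cancel (shear t h) (unshear t h).
Proof. by move=> [u w]; rewrite /shear /unshear /= subrK. Qed.

Lemma hol_shear t h : holomorphic_at0 (shear t h).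
Proof.
apply: hol_pair; first exact: hol_fst.
by apply: hol_add; [exact: hol_snd | apply/hol_opp/hol_tail; exact: hol_fst].
Qed.

Lemma hol_unshear t h : holomorphic_at0 (unshear t h).
Proof.
apply: hol_pair; first exact: hol_fst.
by apply: hol_add; [exact: hol_snd | apply: hol_tail; exact: hol_fst].
Qed.

Lemma shear0 t h : shear t h 0 = 0.
Proof. by rewrite /shear /= tail0 subr0. Qed.

Lemma unshear0 t h : unshear t h 0 = 0.
Proof. by rewrite /unshear /= tail0 addr0. Qed.

Lemma hol_comp2 (phi psi : C * C -> C * C) : phi 0 = 0 -> holomorphic_at0 phi ->
  holomorphic_at0 psi -> holomorphic_at0 (fun z => psi (phi z)).
Proof.
move=> p0 hp hs; have hs' := near0_comp p0 hp hs.
by near=> z; apply: (@differentiable_comp _ _ _ _ phi psi); near: z.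
Unshelve. all: by end_near. Qed.

(* The two lifts are inverse to each other off the curve contracted by [quad]. *)
Lemma lift_cancel b dl t h t' h' (phi psi : C * C -> C * C) : dl != 0 -> nondeg b ->
  phi 0 = 0 -> holomorphic_at0 phi -> psi 0 = 0 -> holomorphic_at0 psi ->
  (\forall z \near (0 : C * C), collinear (qmap b dl (chart (cpoint (t, h)) z)) (chart (cpoint (t', h')) (phi z))) ->
  (\forall z \near (0 : C * C), collinear (qmap (bminus b dl) dl^-1 (chart (cpoint (t', h')) z)) (chart (cpoint (t, h)) (psi z))) ->
  \forall z \near (0 : C * C), psi (phi z) = z.
Proof.
move=> d0 nb p0 hp s0 hs Hphi Hpsi.
have Hpsi' := near0_comp p0 hp Hpsi.
pose f z : C := \prod_a line b a (chart (cpoint (t, h)) z) * z.1.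
have E : \forall z \near (0 : C * C), f z != 0 -> psi (phi z) = z.
  near=> z; rewrite mulf_eq0 negb_or => /andP[l0 z0].
  have [k Ek] : collinear (qmap b dl (chart (cpoint (t, h)) z)) (chart (cpoint (t', h')) (phi z)) by near: z.
  have [k' Ek'] : collinear (qmap (bminus b dl) dl^-1 (chart (cpoint (t', h')) (phi z)))
     (chart (cpoint (t, h)) (psi (phi z))) by near: z.
  have := qmapK (chart (cpoint (t, h)) z) d0 nb; rewrite Ek qmapZ Ek' scalerA.
  set m := _ * _ => E.
  have m0 : m != 0.
    apply: contraNneq l0 => m0.
    have := congr1 (fun M : 'rV[C]_3 => M 0 2%:R) E.
    rewrite m0 scale0r !chart_cpoint !mxE /= mulr1 => /esym /eqP.
    by rewrite mulf_eq0 expf_eq0 /= (negbTE d0).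
  have Em : m = dl ^+ 3 * \prod_a line b a (chart (cpoint (t, h)) z).
    have := congr1 (fun M : 'rV[C]_3 => M 0 2%:R) E.
    by rewrite !chart_cpoint !mxE /= !mulr1.
  move: E; rewrite -Em !chart_cpoint => /esym E.
  apply: (can_inj (shearK t h)); exact: (@cchart_eq t h m (shear t h z) (shear t h (psi (phi z))) m0 z0 E).
have tf : thick f.
  apply: thick_mul; last by apply: nowhere_thick; exact: nowhere_fst.
    have -> : (fun z => \prod_a line b a (chart (cpoint (t, h)) z)) = fun z =>
       line b 0 (chart (cpoint (t, h)) z) * (line b 1 (chart (cpoint (t, h)) z) * line b 2%:R (chart (cpoint (t, h)) z)).
      by apply/funext => z; rewrite (big_ord3 _ _ 0) /= !add0r.
    by do 2![apply: hol_mul; first exact: hol_line]; exact: hol_line.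
  have -> : (fun z => \prod_a line b a (chart (cpoint (t, h)) z)) = fun z =>
     line b 0 (chart (cpoint (t, h)) z) * (line b 1 (chart (cpoint (t, h)) z) * line b 2%:R (chart (cpoint (t, h)) z)).
    by apply/funext => z; rewrite (big_ord3 _ _ 0) /= !add0r.
  by apply: thick_mul; [exact: hol_line|exact: thick_line|apply: thick_mul; [exact: hol_line|exact: thick_line|exact: thick_line]].
have h1 : hol (fun z => (psi (phi z)).1).
  by apply: (@hol_comp C (fun z => (psi z).1) phi p0 hp); apply: (@hol_comp C fst psi s0 hs); exact: hol_fst.
have h2 : hol (fun z => (psi (phi z)).2).
  by apply: (@hol_comp C (fun z => (psi z).2) phi p0 hp); apply: (@hol_comp C snd psi s0 hs); exact: hol_snd.
have E1 : \forall z \near (0 : C * C), (psi (phi z)).1 = z.1.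
  by apply: (thick_eq tf h1 (@hol_fst C)); apply: filterS E => z H /H ->.
have E2 : \forall z \near (0 : C * C), (psi (phi z)).2 = z.2.
  by apply: (thick_eq tf h2 (@hol_snd C)); apply: filterS E => z H /H ->.
near=> z; rewrite [LHS]surjective_pairing [RHS]surjective_pairing; congr pair; near: z; [exact: E1|exact: E2].
Unshelve. all: by end_near. Qed.

Lemma point_lift_chart b dl p : dl != 0 -> nondeg b -> (forall a, p <> (b a, 0%N)) ->
  exists phi : C * C -> C * C, [/\ phi 0 = 0, holomorphic_at0 phi &
   \forall z \near (0 : C * C), collinear (qmap b dl (chart (cpoint p) z)) (chart (cpoint (point_map b dl p)) (phi z))].
Proof.
case: p => t h d0 nb np; have [U [W [hU hW U0 W0 H]]] := point_lift d0 nb np.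
case: (point_map _ _ _) H => t' h' /= H.
have h1 := hol_comp2 (shear0 t h) (hol_shear t h) (hol_pair hU hW).
exists (fun z => unshear t' h' (U (shear t h z), W (shear t h z))); split.
- by rewrite shear0 U0 W0 unshear0.
- by apply: (hol_comp2 _ h1 (hol_unshear t' h')); rewrite shear0 U0 W0.
- have H' := near0_comp (shear0 t h) (hol_shear t h) H.
  near=> z; have [k Ek] : exists k : C,
    qmap b dl (cchart t h (shear t h z).1 (shear t h z).2) = k *: cchart t' h' (U (shear t h z)) (W (shear t h z)).
    by near: z.
  by exists k; rewrite !chart_cpoint Ek /= addrK.
Unshelve. all: by end_near. Qed.

(** No Jacobian is computed: [point_lift] applied to the inverse map provides the inverse germ. *)
Lemma quad_maps_to b dl (d0 : dl != 0) (nb : nondeg b) p : (forall a, p <> (b a, 0%N)) ->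
  maps_to (quad closed d0 nb) (cpoint p) (cpoint (point_map b dl p)).
Proof.
move=> np; have [phi [p0 hp Hp]] := point_lift_chart d0 nb np.
have d0' : dl^-1 != 0 by rewrite invr_eq0.
have np' a : point_map b dl p <> (bminus b dl a, 0%N) by apply: point_map_nbase_minus.
have [psi [s0 hs Hs]] := point_lift_chart d0' (nondeg_minus d0 nb) np'.
move: Hs; rewrite (point_mapK nb.1 d0) => Hs.
case: p {np np'} (point_map b dl p) Hp Hs => t h [t' h'] Hp Hs.
exists phi; split; last by apply: filterS Hp => z; rewrite rmap_eval.
split=> //; exists psi; split=> //; first exact: (lift_cancel d0 nb p0 hp s0 hs Hp Hs).
apply: (lift_cancel d0' (nondeg_minus d0 nb) s0 hs p0 hp Hs).
by rewrite (bminusK b d0) invrK.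
Qed.
End MapsTo.

(** * Realization *)

Section Sequences.
Variable R : realFieldType.
Implicit Types (x y z : R * seq R).

Lemma reach_seq x z : reach x z -> exists n (y : nat -> R * seq R) (e : nat -> 'I_3 -> R),
  [/\ y 0%N = x, (y n).1 = z.1 /\ perm_eq (y n).2 z.2 &
   forall l, (l < n)%N -> legal (y l).1 (e l 0) (e l 1) (e l 2%:R) /\
     cstep (y l) (e l 0) (e l 1) (e l 2%:R) (y l.+1)].
Proof.
elim=> {x z} [x z E P|x a b c y z L S _ [n [Y [e [Y0 Yn H]]]]]; first by exists 0, (fun=> x), (fun _ _ => 0).
exists n.+1, (fun l => if l is l'.+1 then Y l' else x),
  (fun l => if l is l'.+1 then e l' else fun i : 'I_3 => nth 0 [:: a; b; c] i); split=> // -[|l] ln /=.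
  by rewrite Y0.
by apply: H.
Qed.

(* In the coordinate of the cubic, where three points are collinear when their parameters sum to 0. *)
Definition shifted x := [seq t - x.1 / 3 | t <- x.2].

Lemma legal_nondeg x (e : 'I_3 -> R) : legal x.1 (e 0) (e 1) (e 2%:R) ->
  nondeg (fun a => e a - x.1 / 3).
Proof.
case=> n1 n2 n3 ns; split.
  move=> i j /addIr; case: (ord3_cases 0 i) => ->; case: (ord3_cases 0 j) => -> //; rewrite !add0r => E;
  by rewrite E eqxx in n1 n2 n3.
rewrite /bsum (big_ord3 _ _ 0) /= !add0r; apply: contra ns => /eqP E; apply/eqP; lra.
Qed.

(** The multiplier is free, since values on the target copy may be rescaled; this is how the factor
    lambda is inserted. *)
Lemma cstep_mult x (e : 'I_3 -> R) y dl : cstep x (e 0) (e 1) (e 2%:R) y ->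
  mult_step (fun a => e a - x.1 / 3) dl (shifted x) [seq dl * t | t <- shifted y].
Proof.
have S : bsum (fun a => e a - x.1 / 3) = e 0 + e 1 + e 2%:R - x.1.
  by rewrite /bsum (big_ord3 _ _ 0) /= !add0r; field.
have E3 (f : 'I_3 -> R) : [seq f a | a : 'I_3] = [:: f 0; f 1; f 2%:R].
  have E : enum 'I_3 = [:: 0; 1; 2%:R] by apply: (inj_map val_inj); rewrite val_enum_ord.
  by rewrite -[RHS]/(map f [:: 0; 1; 2%:R]) -E.
case=> u [P1 Ey P2]; exists [seq t - x.1 / 3 | t <- u]; rewrite !E3; split.
  by rewrite (perm_trans (perm_map _ P1)) //=.
rewrite -map_comp (perm_trans (perm_map _ P2)) //=; apply: eq_perm.
rewrite /bminus /aff S Ey -!map_comp; congr [:: _, _, _ & _]; [by field|by field|by field|].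
by apply: eq_map => t /=; field.
Qed.

Lemma mult_step_map (F : numFieldType) (f : {rmorphism R -> F}) b dl s s' : mult_step b dl s s' ->
  mult_step (fun a => f (b a)) (f dl) (map f s) (map f s').
Proof.
have S : bsum (fun a => f (b a)) = f (bsum b) by rewrite /bsum rmorph_sum.
have E3 (g : 'I_3 -> R) : map f [seq g a | a : 'I_3] = [seq f (g a) | a : 'I_3].
  by rewrite -map_comp.
case=> u [P1 P2]; exists (map f u); split.
  by rewrite (perm_trans (perm_map f P1)) // map_cat E3.
rewrite (perm_trans (perm_map f P2)) // map_cat E3 -!map_comp; apply: eq_perm; congr (_ ++ _).
  by apply: eq_image => // a; rewrite /bminus S !(rmorphM, rmorphB, fmorphV, rmorph_nat).
by apply: eq_map => t /=; rewrite /aff S rmorphM rmorphD rmorphM fmorphV rmorph_nat.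
Qed.

Lemma nondeg_map (F : numFieldType) (f : {rmorphism R -> F}) b : nondeg b -> nondeg (fun a => f (b a)).
Proof.
case=> bi b0; split; first by move=> i j /fmorph_inj /bi.
by rewrite /bsum -rmorph_sum fmorph_eq0.
Qed.
End Sequences.

Section Realization.
Variable C : numFieldType.
Hypothesis closed : forall p : {poly C}, size p != 1 -> exists x, root p x.
Variables (n : nat) (b : nat -> 'I_3 -> C) (dl : nat -> C) (ts : nat -> seq C).
Hypotheses (n0 : (0 < n)%N) (bi : forall l, (l < n)%N -> injective (b l))
  (d0 : forall l, (l < n)%N -> dl l != 0)
  (st : forall l, (l < n)%N -> mult_step (b l) (dl l) (ts l) (ts l.+1))
  (stn : perm_eq (ts n) (ts 0)) (b0 : forall l, (l < n)%N -> bsum (b l) != 0).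

Definition quad_at (l : 'I_n) : quadratic_map C :=
  quad closed (d0 (ltn_ord l)) (conj (bi (ltn_ord l)) (b0 (ltn_ord l))).

Lemma orbit_realizes : @realizes C (orbit_of_quadratics n0 bi d0 st stn) quad_at.
Proof.
exists (fun i : Kset n => cbase (b i.1 i.2)), (fun i : Kset n => cbase (bminus (b i.1) (dl i.1) i.2)).
split=> [l|]; first exact: quad_labelling.
have ltm m : (m %% n < n)%N by rewrite ltn_mod.
exists (fun (iota : Kset n) m => (Ordinal (ltm (iota.1.+1 + m)%N), cpoint (flow n b dl (iota.1.+1 + m) (start b dl iota)))).
move=> iota; set N := return_time n0 bi d0 st stn iota.
have [lt1 _ nohit] := return_timeP n0 bi d0 st stn iota.
have muE : (iota.1.+1 + @mu (orbit_of_quadratics n0 bi d0 st stn) iota)%N = N.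
  by rewrite mu_orbit subnKC.
have nb m a : (m < @mu (orbit_of_quadratics n0 bi d0 st stn) iota)%N ->
    flow n b dl (iota.1.+1 + m) (start b dl iota) <> (b ((iota.1.+1 + m) %% n) a, 0%N).
  move=> lt E; have range : (iota.1 < iota.1.+1 + m < N)%N by rewrite leq_addr -muE ltn_add2l.
  by apply: (negP (nohit _ range)); apply/existsP; exists a; rewrite E.
split=> [|m lt|m lt iota'|].
- congr pair; last by rewrite addn0 flow_start_next.
  by apply: val_inj; rewrite /= addn0.
- split; first by apply: val_inj; rewrite /= -[in RHS]addn1 modnDml addn1 addnS.
  by rewrite addnS /=; apply: quad_maps_to => a; apply: nb.
- move=> E; have E1 := congr1 (fun x => nat_of_ord x.1) E; rewrite /= in E1.
  have := congr1 snd E; rewrite -[snd (iota'.1, _)]/(cpoint (b iota'.1 iota'.2, 0%N)) => /cpoint_inj.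
  by rewrite -E1; apply: nb.
- have := flow_succ n0 bi d0 st stn iota; rewrite -/N -muE => ->.
  rewrite [od_sigma _ iota]permE; congr pair.
  by apply: val_inj; rewrite /= muE.
Qed.
End Realization.

Theorem theorem1p5 (R : realType) (tau : orbit_data) :
  1 < lambda tau R ->
  exists tau' : orbit_data,
    [/\ lambda tau' R = lambda tau R,
        1 < lambda tau' R,
        realizability tau'
      & exists (f : 'I_(od_n tau') -> quadratic_map R[i])
               (delta : 'I_(od_n tau') -> R[i]),
          [/\ forall l, in_QC (f l),
              realizes f,
              forall l, is_delta (f l) (delta l)
            & \prod_l delta l = (lambda tau' R)%:C%C]].
Proof.
set la := lambda tau R => l1.
have l0 : 0 < la by apply: lt_trans l1.
have [r r1 Hr] := lambda_gt1_real l1.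
have c01 : 0 < la^-1 < 1 by rewrite invr_gt0 l0 invf_lt1.
have [n [y [e [y0 [yn1 yn2] H]]]] := reach_seq (eigenfun_reach r1 c01 Hr).
have [d1 s1] : (y 0%N).1 = 1 /\ (y 0%N).2 = (cstate r).2 by rewrite y0.
rewrite /= r1 mulr1 in yn1.
have n0 : (0 < n)%N.
  rewrite lt0n; apply/eqP => E; have : la^-1 < 1 by case/andP: c01.
  by rewrite -yn1 E d1 ltxx.
(* Stage n is stage 0 divided by lambda on the same plane, so it is multiplied by lambda. The last
   map then has multiplier lambda and all others 1. *)
pose sc l : R := if l == n then la else 1.
have sc0 l : sc l != 0 by rewrite /sc; case: ifP => _; rewrite ?oner_neq0 ?gt_eqF.
have scn l : (l < n)%N -> sc l = 1 by move=> ln; rewrite /sc ltn_eqF.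
pose f : {rmorphism R -> R[i]} := real_complex R.
pose b l a := f (e l a - (y l).1 / 3).
pose dl l := f (sc l.+1).
pose ts l := [seq f (sc l * t) | t <- shifted (y l)].
pose dd l := f (sc l * (y l).1).
have nb l : (l < n)%N -> nondeg (b l).
  by move=> /H [L _]; apply: (@nondeg_map _ _ f); apply: legal_nondeg.
have bi l : (l < n)%N -> injective (b l) by case/nb.
have b0 l : (l < n)%N -> bsum (b l) != 0 by case/nb.
have d0 l : (l < n)%N -> dl l != 0 by move=> _; rewrite fmorph_eq0.
have st l : (l < n)%N -> mult_step (b l) (dl l) (ts l) (ts l.+1).
  move=> ln; have [_ S] := H l ln; have := mult_step_map f (cstep_mult (sc l.+1) S).
  have -> : map f (shifted (y l)) = ts l by apply: eq_map => t; rewrite scn // mul1r.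
  by rewrite -map_comp.
have stn : perm_eq (ts n) (ts 0%N).
  rewrite /ts /shifted /sc eqxx ltn_eqF // -!map_comp.
  apply: (perm_trans (perm_map _ yn2)); rewrite s1 -map_comp; apply: eq_perm; apply: eq_map => t /=.
  by rewrite yn1 d1; congr (f _); field; rewrite gt_eqF.
have dd_step l : (l < n)%N -> dd l.+1 = dl l * (dd l - bsum (b l)).
  move=> ln; have [_ [u [_ Ey _]]] := H l ln.
  have -> : bsum (b l) = f (e l 0 + e l 1 + e l 2%:R - (y l).1).
    by rewrite /bsum (big_ord3 _ _ 0) /= !add0r -!rmorphD; congr (f _); field.
  by rewrite /dd Ey (scn l ln) mul1r -rmorphB -rmorphM.
have dd_n : dd n = dd 0%N.
  by rewrite /dd /sc eqxx ltn_eqF // yn1 d1 divff ?mulr1 // gt_eqF.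
have prod_dl : \prod_(i < n) dl i = f la.
  rewrite -[in LHS](prednK n0) big_ord_recr /= big1 ?mul1r => [|i _].
    by rewrite /dl prednK // /sc eqxx.
  by rewrite /dl scn ?rmorph1 // -[X in (_ < X)%N](prednK n0) ltnS.
pose tau' := orbit_of_quadratics n0 bi d0 st stn.
have normla : Normc.normc (f la) = la by rewrite /f /= /Normc.normc expr0n addr0 sqrtr_sqr gtr0_norm.
have El : lambda tau' R = la.
  rewrite -[RHS]normla; apply: (@lambda_eigenfun R tau' (class_fun dd n)); last by rewrite normla.
    by exists None; rewrite /= dd_n /dd d1 mulr1 fmorph_eq0.
  by have := class_fun_eigen (n0 := n0) (bi := bi) (d0 := d0) (st := st) (stn := stn) dd_step dd_n; rewrite prod_dl.
have closed : forall p : {poly R[i]}, size p != 1%N -> exists x, root p x by move=> p /closed_rootP.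
exists tau'; split; rewrite ?El //.
  apply: (orbit_realizability dd_step dd_n b0) => k k0; rewrite prod_dl -rmorphXn fmorph_eq1.
  by rewrite gt_eqF // exprn_egt1 // -lt0n.
exists (quad_at closed bi d0 b0), (fun l => dl l); split=> [l||l|].
- exact: quad_QC.
- exact: orbit_realizes.
- exact: quad_delta.
- exact: prod_dl.
Qed.
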